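(* Let $\mu$ be a Borel probability measure on $\mathbb{C}$ supported in the unit circle $\partial\mathbb{D}$, and let $Z=Z_1,Z_2,\dots$ be i.i.d. complex-valued random variables with law $\mu$ on a probability space $(\Omega,\mathbb{P})$. Put $P_n(\omega)(z)=(z-Z_1(\omega))\cdots(z-Z_n(\omega))$. Let $\lambda_{n,j}:\Omega\to\mathbb{C}$ ($n=2,3,\dots$, $j=1,\dots,n$) be such that, almost surely, $\sum_{j=1}^n\lambda_{n,j}\ne0$ for all $n$. Let $$Q_n(\omega)(z)=P_n(\omega)(z)\sum_{j=1}^n\frac{\lambda_{n,j}(\omega)}{z-Z_j(\omega)},$$ which almost surely is a polynomial of degree $n-1$; let $W_{n,1}(\omega),\dots,W_{n,n-1}(\omega)$ be its zeros, counted with multiplicity, and let $\mu_n(\omega)=\frac{1}{n-1}\sum_{j=1}^{n-1}\delta_{W_{n,j}(\omega)}$. Assume that there is a constant $M>0$ such that, almost surely, $|W_{n,j}|\le M$ for all $n,j$. Then $\mu_n\rightharpoonup\mu$ as $n\to\infty$ almost surely if there are constants $K,\delta>0$ and $b_0,b_1,b_2,\dots\in\mathbb{C}$, with at least one of the $b_m$ non-zero, such that the following three conditions hold: (i) for every $m=0,1,2,\dots$, $\displaystyle\frac1n\sum_{j=1}^n\overline{\lambda_{n,j}}\,Z_j^{m+1}\to b_m$ as $n\to\infty$ almost surely; (ii) almost surely, $\displaystyle\frac1n\sum_{j=1}^n|\lambda_{n,j}|\le K$ for all $n$; (iii) almost surely, $\displaystyle\frac1n\Big|\sum_{j=1}^n\lambda_{n,j}\Big|\ge\delta$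 for all $n$. This result is applicable (so that $\mu_n\rightharpoonup\mu$ as $n\to\infty$ almost surely) in each of the following cases: (a) $Q_n$ is the polar derivative of $P_n$ with respect to $\xi$, where $\xi\in\mathbb{C}$ is any fixed number with $|\xi|>1$ if $\mu$ is uniform, and $|\xi|>\max\{1,1/|\mathbb{E}[Z]|\}$ if $\mu$ is non-uniform (with $1/0=+\infty$); (b) $\mu$ is non-uniform and $Q_n$ is any Sz.-Nagy's generalized derivative of $P_n$ such that each $\lambda_{n,j}$ is degenerate (i.e. almost surely constant, where the constant may depend on $n$ and $j$) and there is a constant $M'>0$ such that, almost surely, $\lambda_{n,j}\le M'$ for all $n,j$.
   Context: $\partial\mathbb{D}=\{z\in\mathbb{C}:|z|=1\}$. A probability measure $\mu$ on $\mathbb{C}$ (with the Borel $\sigma$-algebra) is supported in a closed set $S$ if $\mu(S)=1$. ''Uniform'' means that $\mu$ is the uniform probability distribution (normalized arc length) on $\partial\mathbb{D}$. $\delta_x$ is the Dirac measure at $x$, $\rightharpoonup$ denotes weak convergence of probability measures on $\mathbb{C}$, and $\mathbb{E}$ is expectation with respect to $\mathbb{P}$. For a polynomial $P(z)=(z-z_1)\cdots(z-z_n)$ and $\lambda_1,\dots,\lambda_n\in\mathbb{C}$ with $\sum_{j=1}^n\lambda_j\neq0$, let $Q(z)=P(z)\sum_{j=1}^n\frac{\lambda_j}{z-z_j}$ (a polynomial of degree $n-1$). $Q$ is called the polar derivative of $P$ with respect to $\xi\in\mathbb{C}$ if $\lambda_j=\xi-z_j$ for all $j$; in that case $Q(z)=nP(z)-(z-\xi)P'(z)$.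 $Q$ is called a Sz.-Nagy's generalized derivative of $P$ if $\lambda_j>0$ for all $j$ and $\sum_{j=1}^n\lambda_j=n$. *)

(* Defs.v *)
From HB Require Import structures.
From mathcomp Require Import all_boot all_order all_algebra.
From mathcomp Require Import finmap.
From mathcomp Require Import all_classical all_reals all_analysis.
From mathcomp Require Import complex.

Set Implicit Arguments.
Unset Strict Implicit.
Unset Printing Implicit Defensive.

Import Order.TTheory GRing.Theory Num.Theory.
Import numFieldNormedType.Exports.

Local Open Scope classical_set_scope.
Local Open Scope ring_scope.
Local Open Scope complex_scope.

(* The complex numbers are [R[i]], with the topology of the modulus (the one of
   any [numFieldType]) and its Borel sigma-algebra. *)
HB.instance Definition _ (R : realType) :=
  PseudoPointedMetric.copy R[i] R[i]^o.
HB.instance Definition _ (R : realType) :=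
  PseudoMetricNormedZmod.copy R[i] R[i]^o.
HB.instance Definition _ (R : realType) :=
  Measurable.copy R[i] (g_sigma_algebraType (@open R[i])).

Definition unit_circle (R : realType) : set R[i] := [set z | `|z| = 1].

Lemma pi2_gt0 (R : realType) : 0 < 2 * pi :> R.
Proof. by rewrite mulr_gt0 ?pi_gt0. Qed.

(* Normalized arc length is the image of the uniform distribution on [0, 2 pi]
   by t |-> e^{it}. *)
Definition uniform_on_circle (R : realType) (mu : set R[i] -> \bar R) :=
  forall A : set R[i], measurable A ->
    mu A = pushforward (uniform_prob (@pi2_gt0 R))
                       (fun t : R => cos t +i* sin t) A.

Definition mutually_independent (R : realType) (d d' : measure_display)
    (Omega : measurableType d) (T : measurableType d')
    (P : probability Omega R) (Z : nat -> {RV P >-> T}) :=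
  forall (J : {fset nat}) (A : nat -> set T), (forall j, measurable (A j)) ->
    P (\bigcap_(j in [set` J]) Z j @^-1` A j) =
    (\prod_(j <- J) P (Z j @^-1` A j))%E.

Definition iid (R : realType) (d d' : measure_display)
    (Omega : measurableType d) (T : measurableType d')
    (P : probability Omega R) (Z : nat -> {RV P >-> T})
    (mu : probability T R) :=
  mutually_independent Z /\
  forall j (A : set T), measurable A -> distribution P (Z j) A = mu A.

Definition Cexpectation (R : realType) (d : measure_display)
    (Omega : measurableType d) (P : probability Omega R) (X : Omega -> R[i]) :=
  fine 'E_P[fun w => complex.Re (X w)] +i* fine 'E_P[fun w => complex.Im (X w)].

Definition weak_cvg (R : realType) (nu : nat -> {measure set R[i] -> \bar R})
    (mu : {measure set R[i] -> \bar R}) :=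
  forall f : R[i] -> R, continuous f -> (exists B : R, forall z, `|f z| <= B) ->
    (\int[nu n]_z (f z)%:E)%E @[n --> \oo] --> (\int[mu]_z (f z)%:E)%E.

Definition root_poly (F : fieldType) (n : nat) (z : 'I_n -> F) : {poly F} :=
  \prod_(j < n) ('X - (z j)%:P).

(* P(x) * \sum_j l_j / (x - z_j) as a polynomial in x; see [horner_gen_deriv]. *)
Definition gen_deriv (F : fieldType) (n : nat) (z l : 'I_n -> F) : {poly F} :=
  \sum_(j < n) l j *: \prod_(k < n | k != j) ('X - (z k)%:P).

Lemma horner_gen_deriv (F : fieldType) n (z l : 'I_n -> F) (x : F) :
  (forall j, x != z j) ->
  (gen_deriv z l).[x] = (root_poly z).[x] * \sum_(j < n) l j / (x - z j).
Proof.
move=> xz; rewrite horner_sum mulr_sumr; apply: eq_bigr => j _.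
rewrite hornerZ /root_poly [in RHS](bigD1 j)//= hornerM hornerXsubC.
by rewrite mulrC [in RHS]mulrC mulrA divfK ?subr_eq0// mulrC.
Qed.

Lemma size_gen_deriv (F : fieldType) n (z l : 'I_n -> F) :
  \sum_(j < n) l j != 0 -> size (gen_deriv z l) = n.
Proof.
move=> l0.
have n0 : (0 < n)%N by case: n z l l0 => // z l; rewrite big_ord0 eqxx.
have sz j : size (\prod_(k < n | k != j) ('X - (z k)%:P)) = n.
  rewrite (eq_bigl [in predC1 j])// -big_enum size_prod_XsubC -cardE.
  by rewrite cardC1 card_ord prednK.
have lc : (gen_deriv z l)`_n.-1 = \sum_(j < n) l j.
  rewrite coef_sum; apply: eq_bigr => j _.
  have /monicP : \prod_(k < n | k != j) ('X - (z k)%:P) \is monic.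
    by rewrite monic_prod// => k _; exact: monicXsubC.
  by rewrite /lead_coef sz coefZ => ->; rewrite mulr1.
apply/eqP; rewrite eqn_leq; apply/andP; split.
  apply: (leq_trans (size_sum _ _ _)); apply/bigmax_leqP => j _.
  by rewrite (leq_trans (size_scale_leq _ _))// sz.
rewrite -[leqLHS](prednK n0) ltnNge; apply: contra l0 => /leq_sizeP.
by move=> /(_ _ (leqnn _)); rewrite lc => ->.
Qed.

(* The zeros with multiplicity, in an unspecified order. *)
Definition zeros (F : closedFieldType) (p : {poly F}) : seq F :=
  sval (closed_field_poly_normal p).

Lemma zerosE (F : closedFieldType) (p : {poly F}) :
  p = lead_coef p *: \prod_(x <- zeros p) ('X - x%:P).
Proof. exact: svalP (closed_field_poly_normal p). Qed.

Lemma size_zeros (F : closedFieldType) (p : {poly F}) :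
  p != 0 -> size (zeros p) = (size p).-1.
Proof.
move=> p0; rewrite [in RHS](zerosE p) size_scale ?lead_coef_eq0//.
by rewrite size_prod_XsubC.
Qed.

(* In what follows the sequences Z_1, Z_2, ..., lambda_{n,1}, ..., lambda_{n,n}
   and W_{n,1}, ..., W_{n,n-1} are indexed from 0; the coefficients lambda_{n,j}
   and the zeros W_{n,j} are meaningful for n >= 2 only. *)

Definition Q_ (R : realType) (Omega : Type) (Z : nat -> Omega -> R[i])
    (lam : forall n, 'I_n -> Omega -> R[i]) (n : nat) (w : Omega) : {poly R[i]} :=
  gen_deriv (fun j : 'I_n => Z j w) (fun j : 'I_n => lam n j w).

Definition W_ (R : realType) (Omega : Type) (Z : nat -> Omega -> R[i])
    (lam : forall n, 'I_n -> Omega -> R[i]) (n : nat) (w : Omega) (j : nat) : R[i] :=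
  (zeros (Q_ Z lam n w))`_j.

Definition mu_ (R : realType) (Omega : Type) (Z : nat -> Omega -> R[i])
    (lam : forall n, 'I_n -> Omega -> R[i]) (w : Omega) (n : nat) :
    {measure set R[i] -> \bar R} :=
  mscale (n.-1%:R^-1)%:nng (msum (fun j => \d_(W_ Z lam n w j)) n.-1).

Definition as_weak_cvg (R : realType) (d : measure_display)
    (Omega : measurableType d) (P : probability Omega R)
    (Z : nat -> Omega -> R[i]) (lam : forall n, 'I_n -> Omega -> R[i])
    (mu : probability R[i] R) :=
  {ae P, forall w, weak_cvg (mu_ Z lam w) mu}.

Definition hypotheses (R : realType) (d : measure_display)
    (Omega : measurableType d) (P : probability Omega R)
    (Z : nat -> Omega -> R[i]) (lam : forall n, 'I_n -> Omega -> R[i]) :=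
  [/\ {ae P, forall w, forall n, (2 <= n)%N -> \sum_(j < n) lam n j w != 0},
      exists2 M : R, 0 < M &
        {ae P, forall w, forall n, (2 <= n)%N ->
           forall j, (j < n.-1)%N -> `|W_ Z lam n w j| <= M%:C}
    & exists (K delta : R) (b : nat -> R[i]),
        [/\ 0 < K, 0 < delta, exists m, b m != 0
          & [/\ forall m, {ae P, forall w,
                  (n%:R^-1 * \sum_(j < n) (lam n j w)^* * Z j w ^+ m.+1)
                    @[n --> \oo] --> b m},
                {ae P, forall w, forall n, (2 <= n)%N ->
                  n%:R^-1 * \sum_(j < n) `|lam n j w| <= K%:C}
              & {ae P, forall w, forall n, (2 <= n)%N ->
                  delta%:C <= n%:R^-1 * `|\sum_(j < n) lam n j w|}]]].

Definition polar_derivative_case (R : realType) (d : measure_display)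
    (Omega : measurableType d) (P : probability Omega R)
    (Z : nat -> Omega -> R[i]) (lam : forall n, 'I_n -> Omega -> R[i])
    (xi : R[i]) :=
  {ae P, forall w, forall n, (2 <= n)%N ->
     forall j : 'I_n, lam n j w = xi - Z j w}.

(* On [R[i]], [0 < x] and [x <= y] include that x, resp. y - x, is real. *)
Definition SzNagy_case (R : realType) (d : measure_display)
    (Omega : measurableType d) (P : probability Omega R)
    (lam : forall n, 'I_n -> Omega -> R[i]) :=
  [/\ {ae P, forall w, forall n, (2 <= n)%N ->
         (forall j : 'I_n, 0 < lam n j w) /\ \sum_(j < n) lam n j w = n%:R},
      forall n, (2 <= n)%N -> forall j : 'I_n,
        exists c : R[i], {ae P, forall w, lam n j w = c}
    & exists2 M' : R, 0 < M' &
        {ae P, forall w, forall n, (2 <= n)%N ->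
           forall j : 'I_n, lam n j w <= M'%:C}].

(* Main.v *)
(* Write F_n = Q_n / P_n = \sum_j lambda_j / (X - Z_j). Since |Z_j| = 1, the coefficients
   of F_n / n at infinity and at 0 are bounded by (ii); at infinity the leading one is
   bounded below by (iii), and at 0 they converge by (i) to a nonzero power series.
   Moving a zero W of Q_n elsewhere only multiplies the residues lambda_j by a Moebius
   function of Z_j, so zeros can be reflected in a circle of radius rho <> 1; together
   with the maximum principle, where the Cauchy integral becomes a mean over roots of
   unity, this bounds the number of zeros at distance > eps from the unit circle
   independently of n. Comparing logarithmic derivatives in Q_n = P_n F_n shows that the
   power sums of the zeros of Q_n and of P_n differ by O(1) for each exponent, so the
   means of W^k converge almost surely to the moments of mu. A continuous function on the
   circle is uniformly close to the real part of a polynomial, and weak convergence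
   follows.

   The strong law is proved from Hoeffding's exponential bound and Borel-Cantelli, because
   case (b) needs it for weights that form a triangular array. In case (b) the b_m are the
   moments of mu, and if all of them vanish then mu is uniform. *)

Require Import Defs.
From HB Require Import structures.
From mathcomp Require Import all_boot all_order all_algebra.
From mathcomp Require Import finmap.
From mathcomp Require Import all_classical all_reals all_analysis.
From mathcomp Require Import measurable_realfun complex.
From mathcomp Require Import cyclic separable cyclotomic.
From mathcomp Require Import ring lra zify.

Set Implicit Arguments.
Unset Strict Implicit.
Unset Printing Implicit Defensive.

Import Order.TTheory GRing.Theory Num.Theory.
Import numFieldNormedType.Exports.

Local Open Scope classical_set_scope.
Local Open Scope ring_scope.

(** The poles Z_j of F_n lie on the unit circle itself, so by (ii) F_n / n is bounded only off that
    circle and nothing controls it there. The maximum principle is therefore applied on a circle of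
    radius rho < 1, and the exterior is brought inside by x |-> 1/x. Zeros of Q_n may coincide with
    some Z_j; F_n is evaluated only off the circle, the rest being polynomial identities. Power sums
    alone do not determine a measure in the plane: every rotation-invariant law in the disk has the
    moments of the uniform law. This is what the zero counts are for: all but boundedly many zeros
    lie in an arbitrarily thin annulus around the circle, and the others, bounded by M, contribute
    O(1/n). The bounds do not depend on n because the upper bound K n and the lower bounds are all
    linear in n. The lambda_{n,j} carry no measurability, so their conditions enter pathwise on an
    event of full measure. *)

Local Notation normc := Normc.normc.
Local Notation normcM := Normc.normcM.
Local Notation normcV := Normc.normcV.

(** * Moving roots, and means over roots of unity *)

(* The partial fraction [gen_deriv z l / root_poly z] is multiplied by
   [(a X + b) / (X - W)]; its poles stay the same, so only its residues change. *)
Lemma gen_deriv_move_root (F : fieldType) n (z l : 'I_n -> F) (W a b : F)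
    (g : {poly F}) :
  (forall j, W != z j) -> gen_deriv z l = ('X - W%:P) * g ->
  gen_deriv z (fun j => l j * (a * z j + b) / (z j - W)) = (a *: 'X + b%:P) * g.
Proof.
move=> Wz Gg; apply: (@mulfI _ ('X - W%:P)); first by rewrite polyXsubC_eq0.
rewrite mulrCA -Gg; apply/eqP; rewrite -subr_eq0 mulr_sumr mulr_sumr -sumrB.
have PW : (root_poly z).[W] != 0.
  rewrite /root_poly horner_prod; apply/prodf_neq0 => j _.
  by rewrite hornerXsubC subr_eq0.
(* [W] is a root of [gen_deriv z l] but not of [root_poly z], so the partial fraction vanishes
   there. *)
have l0 : \sum_(j < n) l j / (W - z j) = 0.
  apply/eqP; have := horner_gen_deriv l Wz.
  by rewrite Gg hornerM hornerXsubC subrr mul0r => /esym/eqP; rewrite mulf_eq0 (negPf PW).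
(* Summand by summand the two sides differ by a constant multiple of [l j / (W - z j)] times
   [root_poly z]; these add up to 0 by [l0]. *)
rewrite (eq_bigr (fun j => (- (a * W + b) * (l j / (W - z j)))%:P * root_poly z)).
  by rewrite -mulr_suml -rmorph_sum -mulr_sumr l0 mulr0 mul0r.
move=> j _; rewrite /root_poly [in RHS](bigD1 j)//= -!mul_polyC.
set p := \prod_(_ < _ | _) _.
have zW : z j - W != 0 by rewrite subr_eq0 eq_sym.
have e : (z j - W)^-1%:P * ((z j)%:P - W%:P) = 1 :> {poly F}.
  by rewrite -polyCB -polyCM mulVf.
have -> : (W - z j)^-1 = - (z j - W)^-1 by rewrite -invrN opprB.
rewrite !(polyCM, polyCD, polyCN).
transitivity ((l j)%:P * p * (('X - W%:P) * ((a%:P * (z j)%:P + b%:P) * (z j - W)^-1%:P)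
   - (a%:P * 'X + b%:P) * ((z j - W)^-1%:P * ((z j)%:P - W%:P)))); last by ring.
by rewrite e; ring.
Qed.

(** Positive integers supply enough nonzero test points in characteristic 0; this serves identities
    obtained by substituting 1/x. *)
Lemma poly_eq_nonzero (F : numFieldType) (p q : {poly F}) :
  (forall x, x != 0 -> p.[x] = q.[x]) -> p = q.
Proof.
move=> pq; apply/eqP; rewrite -subr_eq0; apply/eqP.
pose rs := [seq k.+1%:R : F | k <- iota 0 (size (p - q))].
apply: (@roots_geq_poly_eq0 _ _ rs); last by rewrite size_map size_iota.
  apply/allP => _ /mapP[k _ ->].
  by rewrite /root hornerD hornerN pq ?pnatr_eq0// subrr.
rewrite map_inj_uniq ?iota_uniq// => i j /eqP.
by rewrite eqr_nat => /eqP[].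
Qed.

Lemma sum_prim_root (F : fieldType) N (w : F) k :
  N.-primitive_root w -> ~~ (N %| k)%N -> \sum_(i < N) w ^+ (i * k) = 0.
Proof.
move=> wN Nk.
have wk : w ^+ k != 1 by rewrite -(prim_order_dvd wN).
have : (w ^+ k - 1) * \sum_(i < N) (w ^+ k) ^+ i = 0.
  by rewrite -subrX1 exprAC (prim_expr_order wN) expr1n subrr.
move/eqP; rewrite mulf_eq0 subr_eq0 (negPf wk)/= => /eqP e.
by rewrite -[RHS]e; apply: eq_bigr => i _; rewrite -exprM mulnC.
Qed.

Lemma closed_prim_root (F : numClosedFieldType) N :
  (0 < N)%N -> exists w : F, N.-primitive_root w.
Proof.
move=> N0; pose p : {poly F} := 'X^N - 1.
have [r Dp] := closed_field_poly_normal p.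
have sz_p : size p = N.+1 by rewrite size_XnsubC.
rewrite (monicP _) ?monicXnsubC // scale1r in Dp.
have pn1 : all N.-unity_root r by apply/allP => z; rewrite -root_prod_XsubC -Dp.
have sr : (N < (size r).+1)%N by rewrite -(size_prod_XsubC r id) -Dp sz_p.
have [|z] := hasP (has_prim_root N0 pn1 _ sr); last by exists z.
rewrite -separable_prod_XsubC -Dp separable_Xn_sub_1 //.
by rewrite pnatr_eq0 -lt0n.
Qed.

(** A finite Cauchy formula: averaging the geometric kernel keeps only exponents divisible by N.
    Finite sums replace series so that u may lie outside the unit disk, as is needed at the
    poles. *)
Lemma sum_prim_root_geometric (F : fieldType) N (w u : F) :
  N.-primitive_root w -> u ^+ N != 1 ->
  \sum_(i < N) (1 - u * w ^+ i)^-1 = N%:R / (1 - u ^+ N).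
Proof.
move=> wN u1; have N0 := prim_order_gt0 wN.
have uN0 : 1 - u ^+ N != 0 by rewrite subr_eq0 eq_sym.
have E (i : 'I_N) : (1 - u * w ^+ i)^-1 =
    (\sum_(k < N) u ^+ k * w ^+ (i * k)) / (1 - u ^+ N).
  have e : 1 - u ^+ N = (1 - u * w ^+ i) * \sum_(k < N) u ^+ k * w ^+ (i * k).
    rewrite -[LHS]opprB -(opprB (u * w ^+ i)) mulNr; congr (- _).
    have -> : u ^+ N = (u * w ^+ i) ^+ N.
      by rewrite exprMn exprAC (prim_expr_order wN) expr1n mulr1.
    rewrite subrX1; congr (_ * _); apply: eq_bigr => k _.
    by rewrite exprMn -exprM.
  have : (1 - u * w ^+ i) * \sum_(k < N) u ^+ k * w ^+ (i * k) != 0 by rewrite -e.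
  by rewrite mulf_eq0 negb_or e => /andP[? ?]; rewrite invfM mulrCA divff ?mulr1.
under eq_bigr do rewrite E.
rewrite -mulr_suml; congr (_ / _).
rewrite exchange_big/= (bigD1 (Ordinal N0))//= [X in _ + X]big1 ?addr0.
  by under eq_bigr do rewrite muln0 !expr0 mulr1; rewrite sumr_const card_ord.
move=> k k0; rewrite -mulr_sumr sum_prim_root ?mulr0//.
by apply/negP => /(@dvdn_leq N k); rewrite lt0n => /(_ k0); rewrite leqNgt ltn_ord.
Qed.

(** * The modulus as a real number *)

Section NormcTheory.
Variable R : realType.
Local Open Scope complex_scope.
Implicit Types x y : R[i].

Lemma normc_ge0 x : 0 <= normc x.
Proof. by case: x => a b; rewrite sqrtr_ge0. Qed.

Lemma normrE_normc x : `|x| = (normc x)%:C.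
Proof. by case: x => a b; rewrite normc_def. Qed.

Lemma normc_eq0 x : (normc x == 0) = (x == 0).
Proof.
by apply/eqP/eqP => [/Normc.eq0_normc|->]//; exact: Normc.normc0.
Qed.

Lemma normc_gt0 x : (0 < normc x) = (x != 0).
Proof. by rewrite lt_neqAle normc_ge0 andbT eq_sym normc_eq0. Qed.

Lemma normcX x k : normc (x ^+ k) = normc x ^+ k.
Proof.
by elim: k => [|k IH]; rewrite ?expr0 ?Normc.normc1// !exprS normcM IH.
Qed.

Lemma normcB_le x y : normc (x - y) <= normc x + normc y.
Proof. by rewrite -(normcN y) le_normcD. Qed.

Lemma normcB_ge x y : normc x - normc y <= normc (x - y).
Proof. by rewrite lerBlDr -{1}(subrK y x) le_normcD. Qed.

Lemma normc_sum_le I (r : seq I) (P : pred I) (F : I -> R[i]) :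
  normc (\sum_(i <- r | P i) F i) <= \sum_(i <- r | P i) normc (F i).
Proof.
elim/big_ind2 : _ => //; first by rewrite Normc.normc0.
by move=> a b c d ab cd; rewrite (le_trans (le_normcD _ _))// lerD.
Qed.

Lemma normc_prod I (r : seq I) (P : pred I) (F : I -> R[i]) :
  normc (\prod_(i <- r | P i) F i) = \prod_(i <- r | P i) normc (F i).
Proof.
by elim/big_rec2 : _ => [|i u v _ <-]; rewrite ?Normc.normc1 ?normcM.
Qed.

Lemma normc_real (a : R) : normc a%:C = `|a|.
Proof. by rewrite /= expr0n/= addr0 sqrtr_sqr. Qed.

Lemma normc_nat n : normc (n%:R : R[i]) = n%:R.
Proof. by rewrite -[n%:R](rmorph_nat (real_complex R)) normc_real ger0_norm. Qed.

Lemma normc_conj x : normc x^*%R = normc x.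
Proof. by case: x => a b; rewrite /= sqrrN. Qed.

Lemma normc_ge_absRe x : `|complex.Re x| <= normc x.
Proof.
case: x => a b /=; rewrite -sqrtr_sqr ler_wsqrtr//.
by rewrite lerDl sqr_ge0.
Qed.

Lemma normc_ge_absIm x : `|complex.Im x| <= normc x.
Proof.
case: x => a b /=; rewrite -sqrtr_sqr ler_wsqrtr//.
by rewrite lerDr sqr_ge0.
Qed.

Lemma normc_le_ReIm x : normc x <= `|complex.Re x| + `|complex.Im x|.
Proof.
case: x => a b /=; rewrite -[leRHS]ger0_norm ?addr_ge0// -sqrtr_sqr ler_wsqrtr//.
by rewrite sqrrD !real_normK ?num_real// lerD2r lerDl mulrn_wge0// mulr_ge0.
Qed.

Lemma sqr_normcE x : normc x ^+ 2 = complex.Re x ^+ 2 + complex.Im x ^+ 2.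
Proof. by case: x => a b /=; rewrite sqr_sqrtr// addr_ge0 ?sqr_ge0. Qed.

Lemma Re_sum I (r : seq I) (P : pred I) (F : I -> R[i]) :
  complex.Re (\sum_(i <- r | P i) F i) = \sum_(i <- r | P i) complex.Re (F i).
Proof. by elim/big_rec2 : _ => [//|i u v _ <-]; case: (F i) v => ? ? []. Qed.

Lemma Im_sum I (r : seq I) (P : pred I) (F : I -> R[i]) :
  complex.Im (\sum_(i <- r | P i) F i) = \sum_(i <- r | P i) complex.Im (F i).
Proof. by elim/big_rec2 : _ => [//|i u v _ <-]; case: (F i) v => ? ? []. Qed.

Lemma conjC_unit x : normc x = 1 -> x^*%R = x^-1.
Proof.
move=> x1; have x0 : x != 0 by rewrite -normc_gt0 x1.
apply: (mulfI x0); rewrite divff// -[x^*%R]/(conjc x) -sqr_normc normrE_normc x1.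
exact: expr1n.
Qed.

Lemma conjC_real (a : R) : (a%:C)^*%R = a%:C.
Proof. exact: conjc_real. Qed.

End NormcTheory.

Lemma geometric_cvg_le (R : realType) (a b c q : R) :
  0 <= q -> q < 1 -> (forall N, a <= b + c * q ^+ N) -> a <= b.
Proof.
move=> q0 q1 H; rewrite leNgt; apply/negP => ba.
have : (fun N => b + c * q ^+ N) @ \oo --> b + c * 0.
  apply: cvgD; first exact: cvg_cst.
  by apply: cvgMr; apply: cvg_expr; rewrite ger0_norm.
rewrite mulr0 addr0 => /cvgr_lt /(_ _ ba)[N _ /(_ N (leqnn N))] /=.
by rewrite ltNge H.
Qed.

Section CauchyEstimate.
Variables (R : realType) (n : nat) (z l : 'I_n -> R[i]).
Let C := R[i].
Local Open Scope complex_scope.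

Let F (X : C) := \sum_(j < n) l j / (X - z j).

(* The Cauchy integral over the circle of radius rho is replaced by the mean over
   the N-th roots of unity, which is exact up to terms of order q^N. *)
Lemma Cauchy_estimate (rho B : R) (X0 : C) :
  (forall j, normc (z j) = 1) -> 0 < rho -> rho < 1 -> normc X0 < rho ->
  (forall X, normc X = rho -> normc (F X) <= B) ->
  normc (F X0) <= rho / (rho - normc X0) * B.
Proof.
move=> z1 rho0 rho1 X0rho FB.
have rhoC0 : rho%:C != 0 by rewrite -normc_gt0 normc_real gtr0_norm.
pose u := X0 / rho%:C.
pose v j := z j / rho%:C.
have normcr : normc rho%:C = rho by rewrite normc_real gtr0_norm.
have nu : normc u = normc X0 / rho by rewrite normcM normcV normcr.
have nu1 : normc u < 1 by rewrite nu ltr_pdivrMr// mul1r.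
have nv j : normc (v j) = rho^-1 by rewrite normcM normcV normcr z1 mul1r.
(* The errors are powers of [u] and of [(v j)^-1], whose modulus is rho; [q] dominates both. *)
pose q := Num.max (normc u) rho.
have q0 : 0 <= q by rewrite le_max normc_ge0.
have q1 : q < 1 by rewrite gt_max nu1.
have X0z j : X0 - z j != 0.
  rewrite subr_eq0; apply/eqP => e; have := X0rho.
  by rewrite e z1 => /(lt_trans rho1); rewrite ltxx.
pose D := \sum_(j < n) normc (l j) / normc (X0 - z j).
(* The mean is taken over N = k + 1 points to have N > 0, hence the extra factor [q] in the
   constant. *)
apply: (@geometric_cvg_le _ _ _ (D * (2 / (1 - q)) * q) q) => // k.
set N := k.+1.
have [w wN] := @closed_prim_root C N (ltn0Sn k).
have w1 : normc w = 1.
  apply: (@pexpIrn R N) => //; rewrite ?nnegrE ?normc_ge0//.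
  by rewrite -normcX (prim_expr_order wN) Normc.normc1 expr1n.
have uN1 : u ^+ N != 1.
  apply/eqP => /(congr1 (@Normc.normc R)); rewrite normcX Normc.normc1 => /eqP.
  by rewrite pexpr_eq1 ?normc_ge0// lt_eqF.
have vN1 j : v j ^+ N != 1.
  apply/eqP => /(congr1 (@Normc.normc R)); rewrite normcX Normc.normc1 => /eqP.
  rewrite pexpr_eq1 ?normc_ge0// nv => /eqP e.
  by move: rho1; rewrite -(invrK rho) e invr1 ltxx.
(* Dividing by [w ^+ i] turns [X i / (X i - X0)] into [(1 - u * w ^+ i)^-1], the form of
   [sum_prim_root_geometric]. *)
pose X i := rho%:C / w ^+ i.
have w0 i : w ^+ i != 0 by rewrite -normc_gt0 normcX w1 expr1n.
have nX i : normc (X i) = rho by rewrite normcM normcV normcX w1 normcr expr1n invr1 mulr1.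
(* Partial fractions: X / ((X - X0)(X - z)) is (X / (X - X0) - X / (X - z)) / (X0 - z). *)
have meanE : N%:R^-1 * \sum_(i < N) X i / (X i - X0) * F (X i) =
   \sum_(j < n) l j / (X0 - z j) * ((1 - u ^+ N)^-1 - (1 - v j ^+ N)^-1).
  have N0 : N%:R != 0 :> C by rewrite pnatr_eq0.
  apply: (mulfI N0); rewrite mulVKf// mulr_sumr.
  under eq_bigr do rewrite mulr_sumr.
  rewrite exchange_big/=; apply: eq_bigr => j _.
  rewrite mulrCA mulrBr -(sum_prim_root_geometric wN uN1).
  rewrite -(sum_prim_root_geometric wN (vN1 j)) -sumrB mulr_sumr.
  apply: eq_bigr => i _.
  have XX0 : X i - X0 != 0.
    rewrite subr_eq0; apply/eqP => e; have := nX i; rewrite e => e'.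
    by move: X0rho; rewrite e' ltxx.
  have Xz : X i - z j != 0.
    rewrite subr_eq0; apply/eqP => e; have := nX i; rewrite e z1 => e'.
    by move: rho1; rewrite e' ltxx.
  have X0' : X i != 0 by rewrite -normc_gt0 nX.
  have E (a : C) : 1 - a / rho%:C * w ^+ i = (X i - a) / X i.
    by rewrite /X; field; rewrite rhoC0 w0.
  rewrite !E; field.
  by rewrite X0z XX0 Xz X0'.
have meanle : normc (N%:R^-1 * \sum_(i < N) X i / (X i - X0) * F (X i)) <=
    rho / (rho - normc X0) * B.
  rewrite normcM normcV normc_nat ler_pdivrMl//.
  apply: (le_trans (normc_sum_le _ _ _)).
  apply: (@le_trans _ _ (\sum_(i < N) rho / (rho - normc X0) * B)).
    apply: ler_sum => i _; rewrite normcM (normcM (X i)) normcV nX.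
    have d0 : 0 < rho - normc X0 by rewrite subr_gt0.
    have := normcB_ge (X i) X0; rewrite nX => le1.
    apply: ler_pM; rewrite ?mulr_ge0 ?invr_ge0 ?normc_ge0 ?(ltW rho0)//; last exact: FB.
    by rewrite ler_pM2l// lef_pV2 ?posrE// (lt_le_trans d0).
  by rewrite sumr_const card_ord mulr_natl.
have tail (a : C) : normc a <= q -> normc (a ^+ N / (1 - a ^+ N)) <= q ^+ N / (1 - q).
  move=> aq; rewrite normcM normcV normcX.
  have aN : normc a ^+ N <= q.
    rewrite exprS (le_trans (ler_piMr (normc_ge0 _) _))//.
    by rewrite exprn_ile1 ?normc_ge0// (le_trans aq (ltW q1)).
  have := normcB_ge 1 (a ^+ N); rewrite Normc.normc1 normcX => le1.
  apply: ler_pM; rewrite ?exprn_ge0 ?invr_ge0 ?normc_ge0//.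
    by rewrite lerXn2r ?nnegrE ?normc_ge0.
  rewrite lef_pV2 ?posrE ?subr_gt0//; last first.
    by apply: lt_le_trans le1; rewrite subr_gt0 (le_lt_trans aN).
  by apply: le_trans le1; rewrite lerD2l lerN2.
rewrite -[leLHS]/(normc (F X0)).
(* Since |u| < 1 < |v j|, the mean of the first kernel is 1 up to order u^N and that of the second
   is 0 up to order (v j)^-N. *)
have -> : F X0 = N%:R^-1 * (\sum_(i < N) X i / (X i - X0) * F (X i)) -
    \sum_(j < n) l j / (X0 - z j) *
      (u ^+ N / (1 - u ^+ N) + (v j)^-1 ^+ N / (1 - (v j)^-1 ^+ N)).
  rewrite meanE -sumrB; apply: eq_bigr => j _.
  rewrite -mulrBr -[LHS]mulr1; congr (_ * _).
  have vN0 : v j ^+ N != 0.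
    by rewrite -normc_gt0 normcX nv exprn_gt0// invr_gt0.
  have h1 : 1 - u ^+ N != 0 by rewrite subr_eq0 eq_sym.
  have h2 : 1 - v j ^+ N != 0 by rewrite subr_eq0 eq_sym.
  have h3 : v j ^+ N - 1 != 0 by rewrite subr_eq0.
  rewrite exprVn; move: (u ^+ N) (v j ^+ N) vN0 h1 h2 h3 => a b b0 h1 h2 h3.
  by field; rewrite b0 h1 h2 h3.
apply: (le_trans (normcB_le _ _)); rewrite lerD//.
apply: (le_trans (normc_sum_le _ _ _)); rewrite /D !mulr_suml.
apply: ler_sum => j _; rewrite !normcM normcV -!mulrA.
rewrite ler_wpM2l ?normc_ge0// ler_wpM2l ?invr_ge0 ?normc_ge0//.
rewrite (le_trans (le_normcD _ _))//.
have := tail u; have := tail (v j)^-1.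
rewrite normcV nv invrK !le_max !lexx orbT => /(_ isT) t1 /(_ isT) t2.
apply: (le_trans (lerD t2 t1)); rewrite exprS; lra.
Qed.
End CauchyEstimate.

(** * Counting zeros off the unit circle *)

Lemma gen_deriv_move_roots (F : fieldType) n (z l : 'I_n -> F) (g : {poly F})
    (s : seq F) (a b : F -> F) :
  {in s, forall W j, W != z j} ->
  gen_deriv z l = g * \prod_(W <- s) ('X - W%:P) ->
  exists l' : 'I_n -> F,
    gen_deriv z l' = g * \prod_(W <- s) (a W *: 'X + (b W)%:P).
Proof.
elim: s g l => [|W s IH] g l sz; first by rewrite !big_nil => <-; exists l.
rewrite !big_cons mulrCA => /gen_deriv_move_root -/(_ (a W) (b W)) E.
have {}E := E (sz W (mem_head _ _)).
have sz' : {in s, forall V j, V != z j}.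
  by move=> V Vs; apply: sz; rewrite inE Vs orbT.
rewrite mulrA [X in X * _]mulrC in E.
have [l' l'E] := IH _ _ sz' E.
by exists l'; rewrite l'E mulrA.
Qed.

Section ZerosInsideDisk.
Variable R : realType.
Local Open Scope complex_scope.

(** The reflected factor is that of a Blaschke product for the disk of radius rho. The correction
    vanishes for |X| = rho and is positive when X and W are both inside: equality on the circle and
    a gain within. *)
Lemma sqr_normc_Blaschke (rho : R) (W X : R[i]) : rho != 0 ->
  normc ((- (W^* / rho%:C)) * X + rho%:C) ^+ 2 =
  normc (X - W) ^+ 2 +
  (rho ^+ 2 - normc X ^+ 2) * (rho ^+ 2 - normc W ^+ 2) / rho ^+ 2.
Proof.
move=> r0; have -> : (rho%:C)^-1 = (rho^-1)%:C :> R[i] by rewrite fmorphV.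
by rewrite !sqr_normcE; case: W X => a b [c e] /=; field.
Qed.

(* The zeros W in the disk are replaced by their reflections in the circle of radius
   rho, which keeps the modulus on that circle and gains a factor theta at X0. *)
Lemma zeros_inside_bound (r x : R) : 0 <= r < 1 -> 0 <= x < 1 ->
  exists theta C : R, [/\ 0 <= theta, theta < 1, 0 <= C &
    forall n (z l : 'I_n -> R[i]) (g : {poly R[i]}) (s : seq R[i]) (X0 : R[i]),
      (forall j, normc (z j) = 1) -> {in s, forall W, normc W <= r} ->
      normc X0 <= x -> gen_deriv z l = g * \prod_(W <- s) ('X - W%:P) ->
      normc (\sum_(j < n) l j / (X0 - z j)) <=
        C * theta ^+ size s * \sum_(j < n) normc (l j)].
Proof.
move=> /andP[r0 r1] /andP[x0 x1].
pose m := Num.max r x; pose rho := (1 + m) / 2.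
have m0 : 0 <= m by rewrite le_max r0.
have m1 : m < 1 by rewrite gt_max r1.
have rm : r <= m by rewrite le_max lexx.
have xm : x <= m by rewrite le_max lexx orbT.
have rho0 : 0 < rho by rewrite /rho; lra.
have rho1 : rho < 1 by rewrite /rho; lra.
have mrho : m < rho by rewrite /rho; lra.
clearbody rho.
(* By [sqr_normc_Blaschke] the squared ratio of the old factor to the new one at X0 is 1 minus the
   gap divided by rho^2 Q^2, where Q, the modulus of the new factor, is at most 2 rho. *)
pose t := 1 - (rho ^+ 2 - x ^+ 2) * (rho ^+ 2 - r ^+ 2) / (4 * rho ^+ 4).
have ltsq (y : R) : 0 <= y -> y <= m -> 0 < rho ^+ 2 - y ^+ 2.
  by move=> y0 ym; rewrite subr_gt0 ltrXn2r ?nnegrE ?(ltW rho0)// (le_lt_trans ym).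
have t1 : t < 1.
  by rewrite /t ltrBlDr ltrDl divr_gt0 ?mulr_gt0 ?ltsq ?exprn_gt0.
have t0 : 0 <= t.
  rewrite subr_ge0 ler_pdivrMr ?mulr_gt0 ?exprn_gt0// mul1r.
  rewrite (@le_trans _ _ (rho ^+ 2 * rho ^+ 2))//.
    by rewrite ler_pM ?(ltW (ltsq _ _ _))// gerBl sqr_ge0.
  by rewrite -exprD ler_peMl ?exprn_ge0 ?(ltW rho0)// ler1n.
pose theta := Num.sqrt t.
have d0 : 0 < rho - x by rewrite subr_gt0 (le_lt_trans xm).
exists theta, (rho / (rho - x) * (1 - rho)^-1); split.
- exact: sqrtr_ge0.
- by rewrite -[ltRHS]sqrtr1 ltr_sqrt.
- by rewrite !mulr_ge0 ?invr_ge0 ?subr_ge0 ?(ltW rho0) ?(ltW rho1) ?(ltW d0)//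
    ltW// (le_lt_trans xm).
move=> n z l g s X0 z1 sr X0x Gg.
pose a (W : R[i]) := - (W^* / rho%:C); pose b (_ : R[i]) := rho%:C.
have Wz : {in s, forall W j, W != z j}.
  move=> W Ws j; apply/eqP => e; have := sr _ Ws.
  by rewrite e z1 => /(le_lt_trans) /(_ r1); rewrite ltxx.
have [l' l'E] := gen_deriv_move_roots a b Wz Gg.
have P0 X : normc X < 1 -> (root_poly z).[X] != 0.
  move=> X1; rewrite /root_poly horner_prod; apply/prodf_neq0 => j _.
  rewrite hornerXsubC subr_eq0; apply/eqP => e; move: X1.
  by rewrite e z1 ltxx.
have Xz X : normc X < 1 -> forall j, X != z j.
  by move=> X1 j; apply/eqP => e; move: X1; rewrite e z1 ltxx.
have FE X : normc X < 1 ->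
    normc (root_poly z).[X] * normc (\sum_(j < n) l j / (X - z j)) =
    normc g.[X] * \prod_(W <- s) normc (X - W).
  move=> X1; rewrite -normcM -horner_gen_deriv ?Gg; last exact: Xz.
  rewrite hornerM horner_prod normcM normc_prod; congr (_ * _).
  by apply: eq_bigr => W _; rewrite hornerXsubC.
have F'E X : normc X < 1 ->
    normc (root_poly z).[X] * normc (\sum_(j < n) l' j / (X - z j)) =
    normc g.[X] * \prod_(W <- s) normc (a W * X + b W).
  move=> X1; rewrite -normcM -horner_gen_deriv ?l'E; last exact: Xz.
  rewrite hornerM horner_prod normcM normc_prod; congr (_ * _).
  by apply: eq_bigr => W _; rewrite hornerD hornerZ hornerX hornerC.
have rho_neq0 : rho != 0 by rewrite gt_eqF.
have X01 : normc X0 < 1 by rewrite (le_lt_trans X0x).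
have step1 : normc (\sum_(j < n) l j / (X0 - z j)) <=
    theta ^+ size s * normc (\sum_(j < n) l' j / (X0 - z j)).
  have PX0 : 0 < normc (root_poly z).[X0] by rewrite normc_gt0 P0.
  rewrite -(ler_pM2l PX0) mulrCA FE// F'E// mulrCA ler_wpM2l ?normc_ge0//.
  elim: (s) sr => [|W s' IH] sr'; first by rewrite !big_nil expr0 mulr1.
  rewrite !big_cons exprS [X in _ <= X]mulrACA.
  apply: ler_pM; rewrite ?normc_ge0 ?prodr_ge0//; last first.
  - by apply: IH => V Vs; apply: sr'; rewrite inE Vs orbT.
  - have Wr := sr' _ (mem_head _ _).
    rewrite -(@ler_sqr _ (normc _)) ?nnegrE ?mulr_ge0 ?normc_ge0 ?sqrtr_ge0//.
    rewrite exprMn sqr_sqrtr//.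
    have := sqr_normc_Blaschke W X0 rho_neq0; rewrite -/(a W) -/(b W) => qE.
    have q2 : normc (a W * X0 + b W) <= 2 * rho.
      rewrite (le_trans (le_normcD _ _))// normcM /a /b normcN normcM normcV.
      rewrite normc_conj normc_real gtr0_norm// mulr_natl mulr2n lerD2r.
      have Wrho : normc W / rho <= 1.
        by rewrite ler_pdivrMr// mul1r (le_trans Wr)// (le_trans rm)// ltW.
      rewrite (le_trans (ler_piMl (normc_ge0 _) Wrho))//.
      by rewrite (le_trans X0x)// (le_trans xm)// ltW.
    set Q := normc (a W * X0 + b W) in qE q2 *.
    have Q0 : 0 <= Q by exact: normc_ge0.
    have Q2 : Q ^+ 2 <= 4 * rho ^+ 2.
      by rewrite (_ : 4 * rho ^+ 2 = (2 * rho) ^+ 2) ?lerXn2r ?nnegrE ?mulr_ge0 ?(ltW rho0)//; ring.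
    have gap : (rho ^+ 2 - x ^+ 2) * (rho ^+ 2 - r ^+ 2) <=
        (rho ^+ 2 - normc X0 ^+ 2) * (rho ^+ 2 - normc W ^+ 2).
      by apply: ler_pM; rewrite ?(ltW (ltsq _ _ _))// lerD2l lerN2 lerXn2r ?nnegrE ?normc_ge0.
    have gap0 : 0 <= (rho ^+ 2 - x ^+ 2) * (rho ^+ 2 - r ^+ 2).
      by rewrite mulr_ge0 ?(ltW (ltsq _ _ _)).
    rewrite -(lerD2r ((rho ^+ 2 - normc X0 ^+ 2) * (rho ^+ 2 - normc W ^+ 2) / rho ^+ 2)).
    rewrite -qE /t mulrBl mul1r -addrA lerDl addrC subr_ge0.
    apply: (@le_trans _ _ ((rho ^+ 2 - x ^+ 2) * (rho ^+ 2 - r ^+ 2) / rho ^+ 2)).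
      rewrite (_ : _ / rho ^+ 2 = (rho ^+ 2 - x ^+ 2) * (rho ^+ 2 - r ^+ 2) /
          (4 * rho ^+ 4) * (4 * rho ^+ 2)).
        by rewrite ler_wpM2l// divr_ge0// mulr_ge0// exprn_ge0// ltW.
      by field.
    by rewrite ler_pM2r ?invr_gt0 ?exprn_gt0.
  - by move=> V _; exact: normc_ge0.
(* Reflection preserves every modulus on |X| = rho, so the bound known for [l] passes to [l']. *)
have FF' X : normc X = rho ->
    normc (\sum_(j < n) l' j / (X - z j)) = normc (\sum_(j < n) l j / (X - z j)).
  move=> Xrho; have X1 : normc X < 1 by rewrite Xrho.
  have PX : normc (root_poly z).[X] != 0 by rewrite normc_eq0 P0.
  apply: (mulfI PX); rewrite FE// F'E//; congr (_ * _); apply: eq_bigr => W _.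
  apply/eqP; rewrite -(@eqrXn2 _ 2%N) ?normc_ge0//.
  by rewrite sqr_normc_Blaschke// Xrho subrr !mul0r addr0.
set B := \sum_(j < n) normc (l j).
have F'B X : normc X = rho -> normc (\sum_(j < n) l' j / (X - z j)) <= B / (1 - rho).
  move=> Xrho; rewrite FF'// (le_trans (normc_sum_le _ _ _))// mulr_suml.
  apply: ler_sum => j _; rewrite normcM normcV ler_wpM2l ?normc_ge0//.
  have := normcB_ge (z j) X; rewrite z1 Xrho -normcN opprB => h.
  by rewrite lef_pV2 ?posrE ?subr_gt0 ?(lt_le_trans _ h) ?subr_gt0.
have B0 : 0 <= B by apply: sumr_ge0 => j _; exact: normc_ge0.
have X0rho : normc X0 < rho by rewrite (le_lt_trans X0x)// (le_lt_trans xm).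
have := Cauchy_estimate z1 rho0 rho1 X0rho F'B.
move=> /(ler_wpM2l (exprn_ge0 (size s) (sqrtr_ge0 t))) /(le_trans step1) /le_trans.
apply; rewrite -/theta (_ : _ * theta ^+ _ * B =
  theta ^+ size s * (rho / (rho - x) * (B / (1 - rho)))); last by ring.
rewrite ler_wpM2l ?exprn_ge0 ?sqrtr_ge0// ler_wpM2r ?divr_ge0 ?subr_ge0 ?(ltW rho1)//.
by rewrite ler_pM2l// lef_pV2 ?posrE ?subr_gt0// ?lerD2l ?lerN2// -subr_gt0.
Qed.
End ZerosInsideDisk.

(** * Reversed polynomials *)

Section ReversedGenDeriv.
Variable F : numFieldType.
Implicit Types (s : seq F) (x c : F).

Lemma horner_rev_prod s x : (\prod_(w <- s) (1 - w *: 'X)).[x] = \prod_(w <- s) (1 - w * x).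
Proof.
rewrite horner_prod; apply: eq_bigr => w _.
by rewrite !(hornerE, hornerZ).
Qed.

(** Both sides are x^(n-1) times the original identity at 1/x; [size s = n.-1] makes the power of x
    agree. *)
Lemma rev_gen_deriv n (z l : 'I_n -> F) c s : size s = n.-1 ->
  gen_deriv z l = c *: \prod_(w <- s) ('X - w%:P) ->
  \sum_(j < n) l j *: \prod_(k < n | k != j) (1 - z k *: 'X) =
  c *: \prod_(w <- s) (1 - w *: 'X).
Proof.
move=> sn E; apply: poly_eq_nonzero => x x0.
have revE y : 1 - y * x = x * (x^-1 - y) by rewrite mulrBr divff// mulrC.
rewrite hornerZ horner_rev_prod (eq_bigr _ (fun w _ => revE w)) big_split/=.
rewrite big_const_seq count_predT sn iter_mulr_1.
have := congr1 (horner^~ x^-1) E; rewrite hornerZ horner_prod /=.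
under eq_bigr do rewrite hornerXsubC.
rewrite mulrCA => <-; rewrite !horner_sum mulr_sumr; apply: eq_bigr => j _.
rewrite !hornerZ !horner_prod mulrCA; congr (_ * _).
rewrite (eq_bigr (fun k => x * (x^-1 - z k))); last first.
  by move=> k _; rewrite -revE !(hornerE, hornerZ).
rewrite big_split/=; congr (_ * _); last first.
  by apply: eq_bigr => k _; rewrite hornerXsubC.
by rewrite (eq_bigl [in predC1 j])// prodr_const cardC1 card_ord.
Qed.

(** Each [1 - z k *: 'X] is [- z k] times a monic factor with root [(z k)^-1]; the missing factor k
    = j leaves [- (z j)^-1]. For poles on the unit circle the residues keep their moduli. *)
Lemma rev_gen_deriv_inv n (z l : 'I_n -> F) : (forall j, z j != 0) ->
  \sum_(j < n) l j *: \prod_(k < n | k != j) (1 - z k *: 'X) =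
  gen_deriv (fun j => (z j)^-1)
    (fun j => l j * - (z j)^-1 * \prod_(k < n) - z k).
Proof.
move=> z0; apply: eq_bigr => j _.
rewrite -!scalerA; congr (_ *: _).
rewrite [X in _ = _ *: (X *: _)](bigD1 j)//= scalerA mulrA mulNr mulrN opprK mulVf// mul1r.
rewrite -scaler_prod; apply: eq_bigr => k _.
rewrite [RHS]scalerBr -[X in _ = _ - X]mul_polyC -polyCM mulNr divff//.
by rewrite polyCN opprK scaleNr addrC.
Qed.

End ReversedGenDeriv.

Section ZeroCount.
Variable R : realType.
Local Open Scope complex_scope.

(** The lower bound beta n and the upper bound C theta^(size s) K n are both linear in n, so n
    cancels and theta^(size s) stays above a positive constant. *)
Lemma zeros_inside_size (r x K beta : R) : 0 <= r < 1 -> 0 <= x < 1 ->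
  0 <= K -> 0 < beta -> exists N0 : nat,
    forall n (z l : 'I_n -> R[i]) (g : {poly R[i]}) (s : seq R[i]) (X0 : R[i]),
      (0 < n)%N -> (forall j, normc (z j) = 1) -> {in s, forall W, normc W <= r} ->
      normc X0 <= x -> gen_deriv z l = g * \prod_(W <- s) ('X - W%:P) ->
      \sum_(j < n) normc (l j) <= K * n%:R ->
      beta * n%:R <= normc (\sum_(j < n) l j / (X0 - z j)) ->
      (size s <= N0)%N.
Proof.
move=> r01 x01 K0 beta0.
have [theta [C [t0 t1 C0 H]]] := zeros_inside_bound r01 x01.
have : (fun N => C * K * theta ^+ N) @ \oo --> C * K * 0.
  by apply: cvgMr; apply: cvg_expr; rewrite ger0_norm.
rewrite mulr0 => /cvgr_lt /(_ _ beta0)[N0 _ HN0].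
exists N0 => n z l g s X0 n0 z1 sr X0x E lK lb.
rewrite leqNgt; apply/negP => Ns.
have := HN0 _ (ltnW Ns) => /=; apply/negP; rewrite -leNgt.
have n0' : 0 < n%:R :> R by rewrite ltr0n.
rewrite -(ler_pM2r n0') (le_trans lb)// (le_trans (H _ _ _ _ _ _ z1 sr X0x E))//.
rewrite (_ : _ * _ * _ * n%:R = C * theta ^+ size s * (K * n%:R)); last by ring.
by rewrite ler_wpM2l// mulr_ge0// exprn_ge0.
Qed.

Lemma prod_filter_split (A : pred R[i]) (s : seq R[i]) (f : R[i] -> {poly R[i]}) :
  \prod_(W <- s) f W = \prod_(W <- seq.filter (predC A) s) f W * \prod_(W <- seq.filter A s) f W.
Proof. by rewrite !big_filter (bigID A)/= mulrC. Qed.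

Lemma zeros_inside_count (r x K beta : R) : 0 <= r < 1 -> 0 <= x < 1 ->
  0 <= K -> 0 < beta -> exists N0 : nat,
    forall n (z l : 'I_n -> R[i]) (c : R[i]) (s : seq R[i]) (X0 : R[i]),
      (0 < n)%N -> (forall j, normc (z j) = 1) -> normc X0 <= x ->
      gen_deriv z l = c *: \prod_(W <- s) ('X - W%:P) ->
      \sum_(j < n) normc (l j) <= K * n%:R ->
      beta * n%:R <= normc (\sum_(j < n) l j / (X0 - z j)) ->
      (count (fun W => (normc W <= r)%R) s <= N0)%N.
Proof.
move=> r01 x01 K0 beta0.
have [N0 H] := zeros_inside_size r01 x01 K0 beta0; exists N0 => n z l c s X0 n0 z1 X0x.
rewrite (prod_filter_split (fun W => normc W <= r)) scalerAl => E lK lb.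
rewrite -size_filter; apply: H E lK lb => // W.
by rewrite mem_filter => /andP[].
Qed.

(* Under x |-> 1/x the zeros outside the circle move inside, and the point at infinity,
   where the leading coefficient [\sum_j l j] is read off, moves to 0. *)
Lemma zeros_outside_count (r K delta : R) : 0 < r < 1 ->
  0 <= K -> 0 < delta -> exists N0 : nat,
    forall n (z l : 'I_n -> R[i]) (c : R[i]) (s : seq R[i]),
      (0 < n)%N -> (forall j, normc (z j) = 1) -> size s = n.-1 ->
      gen_deriv z l = c *: \prod_(W <- s) ('X - W%:P) ->
      \sum_(j < n) normc (l j) <= K * n%:R ->
      delta * n%:R <= normc (\sum_(j < n) l j) ->
      (count (fun W => (r^-1 <= normc W)%R) s <= N0)%N.
Proof.
move=> /andP[r0 r1] K0 delta0.
have r01 : 0 <= r < 1 by rewrite r1 ltW.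
have x01 : 0 <= (0 : R) < 1 by rewrite lexx ltr01.
have [N0 H] := zeros_inside_size r01 x01 K0 delta0; exists N0 => n z l c s n0 z1 sn.
move=> /(rev_gen_deriv sn); rewrite rev_gen_deriv_inv => [E lK lb|j]; last first.
  by rewrite -normc_gt0 z1.
rewrite -size_filter; pose A : pred R[i] := fun W => r^-1 <= normc W; rewrite -/A.
have A0 W : W \in seq.filter A s -> W != 0.
  rewrite mem_filter => /andP[+ _]; rewrite -normc_gt0; apply: lt_le_trans.
  by rewrite invr_gt0.
have fE : \prod_(W <- seq.filter A s) (1 - W *: 'X) =
    (\prod_(W <- seq.filter A s) - W)%:P *
    \prod_(W <- map (@GRing.inv R[i]) (seq.filter A s)) ('X - W%:P).
  rewrite big_map rmorph_prod -big_split/= big_seq [RHS]big_seq.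
  apply: eq_bigr => W /A0 W0.
  by rewrite polyCN mulrBr mulNr mulNr opprK -polyCM divff// mul_polyC addrC.
rewrite -(size_map (@GRing.inv R[i])).
apply: (H n (fun j => (z j)^-1) _ _ _ 0 n0 _ _ _ (etrans E _)).
- by move=> j; rewrite normcV z1 invr1.
- move=> V /mapP[W]; rewrite mem_filter => /andP[AW _] ->.
  by rewrite normcV -[leRHS]invrK lef_pV2 ?posrE ?invr_gt0// (lt_le_trans _ AW) ?invr_gt0.
- by rewrite Normc.normc0.
- rewrite (prod_filter_split A) fE mulrA scalerAl; reflexivity.
- apply: le_trans lK; apply: ler_sum => j _.
  rewrite !normcM normcN normcV z1 invr1 mulr1 normc_prod big1 ?mulr1// => k _.
  by rewrite normcN z1.
(* At X0 = 0 each new residue divided by minus its pole is [l j] times a common factor of modulus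
   1. *)
- rewrite (_ : \sum_(j < n) _ = (\sum_(j < n) l j) * \prod_(k < n) - z k).
    rewrite normcM normc_prod [X in _ <= _ * X]big1 ?mulr1// => k _.
    by rewrite normcN z1.
  rewrite mulr_suml; apply: eq_bigr => j _.
  have zj0 : z j != 0 by rewrite -normc_gt0 z1.
  by rewrite sub0r invrN invrK; field.
Qed.

End ZeroCount.

(** * Power sums of the zeros *)

Section PowerSums.
Variable F : numFieldType.
Implicit Types (s : seq F).
Local Notation rp s := (\prod_(w <- s) (1 - w *: 'X)).
Local Notation psum s K := (\sum_(k < K) (\sum_(w <- s) w ^+ k.+1) *: 'X^k).

Lemma geometric_poly (w : F) K :
  (1 - w *: 'X) * \sum_(k < K) w ^+ k *: 'X^k = 1 - w ^+ K *: 'X^K.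
Proof.
have e k : w ^+ k *: 'X^k = (w *: 'X) ^+ k :> {poly F} by rewrite exprZn.
under eq_bigr do rewrite e.
by rewrite e -[RHS]opprB subrX1 -mulNr opprB.
Qed.

(** The logarithmic derivative of the reversed product generates the power sums with a minus sign;
    working modulo X^K avoids power series. *)
Lemma deriv_rev_prod s K :
  exists q, (rp s)^`() + rp s * psum s K = 'X^K * q.
Proof.
elim: s => [|w s [q E]].
  exists 0; rewrite big_nil derivC add0r mul1r mulr0 big1// => k _.
  by rewrite big_nil scale0r.
have pE : psum (w :: s) K = w *: \sum_(k < K) w ^+ k *: 'X^k + psum s K.
  rewrite scaler_sumr -big_split; apply: eq_bigr => k _ /=.
  by rewrite big_cons scalerDl exprS scalerA.
rewrite pE big_cons derivM derivB derivC sub0r derivZ derivX.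
exists ((1 - w *: 'X) * q - w ^+ K.+1 *: rp s).
have := geometric_poly w K; set S := (\sum_(k < K) w ^+ k *: 'X^k).
rewrite exprS -!mul_polyC polyCM => gE.
transitivity ((1 - w%:P * 'X) * ((rp s)^`() + rp s * psum s K) +
   rp s * w%:P * ((1 - w%:P * 'X) * S - 1)); first by ring.
by rewrite E gE; ring.
Qed.

Lemma rev_prod_mod n (z l : 'I_n -> F) K :
  exists q, \sum_(j < n) l j *: \prod_(k < n | k != j) (1 - z k *: 'X) =
   \prod_(k < n) (1 - z k *: 'X) *
     \sum_(i < K) (\sum_(j < n) l j * z j ^+ i) *: 'X^i + 'X^K * q.
Proof.
exists (\sum_(j < n) (l j * z j ^+ K) *: \prod_(k < n | k != j) (1 - z k *: 'X)).
under [X in _ = _ * X + _]eq_bigr do rewrite scaler_suml.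
rewrite exchange_big/= !mulr_sumr -big_split; apply: eq_bigr => j _ /=.
under [X in _ = _ * X + _]eq_bigr do rewrite -scalerA.
rewrite -scaler_sumr [X in _ = X * _ + _](bigD1 j)//=.
set p := \prod_(_ < _ | _) _; set S := \sum_(_ < _) _.
transitivity ((l j)%:P * (p * ((1 - z j *: 'X) * S) + 'X^K * (z j ^+ K)%:P * p)).
  by rewrite geometric_poly -!mul_polyC; ring.
by rewrite -!mul_polyC polyCM; ring.
Qed.

(* Newton-type identities: compare the logarithmic derivatives of both sides of
   [rp W = rp z * \sum_i c_i X^i], where c_i = \sum_j l_j z_j^i. *)
Lemma power_sum_recurrence n (z l : 'I_n -> F) c s k :
  size s = n.-1 -> gen_deriv z l = c *: \prod_(w <- s) ('X - w%:P) ->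
  k.+1%:R * \sum_(j < n) l j * z j ^+ k.+1 =
  \sum_(i < k.+1) (\sum_(j < n) l j * z j ^+ i) *
    (\sum_(j < n) z j ^+ (k - i).+1 - \sum_(w <- s) w ^+ (k - i).+1).
Proof.
move=> sn /(rev_gen_deriv sn) E.
pose zs := codom z.
have zsE : \prod_(j < n) (1 - z j *: 'X) = rp zs.
  by rewrite /zs codomE big_map big_enum.
have zsS (i : nat) : \sum_(j < n) z j ^+ i = \sum_(w <- zs) w ^+ i.
  by rewrite /zs codomE big_map big_enum.
(* One more coefficient than in the power sums, because differentiation lowers the order of the
   error from k + 2 to k + 1. *)
pose L := \sum_(i < k.+2) (\sum_(j < n) l j * z j ^+ i) *: 'X^i.
have [q1 E1] := deriv_rev_prod s k.+1.
have [q2 E2] := deriv_rev_prod zs k.+1.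
have [q3 E3] := rev_prod_mod z l k.+2.
rewrite E zsE -/L in E3.
set S1 := psum s _ in E1; set S2 := psum zs _ in E2.
(* This is L' = L (S2 - S1) modulo X^(k+1), multiplied by [rp zs]. *)
have EP : rp zs * (L^`() - L * (S2 - S1)) = 'X^(k.+1) * (c%:P * q1 - L * q2 -
   ((k.+2)%:R * q3 + 'X * q3^`()) - S1 * 'X * q3).
  have dE := congr1 (fun p => p^`()) E3.
  rewrite /= derivZ derivD derivM (derivM (rp zs)) derivXn /= in dE.
  have dE' : rp zs * L^`() = c *: (rp s)^`() - (rp zs)^`() * L -
       ((('X^(k.+1)) *+ (k.+2)) * q3 + 'X^(k.+2) * q3^`()) by rewrite dE; ring.
  have -> : rp zs * (L^`() - L * (S2 - S1)) =
     c *: (rp s)^`() + S1 * (rp zs * L) - L * ((rp zs)^`() + rp zs * S2)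
     - ((('X^(k.+1)) *+ (k.+2)) * q3 + 'X^(k.+2) * q3^`()) by rewrite mulrBr dE'; ring.
  have -> : rp zs * L = c *: rp s - 'X^(k.+2) * q3 by rewrite E3; ring.
  rewrite E2 (_ : c *: (rp s)^`() + S1 * (c *: rp s - 'X^(k.+2) * q3) =
    c%:P * ((rp s)^`() + rp s * S1) - S1 * 'X^(k.+2) * q3); last first.
    by rewrite -!mul_polyC; ring.
  by rewrite E1 -mulr_natl !exprS; ring.
(* [rp zs] has constant coefficient 1, hence is prime to X and can be cancelled. *)
have dv : 'X^(k.+1) %| L^`() - L * (S2 - S1).
  rewrite -(@Gauss_dvdpr _ _ (rp zs)); first by rewrite EP dvdp_mulIl.
  rewrite coprimep_expl// coprimep_sym coprimepX /root horner_rev_prod.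
  by rewrite big1 ?oner_eq0// => w _; rewrite mulr0 subr0.
have : (L^`() - L * (S2 - S1))`_k = 0.
  by case/dvdpP: dv => q ->; rewrite coefMXn ltnSn.
rewrite coefB coef_deriv => /eqP; rewrite subr_eq0 => /eqP.
have coefS (f : nat -> F) N i : (i < N)%N -> (\sum_(k < N) f k *: 'X^k)`_i = f i.
  move=> iN; rewrite coef_sum (bigD1 (Ordinal iN))//= coefZ coefXn eqxx mulr1.
  rewrite big1 ?addr0// => j ji; rewrite coefZ coefXn.
  rewrite (_ : (i == j) = false) ?mulr0//; apply/eqP => e.
  by move/eqP: ji; apply; apply: val_inj.
have LE m : (m < k.+2)%N -> L`_m = \sum_(j < n) l j * z j ^+ m.
  exact: (coefS (fun m => \sum_(j < n) l j * z j ^+ m)).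
rewrite LE// mulr_natl => ->; rewrite coefM; apply: eq_bigr => i _.
rewrite LE; last by rewrite (leq_trans (ltn_ord i)).
have S1E m : (m < k.+1)%N -> S1`_m = \sum_(w <- s) w ^+ m.+1.
  exact: (coefS (fun m => \sum_(w <- s) w ^+ m.+1)).
have S2E m : (m < k.+1)%N -> S2`_m = \sum_(w <- zs) w ^+ m.+1.
  exact: (coefS (fun m => \sum_(w <- zs) w ^+ m.+1)).
by congr (_ * _); rewrite coefB S1E ?S2E ?ltnS ?leq_subr// zsS.
Qed.
End PowerSums.

Section MomentBound.
Variable R : realType.

(** In [power_sum_recurrence] the newest difference is multiplied by sum_j l_j, of modulus at least
    delta n, while the other weighted sums are at most K n; dividing eliminates n. All smaller
    exponents stay in the statement for the induction. *)
Lemma power_sum_bound (K delta : R) k : 0 <= K -> 0 < delta -> exists B : R, 0 <= B /\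
  forall n (z l : 'I_n -> R[i]) (c : R[i]) (s : seq R[i]),
    (0 < n)%N -> (forall j, normc (z j) = 1) -> size s = n.-1 ->
    gen_deriv z l = c *: \prod_(W <- s) ('X - W%:P) ->
    \sum_(j < n) normc (l j) <= K * n%:R ->
    delta * n%:R <= normc (\sum_(j < n) l j) ->
    forall i, (i < k)%N ->
    normc (\sum_(j < n) z j ^+ i.+1 - \sum_(W <- s) W ^+ i.+1) <= B.
Proof.
move=> K0 delta0; elim: k => [|k [B [B0 IH]]]; first by exists 0.
pose B' := (k.+1%:R * K + k%:R * (K * B)) / delta.
exists (Num.max B B'); split; first by rewrite le_max B0.
move=> n z l c s n0 z1 sn E lK lb i.
have {}IH := IH n z l c s n0 z1 sn E lK lb.
rewrite ltnS leq_eqVlt => /orP[/eqP->|/IH le]; last by rewrite le_max le.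
rewrite le_max; apply/orP; right; rewrite /B' ler_pdivlMr// mulrC.
have n0' : 0 < n%:R :> R by rewrite ltr0n.
pose a i := \sum_(j < n) l j * z j ^+ i.
have aK m : normc (a m) <= K * n%:R.
  rewrite (le_trans (normc_sum_le _ _ _))// (le_trans _ lK)//.
  by apply: ler_sum => j _; rewrite normcM normcX z1 expr1n mulr1.
have := power_sum_recurrence k sn E; rewrite big_ord_recl subn0 -/(a k.+1) -/(a 0).
set d := (_ - _) => /eqP; rewrite -subr_eq => /eqP dE.
rewrite -(ler_pM2r n0') mulrAC.
have a0 : a 0%N = \sum_(j < n) l j by apply: eq_bigr => j _; rewrite expr0 mulr1.
rewrite (le_trans (ler_wpM2r (normc_ge0 _) lb))// -a0 -normcM -dE.
rewrite (le_trans (normcB_le _ _))// [leRHS]mulrDl lerD//.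
  by rewrite normcM normc_nat -mulrA ler_wpM2l//; exact: aK.
rewrite (le_trans (normc_sum_le _ _ _))//.
rewrite (@le_trans _ _ (\sum_(i < k) K * n%:R * B))//.
  apply: ler_sum => m _; rewrite normcM ler_pM ?normc_ge0//; first exact: aK.
  by apply: IH; rewrite /= /bump/= add1n ltn_subrL/= (leq_ltn_trans _ (ltn_ord m)).
rewrite sumr_const card_ord -mulr_natl; lra.
Qed.
End MomentBound.

(** * Approximation of continuous functions on the circle *)

Section ComplexTopology.
Variable R : realType.
Local Open Scope complex_scope.

(** The norm of [R[i]] takes values in [R[i]]; positive elements are real there, so real tolerances
    suffice. *)
Lemma cvgC_normcP (T : Type) (F : set_system T) (FF : Filter F) (f : T -> R[i])
    (l : R[i]) :
  (f @ F --> l) <-> forall e : R, 0 < e -> \forall t \near F, normc (l - f t) < e.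
Proof.
split => [/cvgrPdist_lt H e e0|H].
  have e0' : 0 < e%:C by rewrite ltcR.
  by apply: filterS (H _ e0') => t; rewrite normrE_normc ltcR.
apply/cvgrPdist_lt => -[e e'] /[dup] e0; rewrite ltcE/= => /andP[/eqP-> {}e0].
apply: filterS (H _ e0) => t ht; rewrite normrE_normc.
by rewrite complexr0 ltcR.
Qed.

Lemma nbhs_normcP (x : R[i]) (A : set R[i]) :
  nbhs x A <-> exists2 d : R, 0 < d & forall y, normc (x - y) < d -> A y.
Proof.
split=> [/nbhs_ballP[[e e']]|[d d0 H]].
  rewrite /= ltcE/= => /andP[/eqP-> e0] H; exists e => // y xy; apply: H.
  by rewrite /ball/= normrE_normc complexr0 ltcR.
apply/nbhs_ballP; exists d%:C; first by rewrite /= ltcR.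
by move=> y; rewrite /ball/= normrE_normc ltcR => /H.
Qed.

Definition expi (t : R) : R[i] := cos t +i* sin t.

Lemma normc_expi t : normc (expi t) = 1.
Proof. by rewrite /= cos2Dsin2 sqrtr1. Qed.

Lemma continuous_expi : continuous expi.
Proof.
move=> t; apply/cvgC_normcP => e e0.
have e20 : 0 < e / 2 by rewrite divr_gt0.
have /cvgrPdist_lt/(_ _ e20) hc := @continuous_cos R t.
have /cvgrPdist_lt/(_ _ e20) hs := @continuous_sin R t.
near=> s; rewrite (le_lt_trans (normc_le_ReIm _))// [ltRHS]splitr ltrD//=.
  by near: s.
by near: s.
Unshelve. all: by end_near. Qed.

Lemma unit_circle_expi (z : R[i]) : normc z = 1 ->
  exists2 t, t \in `[- pi, pi] & z = expi t.
Proof.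
case: z => a b /= /(congr1 (fun x => x ^+ 2)).
rewrite sqr_sqrtr ?addr_ge0 ?sqr_ge0// expr1n => ab.
have a1 : -1 <= a <= 1.
  rewrite -ler_norml -(@ler_sqr _ `|a|) ?nnegrE// expr1n real_normK ?num_real//.
  by rewrite -ab lerDl sqr_ge0.
have ca : cos (acos a) = a by rewrite acosK// in_itv.
have sa : sin (acos a) = `|b|.
  by rewrite sin_acos// -ab addrC addKr sqrtr_sqr.
have pi0 : 0 <= pi :> R by exact: pi_ge0.
have := acos_ge0 a1; have := acos_lepi a1 => h1 h2.
have [b0|b0] := leP 0 b.
  exists (acos a); first by rewrite in_itv/= h1 andbT (le_trans _ h2)// oppr_le0.
  by rewrite /expi ca sa ger0_norm.
exists (- acos a); first by rewrite in_itv/= lerN2 h1/= (le_trans _ pi0)// oppr_le0.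
by rewrite /expi cosN sinN ca sa ltr0_norm// opprK.
Qed.

(** Compactness of [[-pi, pi]], mapped onto the circle by [expi], makes the radius uniform in z; w
    ranges over the plane because the zeros are only near the circle. *)
Lemma continuous_near_circle (f : R[i] -> R) : continuous f -> forall e : R, 0 < e ->
  exists2 d : R, 0 < d & forall z w, normc z = 1 -> normc (w - z) < d ->
    `|f w - f z| < e.
Proof.
move=> cf e e0.
have e20 : 0 < e / 2 by rewrite divr_gt0.
have : compact `[- pi, pi : R] by exact: segment_compact.
move/compact_near_coveringP => /(_ R 0^'+
  (fun d t => forall w, normc (w - expi t) < d -> `|f w - f (expi t)| < e) _).
move=> [|d /= d0 H].
- move=> t _.
  have /cvgrPdist_lt/(_ _ e20) := cf (expi t).
  move=> /nbhs_normcP[d d0 fd].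
  have d20 : 0 < d / 2 by rewrite divr_gt0.
  have /cvgC_normcP/(_ _ d20) hs := @continuous_expi t.
  near=> s r => w wr.
  have hs' : normc (expi t - expi s) < d / 2 by near: s.
  have rd : r < d / 2 by near: r; exact: nbhs_right_lt.
  have h1 := fd _ (lt_trans hs' _).
  have h2 : `|f (expi t) - f w| < e / 2.
    apply: fd; rewrite (_ : _ - _ = (expi t - expi s) - (w - expi s)); last by ring.
    by rewrite (le_lt_trans (normcB_le _ _))// [ltRHS]splitr ltrD// (lt_trans wr).
  have {}h1 : `|f (expi t) - f (expi s)| < e / 2.
    by apply: h1; rewrite ltr_pdivrMr// ltr_pMr// ltrDr.
  rewrite (_ : _ - _ = (f (expi t) - f (expi s)) - (f (expi t) - f w)); last by ring.
  by rewrite (le_lt_trans (ler_normB _ _))// [ltRHS]splitr ltrD.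
exists (d / 2); first by rewrite divr_gt0.
move=> z w /unit_circle_expi[t tpi ->]; apply: (H (d / 2)) => //=.
- by rewrite sub0r normrN gtr0_norm ?divr_gt0// ltr_pdivrMr// ltr_pMr// ltrDr.
- by rewrite divr_gt0.
Unshelve. all: by end_near. Qed.

End ComplexTopology.

Lemma cvgC_M (R : realType) (T : Type) (F : set_system T) {FF : Filter F}
    (f g : T -> R[i]) (a b : R[i]) :
  f @ F --> a -> g @ F --> b -> (fun t => f t * g t) @ F --> a * b.
Proof.
move=> /cvgC_normcP fa /cvgC_normcP gb; apply/cvgC_normcP => e e0.
have A0 : 0 < 2 * (normc a + 1) by rewrite mulr_gt0// ltr_wpDl ?normc_ge0.
have B0 : 0 < 2 * (normc b + 1) by rewrite mulr_gt0// ltr_wpDl ?normc_ge0.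
have h1 := gb _ ltr01.
have h2 := gb _ (divr_gt0 e0 A0).
have h3 := fa _ (divr_gt0 e0 B0).
near=> t.
have b1 : normc (b - g t) < 1 by near: t.
have b2 : normc (b - g t) < e / (2 * (normc a + 1)) by near: t.
have a2 : normc (a - f t) < e / (2 * (normc b + 1)) by near: t.
have gt : normc (g t) <= normc b + 1.
  rewrite (_ : g t = b - (b - g t)); last by ring.
  by rewrite (le_trans (normcB_le _ _))// lerD2l ltW.
rewrite (_ : _ - _ = a * (b - g t) + (a - f t) * g t); last by ring.
rewrite (le_lt_trans (le_normcD _ _))// !normcM [ltRHS]splitr ltr_leD//.
  apply: (@le_lt_trans _ _ ((normc a + 1) * normc (b - g t))).
    by rewrite ler_wpM2r ?normc_ge0// lerDl.
  move: b2; rewrite ltr_pdivlMr// ltr_pdivlMr//; lra.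
apply: (@le_trans _ _ (normc (a - f t) * (normc b + 1))).
  by rewrite ler_wpM2l ?normc_ge0.
by move: (ltW a2); rewrite ler_pdivlMr// ler_pdivlMr//; lra.
Unshelve. all: by end_near. Qed.

Lemma continuous_hornerC (R : realType) (p : {poly R[i]}) :
  continuous (fun z : R[i] => p.[z]).
Proof.
elim/poly_ind : p => [|p c IH] z.
  have -> : (fun z : R[i] => (0 : {poly R[i]}).[z]) = cst 0.
    by apply/funext => y; rewrite horner0.
  exact: cst_continuous.
have -> : (fun z : R[i] => (p * 'X + c%:P).[z]) = (fun z => p.[z] * z + c).
  by apply/funext => y; rewrite hornerMXaddC.
apply: (@cvgD _ _ _ (nbhs z) _ (fun z => p.[z] * z) (cst c)).
  exact: (cvgC_M (IH z) (@cvg_id _ (nbhs z))).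
exact: cst_continuous.
Qed.

Lemma continuous_Re (R : realType) : continuous (@complex.Re R : R[i] -> R).
Proof.
move=> z; apply/(@cvgrPdist_lt _ _ _ _ (nbhs_filter z)) => e e0.
have /(cvgC_normcP (nbhs_filter z))/(_ _ e0) := @cvg_id _ (nbhs z).
apply: filterS => t; apply: le_lt_trans.
by rewrite (le_trans _ (normc_ge_absRe _))//; case: (z) (t) => ? ? [].
Qed.

Lemma continuous_Im (R : realType) : continuous (@complex.Im R : R[i] -> R).
Proof.
move=> z; apply/(@cvgrPdist_lt _ _ _ _ (nbhs_filter z)) => e e0.
have /(cvgC_normcP (nbhs_filter z))/(_ _ e0) := @cvg_id _ (nbhs z).
apply: filterS => t; apply: le_lt_trans.
by rewrite (le_trans _ (normc_ge_absIm _))//; case: (z) (t) => ? ? [].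
Qed.

Lemma continuous_normc (R : realType) : continuous (@Normc.normc R : R[i] -> R).
Proof.
move=> z; apply/(@cvgrPdist_lt _ _ _ _ (nbhs_filter z)) => e e0.
have /(cvgC_normcP (nbhs_filter z))/(_ _ e0) := @cvg_id _ (nbhs z).
apply: filterS => t; apply: le_lt_trans.
rewrite ler_norml normcB_ge andbT lerNl opprB.
by rewrite (le_trans (normcB_ge _ _))// -opprB normcN.
Qed.

Section TrigonometricApproximation.
Variable R : realType.
Local Open Scope complex_scope.

(* On the unit circle a real trigonometric polynomial is the real part of an ordinary
   polynomial. *)
Definition trig (h : R[i] -> R) :=
  exists p : {poly R[i]}, forall z, normc z = 1 -> h z = complex.Re p.[z].

Lemma ReD (x y : R[i]) : complex.Re (x + y) = complex.Re x + complex.Re y.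
Proof. by case: x y => ? ? []. Qed.

Lemma Re_realM (a : R) (x : R[i]) : complex.Re (a%:C * x) = a * complex.Re x.
Proof. by case: x => ? ? /=; rewrite mul0r subr0. Qed.

Lemma trig_sum I (r : seq I) (h : I -> R[i] -> R) :
  (forall i, trig (h i)) -> trig (fun z => \sum_(i <- r) h i z).
Proof.
move=> th; elim: r => [|i r [p pE]].
  by exists 0 => z _; rewrite big_nil horner0.
have [q qE] := th i; exists (q + p) => z z1.
by rewrite big_cons hornerD ReD qE// pE.
Qed.

Lemma trigZ (a : R) h : trig h -> trig (fun z => a * h z).
Proof.
move=> [p pE]; exists (a%:C *: p) => z z1.
by rewrite pE// hornerZ Re_realM.
Qed.

(** A negative power of z is on the circle the conjugate of a positive one, and conjugating c as
    well leaves the real part unchanged. *)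
Lemma trig_monomial (c : R[i]) k m :
  trig (fun z => complex.Re (c * (z ^+ k * (z ^+ m)^-1))).
Proof.
have unit0 (z : R[i]) : normc z = 1 -> z != 0 by move=> z1; rewrite -normc_gt0 z1.
have [mk|/ltnW km] := leqP m k.
  exists (c *: 'X^(k - m)) => z z1; rewrite hornerZ hornerXn.
  by rewrite -expfB_cond// (negPf (unit0 _ z1)).
exists (c^*%R *: 'X^(m - k)) => z z1; rewrite hornerZ hornerXn.
rewrite [in LHS](_ : z ^+ k / z ^+ m = (z ^+ (m - k))^*%R).
  by case: c (z ^+ (m - k)) => a b [u v] /=; ring.
have zX1 : normc (z ^+ (m - k)) = 1 by rewrite normcX z1 expr1n.
by rewrite conjC_unit// expfB_cond ?(negPf (unit0 _ z1))// invfM invrK mulrC.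
Qed.

(** The central binomial coefficient C(2n, n), by Vandermonde's identity; it is the mean over the
    circle of the kernel |z + v|^(2n). *)
Definition sqbin n : R := \sum_(a < n.+1) ('C(n, a)%:R : R) ^+ 2.

(** Cauchy-Schwarz for the row sum 2^n of the binomial coefficients, in the form that a variance is
    nonnegative. *)
Lemma sqbin_ge n : 4 ^+ n <= n.+1%:R * sqbin n.
Proof.
pose S : R := \sum_(a < n.+1) 'C(n, a)%:R.
have SE : S = 2 ^+ n.
  rewrite -(@natr1 R 1) exprDn; apply: eq_bigr => a _.
  by rewrite !expr1n mulr1.
pose N : R := n.+1%:R.
have N0 : 0 < N by rewrite ltr0n.
have : 0 <= \sum_(a < n.+1) ('C(n, a)%:R - S / N) ^+ 2.
  by apply: sumr_ge0 => a _; exact: sqr_ge0.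
under eq_bigr do rewrite sqrrB.
rewrite big_split/= sumrB -/(sqbin n) sumr_const card_ord.
rewrite sumrMnl -mulr_suml -/S -[X in _ + X]mulr_natl -/N.
rewrite (_ : _ + _ = sqbin n - S ^+ 2 / N); last first.
  by rewrite mulr2n; field; rewrite gt_eqF.
rewrite subr_ge0 ler_pdivrMr// [sqbin n * N]mulrC; apply: le_trans.
by rewrite SE -exprM mulnC exprM -[X in _ <= X ^+ n]natrX.
Qed.

Lemma sqr_normc_mul (x : R[i]) : (normc x ^+ 2)%:C = x * x^*%R.
Proof. by rewrite -sqr_normc normrE_normc rmorphXn. Qed.

(** |z + v|^(2n) is the de la Vallee-Poussin kernel, (2 cos(t/2))^(2n) for the angle t between z and
    v. It is (z + v)^n times its conjugate, and conjugation is inversion on the circle. *)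
Lemma vallee_poussin_expand n (z v : R[i]) : normc z = 1 -> normc v = 1 ->
  (normc (z + v) ^+ (2 * n))%:C =
  \sum_(a < n.+1) \sum_(b < n.+1) ('C(n, a) * 'C(n, b))%:R *
    (v ^+ a * (v ^+ b)^-1) * (z ^+ (n - a) * (z ^+ (n - b))^-1).
Proof.
move=> z1 v1.
rewrite mulnC exprM -normcX sqr_normc_mul exprDn rmorph_sum mulr_suml.
apply: eq_bigr => a _; rewrite mulr_sumr; apply: eq_bigr => b _.
rewrite rmorphMn rmorphM /=.
rewrite !conjC_unit ?normcX ?z1 ?v1 ?expr1n//.
rewrite -[X in X * _ = _]mulr_natr -[X in _ * X = _]mulr_natr natrM; ring.
Qed.

(** The frequencies a - b lie between -n and n, so n + 1 sample points already average all of them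
    to 0 except a = b. *)
Lemma vallee_poussin_mean n (z w : R[i]) : normc z = 1 -> (n.+1).-primitive_root w ->
  \sum_(i < n.+1) normc (z + w ^+ i) ^+ (2 * n) = n.+1%:R * sqbin n.
Proof.
move=> z1 wN.
have w1 : normc w = 1.
  apply: (@pexpIrn R n.+1) => //; rewrite ?nnegrE ?normc_ge0//.
  by rewrite -normcX (prim_expr_order wN) Normc.normc1 expr1n.
have w0 k : w ^+ k != 0 by rewrite -normc_gt0 normcX w1 expr1n.
have z0 k : z ^+ k != 0 by rewrite -normc_gt0 normcX z1 expr1n.
apply: (@complexI R); rewrite rmorph_sum /=.
under eq_bigr do rewrite vallee_poussin_expand ?normcX ?w1 ?expr1n//.
rewrite exchange_big/= rmorphM rmorph_nat rmorph_sum mulr_sumr.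
apply: eq_bigr => a _; rewrite exchange_big/= (bigD1 a)//=.
rewrite [X in _ + X]big1 ?addr0 => [|b ba].
  under eq_bigr do rewrite (divff (z0 _)) -exprM (divff (w0 _)) !mulr1.
  by rewrite sumr_const card_ord -[LHS]mulr_natl natrM rmorphXn rmorph_nat -expr2.
rewrite -mulr_suml -mulr_sumr.
(* The exponent a - b is represented modulo n + 1 by the natural number [a + (n.+1 - b)]. *)
rewrite (eq_bigr (fun i : 'I_n.+1 => w ^+ (i * (a + (n.+1 - b))))) => [|i _].
  rewrite sum_prim_root ?mulr0 ?mul0r//; apply/negP => /dvdnP[q].
  have an := ltn_ord a; have bn := ltn_ord b.
  have : (a : nat) != b by apply: contra_neq ba => e; apply: val_inj.
  by case: q => [|[|q]] => /eqP + e; nia.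
rewrite -!exprM mulnDr exprD; congr (_ * _).
apply: (mulIf (w0 (i * b)%N)); rewrite mulVf// -exprD -mulnDr subnK ?(ltnW (ltn_ord b))//.
by rewrite mulnC exprM (prim_expr_order wN) expr1n.
Qed.

Lemma trig_ext (h h' : R[i] -> R) : (forall z, normc z = 1 -> h z = h' z) ->
  trig h' -> trig h.
Proof. by move=> hh' [p pE]; exists p => z z1; rewrite hh'// pE. Qed.

Lemma trig_vallee_poussin n (v : R[i]) : normc v = 1 -> trig (fun z => normc (z + v) ^+ (2 * n)).
Proof.
move=> v1; pose c (a b : 'I_n.+1) : R[i] := ('C(n, a) * 'C(n, b))%:R * (v ^+ a * (v ^+ b)^-1).
apply: (@trig_ext _ (fun z => \sum_(a < n.+1) \sum_(b < n.+1)
   complex.Re (c a b * (z ^+ (n - a) * (z ^+ (n - b))^-1)))) => [z z1|].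
  rewrite -[LHS]/(complex.Re (normc (z + v) ^+ (2 * n))%:C) vallee_poussin_expand//.
  by rewrite Re_sum; apply: eq_bigr => a _; rewrite Re_sum.
by apply: trig_sum => a; apply: trig_sum => b; exact: trig_monomial.
Qed.

(** With p the square root of q, (n+1) p^n is at most a geometric sum, hence at most 1/(1 - p), and
    the other factor p^n tends to 0. *)
Lemma exists_natM_geometric_le (q e : R) : 0 <= q -> q < 1 -> 0 < e ->
  exists n : nat, n.+1%:R * q ^+ n <= e.
Proof.
move=> q0 q1 e0; pose p := Num.sqrt q.
have p0 : 0 <= p by exact: sqrtr_ge0.
have p1 : p < 1 by rewrite -[ltRHS]sqrtr1 ltr_sqrt.
have d0 : 0 < 1 - p by rewrite subr_gt0.
have : (fun n => (1 - p)^-1 * p ^+ n) @ \oo --> (1 - p)^-1 * 0.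
  by apply: cvgMr; apply: cvg_expr; rewrite ger0_norm.
rewrite mulr0 => /cvgr_lt /(_ _ e0)[n _ /(_ n (leqnn n)) /= ne]; exists n.
apply: le_trans (ltW ne).
rewrite -[q](@sqr_sqrtr _ q)// -/p exprAC expr2 mulrA ler_wpM2r ?exprn_ge0//.
rewrite -(ler_pM2l d0) mulfV ?gt_eqF// mulr_natl -[n.+1 in X in X <= _]card_ord -sumr_const.
apply: (@le_trans _ _ ((1 - p) * \sum_(i < n.+1) p ^+ i)).
  rewrite ler_wpM2l ?(ltW d0)//; apply: ler_sum => i _.
  by rewrite ler_wiXn2l// ?(ltW p1)// -ltnS.
by rewrite -opprB mulNr -subrX1 opprB gerBl exprn_ge0.
Qed.

(* The approximant is the mean of [f(v) |z + v|^(2n)] over the (n+1)-th roots of unity v,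
   normalized by the mean of [|z + v|^(2n)], which does not depend on z. *)
Lemma trig_approx (f : R[i] -> R) (B e : R) : continuous f ->
  (forall z, `|f z| <= B) -> 0 < e ->
  exists p : {poly R[i]}, forall z, normc z = 1 -> `|f z - complex.Re p.[z]| <= e.
Proof.
move=> cf fB e0.
have e20 : 0 < e / 2 by rewrite divr_gt0.
have [d' d'0 fd'] := continuous_near_circle cf e20.
pose d := Num.min d' 1.
have d0 : 0 < d by rewrite lt_min d'0/=.
have d1 : d <= 1 by rewrite ge_min lexx orbT.
have fd z w : normc z = 1 -> normc (w - z) < d -> `|f w - f z| < e / 2.
  by move=> z1 wz; apply: fd' => //; rewrite (lt_le_trans wz)// ge_min lexx.
have B0 : 0 <= B by exact: le_trans (fB 0).
(* On the circle |z + v|^2 = 4 - |z - v|^2, which is at most 4 q as soon as |z - v| is at least d;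
   [d <= 1] keeps q in [0, 1). *)
pose q := 1 - d ^+ 2 / 4.
have d2 : 0 < d ^+ 2 <= 1 by rewrite exprn_gt0//= exprn_ile1 ?(ltW d0).
have [n nq] : exists n : nat, n.+1%:R * q ^+ n <= e / 2 / (2 * B + 1).
  apply: exists_natM_geometric_le; rewrite /q; try lra.
  by rewrite divr_gt0// ltr_wpDl// mulr_ge0.
have [w wN] := @closed_prim_root R[i] n.+1 (ltn0Sn n).
have w1 i : normc (w ^+ i) = 1.
  have -> : normc (w ^+ i) = normc w ^+ i by rewrite normcX.
  rewrite (_ : normc w = 1) ?expr1n//.
  apply: (@pexpIrn R n.+1) => //; rewrite ?nnegrE ?normc_ge0//.
  by rewrite -normcX (prim_expr_order wN) Normc.normc1 expr1n.
pose N : R := n.+1%:R; pose c := sqbin n.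
have N0 : 0 < N by rewrite ltr0n.
have c0 : 0 < c.
  by rewrite -(pmulr_rgt0 _ N0) (lt_le_trans _ (sqbin_ge n))// exprn_gt0.
have Nc0 : 0 < N * c by rewrite mulr_gt0.
pose h z := (N * c)^-1 * \sum_(i < n.+1) f (w ^+ i) * normc (z + w ^+ i) ^+ (2 * n).
have [p pE] : trig h.
  by apply: trigZ; apply: trig_sum => i; apply: trigZ; exact: trig_vallee_poussin.
exists p => z z1; rewrite -pE//.
have -> : f z - h z = (N * c)^-1 *
    \sum_(i < n.+1) (f z - f (w ^+ i)) * normc (z + w ^+ i) ^+ (2 * n).
  under eq_bigr do rewrite mulrBl.
  rewrite sumrB -mulr_sumr vallee_poussin_mean// mulrBr; congr (_ - _).
  by rewrite -/N -/c mulrCA mulVf ?mulr1// gt_eqF.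
rewrite normrM gtr0_norm ?invr_gt0// ler_pdivrMl//.
rewrite (le_trans (ler_norm_sum _ _ _))//.
apply: (@le_trans _ _ (\sum_(i < n.+1)
    (e / 2 * normc (z + w ^+ i) ^+ (2 * n) + 2 * B * (4 ^+ n * q ^+ n)))).
  apply: ler_sum => i _; rewrite normrM [X in _ * X]ger0_norm ?exprn_ge0 ?normc_ge0//.
  have K0 : 0 <= normc (z + w ^+ i) ^+ (2 * n) by rewrite exprn_ge0 ?normc_ge0.
  have q0 : 0 <= q by rewrite /q; lra.
  have [near|far] := ltP (normc (z - w ^+ i)) d.
    rewrite -[leLHS]addr0 lerD//; last by rewrite !mulr_ge0// exprn_ge0.
    by rewrite ler_wpM2r// ltW// fd.
  rewrite -[leLHS]add0r lerD//; first by rewrite mulr_ge0// ltW.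
  apply: ler_pM => //.
    rewrite (le_trans (ler_normB _ _))// mulr2n mulrDl mul1r lerD//.
  rewrite exprM -exprMn lerXn2r ?nnegrE ?sqr_ge0 ?mulr_ge0//.
  have : normc (z + w ^+ i) ^+ 2 + normc (z - w ^+ i) ^+ 2 = 4.
    have := z1; have := w1 i => /(congr1 (fun x => x ^+ 2)) + /(congr1 (fun x => x ^+ 2)).
    rewrite !sqr_normcE; case: (z) (w ^+ i) => [a b] [u v] /=; lra.
  have : d ^+ 2 <= normc (z - w ^+ i) ^+ 2.
    by rewrite lerXn2r ?nnegrE ?normc_ge0 ?(ltW d0).
  rewrite /q; lra.
rewrite big_split/= -mulr_sumr vallee_poussin_mean// -/N -/c sumr_const card_ord.
rewrite -[X in _ + X]mulr_natl -/N.
rewrite [leRHS](_ : _ = e / 2 * (N * c) + N * c * (e / 2)); last by field.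
rewrite lerD2l.
(* [sqbin_ge] trades 4^n for (n+1) [sqbin n]; the extra factor n + 1 is absorbed by the geometric
   decay. *)
apply: (@le_trans _ _ (N * (2 * B * (N * c * q ^+ n)))).
  rewrite ler_pM2l// ler_wpM2l ?mulr_ge0// ler_wpM2r ?sqbin_ge// exprn_ge0//.
  by rewrite /q; lra.
rewrite (_ : _ * _ = N * c * (2 * B * (N * q ^+ n))); last by ring.
rewrite ler_pM2l//.
apply: (@le_trans _ _ (2 * B * (e / 2 / (2 * B + 1)))).
  by rewrite ler_wpM2l ?mulr_ge0.
rewrite mulrA ler_pdivrMr ?ltr_wpDl ?mulr_ge0//.
by rewrite mulrC ler_wpM2l ?(ltW e20)// lerDl.
Qed.
End TrigonometricApproximation.

(** * The deterministic limit *)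

Section Deterministic.
Variable R : realType.
Local Open Scope complex_scope.

Lemma gen_deriv_zeros n (z l : 'I_n -> R[i]) : \sum_(j < n) l j != 0 ->
  size (zeros (gen_deriv z l)) = n.-1 /\
  gen_deriv z l = lead_coef (gen_deriv z l) *:
    \prod_(W <- zeros (gen_deriv z l)) ('X - W%:P).
Proof.
move=> l0; split; last exact: zerosE.
rewrite size_zeros ?size_gen_deriv// -size_poly_gt0 size_gen_deriv//.
by case: n z l l0 => // z l; rewrite big_ord0 eqxx.
Qed.

(** When all |z j| = 1, these are up to sign and conjugation the Taylor coefficients at 0 of
    [gen_deriv / root_poly] divided by n, since the conjugate of z j is then its inverse. *)
Definition conj_moment n (z l : 'I_n -> R[i]) i :=
  n%:R^-1 * \sum_(j < n) (l j)^* * z j ^+ i.+1.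

(** The Taylor expansion at 0 is cut after degree m and evaluated at a real t, which conjugation
    fixes. Terms below degree m are bounded with t^i <= 1, as they tend to 0 where the lemma is
    applied. *)
Lemma interior_lower_bound n (z l : 'I_n -> R[i]) (K t : R) m : (0 < n)%N ->
  (forall j, normc (z j) = 1) -> 0 < t -> t < 1 ->
  \sum_(j < n) normc (l j) <= K * n%:R ->
  (t ^+ m * normc (conj_moment z l m) - \sum_(i < m) normc (conj_moment z l i) -
   t ^+ m.+1 * K / (1 - t)) * n%:R <=
  normc (\sum_(j < n) l j / (t%:C - z j)).
Proof.
move=> n0 z1 t0 t1 lK; set c := conj_moment z l.
have n0' : 0 < n%:R :> R by rewrite ltr0n.
have nC0 : n%:R != 0 :> R[i] by rewrite pnatr_eq0 -lt0n.
have nt : normc t%:C = t by rewrite normc_real gtr0_norm.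
have tz j : t%:C * z j != 1.
  apply/eqP => /(congr1 (@Normc.normc R)); rewrite normcM z1 mulr1 nt Normc.normc1.
  by move=> e; move: t1; rewrite e ltxx.
have z0 j : z j != 0 by rewrite -normc_gt0 z1.
pose rem := \sum_(j < n) (l j)^* * z j * ((t%:C * z j) ^+ m.+1 / (1 - t%:C * z j)).
have FE : - (\sum_(j < n) l j / (t%:C - z j))^*%R =
    \sum_(i < m.+1) t%:C ^+ i * (n%:R * c i) + rem.
  rewrite rmorph_sum -sumrN.
  under [X in _ = X + _]eq_bigr do rewrite /c /conj_moment mulVKf// mulr_sumr.
  rewrite exchange_big -big_split/=; apply: eq_bigr => j _.
  have -> : (l j / (t%:C - z j))^*%R = (l j)^*%R / (t%:C - (z j)^-1).
    rewrite rmorphM fmorphV rmorphB; congr (_ / (_ - _)); first exact: conjC_real.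
    exact: conjC_unit.
  have h1 : 1 - t%:C * z j != 0 by rewrite subr_eq0 eq_sym.
  have -> : (t%:C - (z j)^-1)^-1 = - (z j / (1 - t%:C * z j)).
    have h2 : t%:C - (z j)^-1 != 0.
      apply: contra (tz j); rewrite subr_eq0 => /eqP ->; by rewrite mulVf.
    apply: (mulfI h2); rewrite divff//; field.
    by rewrite h1 z0.
  have geo : (1 - t%:C * z j)^-1 = \sum_(i < m.+1) (t%:C * z j) ^+ i +
      (t%:C * z j) ^+ m.+1 / (1 - t%:C * z j).
    apply: (mulfI h1); rewrite divff// mulrDr mulrCA divff// mulr1.
    by rewrite -[1 - t%:C * z j]opprB mulNr -subrX1 opprB subrK.
  rewrite mulrN opprK [in LHS]geo mulrA mulrDr; congr (_ + _).
  rewrite mulr_sumr; apply: eq_bigr => i _.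
  by rewrite exprMn exprS; ring.
rewrite -[leRHS]normc_conj -[leRHS]normcN FE big_ord_recr/=.
have rem_le : normc rem <= t ^+ m.+1 * K / (1 - t) * n%:R.
  rewrite (le_trans (normc_sum_le _ _ _))//.
  rewrite (_ : _ * n%:R = (K * n%:R) * (t ^+ m.+1 / (1 - t))); last by ring.
  have t1' : 0 < 1 - t by rewrite subr_gt0.
  have tt0 : 0 <= t ^+ m.+1 / (1 - t) by rewrite divr_ge0 ?exprn_ge0// ltW.
  rewrite (le_trans _ (ler_wpM2r tt0 lK))// mulr_suml; apply: ler_sum => j _.
  rewrite !normcM normc_conj z1 mulr1 normcX normcV normcM z1 mulr1 nt.
  rewrite ler_wpM2l ?normc_ge0// ler_wpM2l ?exprn_ge0 ?(ltW t0)//.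
  have := normcB_ge 1 (t%:C * z j); rewrite Normc.normc1 normcM z1 mulr1 nt => h.
  by rewrite lef_pV2 ?posrE ?(lt_le_trans t1' h).
have sum_le : normc (\sum_(i < m) t%:C ^+ i * (n%:R * c i)) <=
    (\sum_(i < m) normc (c i)) * n%:R.
  rewrite (le_trans (normc_sum_le _ _ _))// mulr_suml; apply: ler_sum => i _.
  rewrite normcM (normcM n%:R) normcX nt normc_nat mulrCA [leRHS]mulrC ler_wpM2l//.
  by apply: ler_piMl; rewrite ?normc_ge0// exprn_ile1 ?(ltW t0) ?(ltW t1).
have top : normc (t%:C ^+ m * (n%:R * c m)) = t ^+ m * normc (c m) * n%:R.
  by rewrite normcM (normcM n%:R) normcX nt normc_nat; ring.
set A := (X in normc X <= _) in sum_le *; set B := t%:C ^+ m * _ in top *.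
have := normcB_ge B (- (A + rem)); rewrite opprK normcN addrA (addrC B) => h.
have := le_normcD A rem; lra.
Qed.

(* Inside the unit disk [gen_deriv / root_poly], divided by n, tends to
   [- \sum_m (b m)^* X^m]; the zeros are counted from a small t > 0 at which the lowest
   nonzero term of this series dominates. *)
Lemma interior_zero_count (z : nat -> R[i]) (lam : forall n, 'I_n -> R[i])
    (b : nat -> R[i]) (K r : R) :
  0 <= r < 1 -> (forall j, normc (z j) = 1) -> (exists m, b m != 0) -> 0 < K ->
  (forall m, (fun n => conj_moment (fun j : 'I_n => z j) (lam n) m) @ \oo --> b m) ->
  (forall n, (2 <= n)%N -> \sum_(j < n) normc (lam n j) <= K * n%:R) ->
  (forall n, (2 <= n)%N -> \sum_(j < n) lam n j != 0) ->
  exists N0 : nat, \forall n \near \oo,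
    (count (fun W => (normc W <= r)%R)
       (zeros (gen_deriv (fun j : 'I_n => z j) (lam n))) <= N0)%N.
Proof.
move=> r01 z1 exb K0 cb lK l0.
have [m bm0 minm] : exists2 m, b m != 0 & forall i, (i < m)%N -> b i = 0.
  have [m bm mm] := ex_minnP exb; exists m => // i im.
  by apply/eqP/negP => /negP /mm; rewrite leqNgt im.
have nb0 : 0 < normc (b m) by rewrite normc_gt0.
(* [t <= 1/2] bounds 1/(1 - t) by 2, and [t <= |b m| / (8 K)] then brings the remainder below beta;
   the leading term is eventually above 2 beta. *)
pose t := Num.min (2^-1) (normc (b m) / (8 * K)).
have t0 : 0 < t by rewrite lt_min invr_gt0 ltr0n divr_gt0// mulr_gt0.
have t12 : t <= 2^-1 by rewrite ge_min lexx.
have t1 : t < 1 by rewrite (le_lt_trans t12)// invf_lt1// ltr1n.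
have tK : 2 * K * t <= normc (b m) / 4.
  have : t <= normc (b m) / (8 * K) by rewrite ge_min lexx orbT.
  by rewrite ler_pdivlMr ?mulr_gt0//; lra.
pose beta := t ^+ m * normc (b m) / 4.
have beta0 : 0 < beta by rewrite divr_gt0// mulr_gt0// exprn_gt0.
have x01 : 0 <= t < 1 by rewrite (ltW t0).
have [N0 HN0] := zeros_inside_count r01 x01 (ltW K0) beta0.
exists N0.
have remle : t ^+ m.+1 * K / (1 - t) <= beta.
  rewrite ler_pdivrMr ?subr_gt0// exprSr /beta.
  rewrite (_ : _ * K = t ^+ m * (K * t)); last by ring.
  rewrite (_ : _ * (1 - t) = t ^+ m * (normc (b m) / 4 * (1 - t))); last by ring.
  rewrite ler_pM2l ?exprn_gt0//.
  rewrite (@le_trans _ _ (normc (b m) / 4 * 2^-1))//; first by lra.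
  by rewrite ler_pM2l ?divr_gt0//; lra.
have cn i : (fun n => normc (conj_moment (fun j : 'I_n => z j) (lam n) i)) @ \oo --> normc (b i).
  exact: (continuous_cvg _ (@continuous_normc R (b i)) (cb i)).
have : (fun n => t ^+ m * normc (conj_moment (fun j : 'I_n => z j) (lam n) m) -
    \sum_(i < m) normc (conj_moment (fun j : 'I_n => z j) (lam n) i)) @ \oo -->
    t ^+ m * normc (b m) - \sum_(i < m) normc (b i).
  apply: cvgB; first exact: cvgMr.
  by apply: cvg_big => [|i _]; [exact: add_continuous|exact: cn].
rewrite [X in _ - X]big1 ?subr0 => [cv|i _]; last by rewrite minm ?ltn_ord// Normc.normc0.
have lt2 : 2 * beta < t ^+ m * normc (b m).
  have : 0 < t ^+ m * normc (b m) by rewrite mulr_gt0// exprn_gt0.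
  by rewrite /beta; lra.
have [N1 _ HN1] := cvgr_gt _ cv _ lt2.
exists (maxn N1 2) => // n /=; rewrite geq_max => /andP[nN1 n2].
have n0 : (0 < n)%N by exact: ltnW.
have [_ E] := gen_deriv_zeros (fun j : 'I_n => z j) (l0 _ n2).
have nt : normc t%:C = t by rewrite normc_real gtr0_norm.
apply: (HN0 n _ _ _ _ t%:C n0 _ _ E (lK _ n2)) => //; first by rewrite nt.
apply: le_trans (interior_lower_bound m n0 _ t0 t1 (lK _ n2)) => //.
rewrite ler_wpM2r//; have := HN1 n nN1 => /=; lra.
Qed.
End Deterministic.

Section DeterministicLimit.
Variable R : realType.
Local Open Scope complex_scope.

Lemma near_div_pred (C e : R) : 0 < e -> \forall n \near \oo, C / n.-1%:R < e.
Proof.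
move=> e0; pose N := (Num.truncn (`|C| / e)).+2.
exists N => // n /= Nn.
have n1 : (`|C| / e) < n.-1%:R.
  apply: (@lt_le_trans _ _ (N.-1)%:R); first exact: truncnS_gt.
  by rewrite ler_nat -!subn1 leq_sub2r.
have n0 : 0 < n.-1%:R :> R by rewrite (le_lt_trans _ n1)// divr_ge0// ltW.
by rewrite ltr_pdivrMr// mulrC (le_lt_trans (ler_norm _))// -ltr_pdivrMr.
Qed.

Variables (z : nat -> R[i]) (lam : forall n, 'I_n -> R[i]) (b : nat -> R[i]).
Arguments lam : clear implicits.
Variables (K delta : R) (mom : nat -> R[i]).
Hypothesis z1 : forall j, normc (z j) = 1.
Hypothesis exb : exists m, b m != 0.
Hypothesis K0 : 0 < K.
Hypothesis delta0 : 0 < delta.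
Hypothesis cb :
  forall m, (fun n => conj_moment (fun j : 'I_n => z j) (lam n) m) @ \oo --> b m.
Hypothesis lK : forall n, (2 <= n)%N -> \sum_(j < n) normc (lam n j) <= K * n%:R.
Hypothesis ldelta :
  forall n, (2 <= n)%N -> delta * n%:R <= normc (\sum_(j < n) lam n j).
Hypothesis zmom :
  forall k, (fun n => n%:R^-1 * \sum_(j < n) z j ^+ k) @ \oo --> mom k.

Let G n := gen_deriv (fun j : 'I_n => z j) (lam n).

Let l0 n : (2 <= n)%N -> \sum_(j < n) lam n j != 0.
Proof.
move=> n2; rewrite -normc_gt0 (lt_le_trans _ (ldelta n2))// mulr_gt0// ltr0n.
exact: ltnW.
Qed.

Lemma zeros_power_mean k :
  (fun n => n.-1%:R^-1 * \sum_(W <- zeros (G n)) W ^+ k) @ \oo --> mom k.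
Proof.
have [B [B0 HB]] := power_sum_bound k (ltW K0) delta0.
have diff n : (2 <= n)%N ->
    normc (n%:R^-1 * (\sum_(j < n) z j ^+ k) -
           n.-1%:R^-1 * \sum_(W <- zeros (G n)) W ^+ k) <= (B + 1) / n.-1%:R.
  move=> n2.
  have [sz E] := gen_deriv_zeros (fun j : 'I_n => z j) (l0 n2).
  have n0 : (0 < n)%N by exact: ltnW.
  have n1 : (0 < n.-1)%N by rewrite -ltnS prednK.
  have nR : 0 < n%:R :> R by rewrite ltr0n.
  have n1R : 0 < n.-1%:R :> R by rewrite ltr0n.
  have nC : n%:R != 0 :> R[i] by rewrite pnatr_eq0 -lt0n.
  have n1C : n.-1%:R != 0 :> R[i] by rewrite pnatr_eq0 -lt0n.
  have nE : n%:R = n.-1%:R + 1 :> R[i] by rewrite natr1 prednK.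
  (* [power_sum_bound] starts at exponent 1; at exponent 0 the power sums are n and n - 1 and both
     means are 1. *)
  case: (k) HB => [|k'] HB.
    under eq_bigr do rewrite expr0; under [X in _ - _ * X]eq_bigr do rewrite expr0.
    rewrite sumr_const card_ord.
    rewrite big_const_seq count_predT sz iter_addr_0 !mulVf// subrr Normc.normc0.
    by rewrite divr_ge0// ?addr_ge0// ltW.
  have {}HB := HB _ _ _ _ _ n0 (fun j => z1 j) sz E (lK n2) (ldelta n2) _ (ltnSn k').
  set s := \sum_(j < n) _ in HB *; set w := \sum_(W <- _) _ in HB *.
  rewrite (_ : _ - _ = n.-1%:R^-1 * (s - w) - n.-1%:R^-1 * n%:R^-1 * s); last first.
    by rewrite nE; field; rewrite -nE nC n1C.
  rewrite (le_trans (normcB_le _ _))// mulrDl lerD//.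
    by rewrite normcM normcV normc_nat mulrC ler_wpM2r// invr_ge0 ltW.
  rewrite -mulrA normcM normcV normc_nat mulrC ler_wpM2r ?invr_ge0 ?(ltW n1R)//.
  rewrite normcM normcV normc_nat ler_pdivrMl// mulr1 (le_trans (normc_sum_le _ _ _))//.
  under eq_bigr do rewrite normcX z1 expr1n.
  by rewrite sumr_const card_ord.
apply/(cvgC_normcP _) => e e0.
have e20 : 0 < e / 2 by rewrite divr_gt0.
have /cvgC_normcP/(_ _ e20) nearz := @zmom k.
have nearB := near_div_pred (B + 1) e20.
have near2 : \forall n \near \oo, (2 <= n)%N by exists 2.
near=> n.
have n2 : (2 <= n)%N by near: n.
have Bn : (B + 1) / n.-1%:R < e / 2 by near: n.
have zn : normc (mom k - n%:R^-1 * (\sum_(j < n) z j ^+ k)) < e / 2 by near: n.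
rewrite -(subrKA (n%:R^-1 * (\sum_(j < n) z j ^+ k))).
rewrite (le_lt_trans (le_normcD _ _))// [ltRHS]splitr ltrD//.
exact: le_lt_trans (diff n n2) Bn.
Unshelve. all: by end_near. Qed.

(** The last hypothesis says that [L] behaves as the integral of f against a measure on the circle
    with moments [mom]. The difference f - Re p is small near the circle, and the boundedly many
    zeros away from it contribute O(1/n). *)
Lemma zeros_mean_cvg (f : R[i] -> R) (B M L : R) : continuous f ->
  (forall x, `|f x| <= B) ->
  (forall n, (2 <= n)%N -> {in zeros (G n), forall W, normc W <= M}) ->
  (forall (p : {poly R[i]}) (e : R), (forall x, normc x = 1 -> `|f x - complex.Re p.[x]| <= e) ->
     `|L - complex.Re (\sum_(k < size p) p`_k * mom k)| <= e) ->
  (fun n => n.-1%:R^-1 * \sum_(W <- zeros (G n)) f W) @ \oo --> L.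
Proof.
move=> cf fB WM HL.
have B0 : 0 <= B by exact: le_trans (fB 0).
apply/(@cvgrPdist_le _ _ _ _ _) => e e0.
(* Five errors of size e' accumulate: one from [L], one from the power means, two from the zeros
   near the circle and one from the others. *)
pose e' := e / 6.
have e'0 : 0 < e' by rewrite divr_gt0.
have [p pE] := trig_approx cf fB e'0.
pose g W := f W - complex.Re p.[W].
have cg : continuous g.
  move=> x; apply: (@cvgB _ _ _ (nbhs x) (nbhs_filter x)); first exact: cf.
  exact: (continuous_comp (@continuous_hornerC R p x) (@continuous_Re R _)).
have [d d0 gd] := continuous_near_circle cg e'0.
(* The annulus r < |W| < 1/r lies within d of the circle: 1/r - 1 is d/2 and 1 - r is at most
   d/2. *)
pose r := (1 + d / 2)^-1.
have d20 : 0 < d / 2 by rewrite divr_gt0.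
have r1 : r < 1 by rewrite invf_lt1 ?ltrDl// addr_gt0.
have r0 : 0 < r by rewrite invr_gt0 addr_gt0.
have r01 : 0 <= r < 1 by rewrite r1 ltW.
have r01' : 0 < r < 1 by rewrite r0 r1.
have [N0 in0] := interior_zero_count r01 z1 exb K0 cb lK l0.
have [N1 out0] := zeros_outside_count r01' (ltW K0) delta0.
pose Mb := `|M| + 1.
pose gB := B + \sum_(k < size p) normc p`_k * Mb ^+ k.
have gB0 : 0 <= gB.
  rewrite addr_ge0// sumr_ge0// => k _; rewrite mulr_ge0 ?normc_ge0// exprn_ge0//.
  by rewrite addr_ge0.
have gM W : normc W <= M -> `|g W| <= gB.
  move=> WM'; rewrite (le_trans (ler_normB _ _))// lerD//.
  rewrite (le_trans (normc_ge_absRe _))// horner_coef (le_trans (normc_sum_le _ _ _))//.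
  apply: ler_sum => k _; rewrite normcM normcX ler_wpM2l ?normc_ge0//.
  rewrite lerXn2r ?nnegrE ?normc_ge0 ?addr_ge0// (le_trans WM')//.
  by rewrite (le_trans (ler_norm _))// lerDl.
have ggood W : r < normc W -> normc W < r^-1 -> `|g W| <= 2 * e'.
  move=> rW Wr; have W0 : 0 < normc W by rewrite (lt_trans r0).
  have WC0 : (normc W)%:C != 0 by rewrite -normc_gt0 normc_real gtr0_norm.
  pose x := W / (normc W)%:C.
  have x1 : normc x = 1.
    by rewrite normcM normcV normc_real gtr0_norm// divff// gt_eqF.
  have WE : W = x * (normc W)%:C by rewrite divfK.
  have : normc (W - x) < d.
    rewrite {1}WE (_ : _ - _ = x * (normc W - 1)%:C); last first.
      by rewrite rmorphB rmorph1 mulrBr mulr1.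
    rewrite normcM x1 mul1r normc_real ltr_norml.
    move: Wr rW; rewrite /r invrK => Wr.
    have : 1 - d / 2 <= (1 + d / 2)^-1.
      rewrite -[leRHS]mul1r ler_pdivlMr ?addr_gt0//; nra.
    lra.
  move=> /(gd _ _ x1); have := pE _ x1; rewrite -/(g x).
  move: (ler_normB (g x) (g x - g W)); rewrite opprB addrC subrK (distrC (g x)); lra.
have gle n : (2 <= n)%N -> (count (fun W => (normc W <= r)%R) (zeros (G n)) <= N0)%N ->
    `|n.-1%:R^-1 * \sum_(W <- zeros (G n)) g W| <= 2 * e' + (gB * (N0 + N1)%:R) / n.-1%:R.
  move=> n2 in1.
  have [sz E] := gen_deriv_zeros (fun j : 'I_n => z j) (l0 n2).
  have n0 : (0 < n)%N by exact: ltnW.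
  have n1R : 0 < n.-1%:R :> R by rewrite ltr0n -ltnS prednK.
  have out1 := out0 _ _ _ _ _ n0 (fun j => z1 j) sz E (lK n2) (ldelta n2).
  rewrite normrM ger0_norm ?invr_ge0 ?(ltW n1R)// ler_pdivrMl//.
  rewrite mulrDr [X in _ + X]mulrCA divff ?mulr1 ?gt_eqF//.
  rewrite (le_trans (ler_norm_sum _ _ _))//.
  apply: (@le_trans _ _ (\sum_(W <- zeros (G n)) (2 * e' +
      (gB * (normc W <= r)%R%:R + gB * (r^-1 <= normc W)%R%:R)))).
    rewrite big_seq [leRHS]big_seq; apply: ler_sum => W Ws.
    have WM' := WM n n2 W Ws.
    have [Wr|rW] := leP (normc W) r.
      rewrite mulr1; apply: ler_wpDl; first by rewrite mulr_ge0 ?(ltW e'0).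
      by apply: ler_wpDr; [rewrite mulr_ge0|exact: gM].
    have [rW'|Wr'] := leP (r^-1) (normc W).
      rewrite mulr0 add0r mulr1; apply: ler_wpDl; last exact: gM.
      by rewrite mulr_ge0 ?(ltW e'0).
    by rewrite !mulr0 !addr0 ggood.
  rewrite big_split/= big_const_seq count_predT sz iter_addr_0 -[X in X + _]mulr_natl lerD2l.
  rewrite big_split/= -!mulr_sumr -mulrDr ler_wpM2l// -!natr_sum.
  by rewrite -natrD ler_nat -!big_mkcond !sum1_count leq_add.
have cvp : (fun n => complex.Re (\sum_(k < size p) p`_k *
    (n.-1%:R^-1 * \sum_(W <- zeros (G n)) W ^+ k))) @ \oo -->
    complex.Re (\sum_(k < size p) p`_k * mom k).
  rewrite Re_sum; under eq_fun do rewrite Re_sum.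
  apply: cvg_big => [|k _]; first exact: add_continuous.
  apply: (continuous_cvg _ (@continuous_Re R _)).
  by apply: cvgC_M; [exact: cvg_cst|exact: zeros_power_mean].
have pL := HL p e' pE.
have /cvgrPdist_lt/(_ _ e'0) nearp := cvp.
have nearN := near_div_pred (gB * (N0 + N1)%:R) e'0.
have near2 : \forall n \near \oo, (2 <= n)%N by exists 2.
near=> n.
have n2 : (2 <= n)%N by near: n.
have gn : `|n.-1%:R^-1 * \sum_(W <- zeros (G n)) g W| <=
    2 * e' + (gB * (N0 + N1)%:R) / n.-1%:R by apply: gle => //; near: n.
have Nn : (gB * (N0 + N1)%:R) / n.-1%:R < e' by near: n.
have pn : `|complex.Re (\sum_(k < size p) p`_k * mom k) -
   complex.Re (\sum_(k < size p) p`_k *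
    (n.-1%:R^-1 * \sum_(W <- zeros (G n)) W ^+ k))| < e' by near: n.
have fE : n.-1%:R^-1 * \sum_(W <- zeros (G n)) f W =
    n.-1%:R^-1 * \sum_(W <- zeros (G n)) g W +
    complex.Re (\sum_(k < size p) p`_k *
      (n.-1%:R^-1 * \sum_(W <- zeros (G n)) W ^+ k)).
  have -> : \sum_(k < size p) p`_k * (n.-1%:R^-1 * \sum_(W <- zeros (G n)) W ^+ k) =
      (n.-1%:R^-1)%:C * \sum_(W <- zeros (G n)) p.[W].
    under [in RHS]eq_bigr do rewrite horner_coef.
    rewrite exchange_big/= mulr_sumr; apply: eq_bigr => k _.
    by rewrite -mulr_sumr mulrCA fmorphV rmorph_nat.
  by rewrite Re_realM Re_sum -mulrDr -big_split/=; under [in RHS]eq_bigr do rewrite subrK.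
rewrite fE; move: pL pn gn Nn; rewrite !ler_norml !ltr_norml.
set A1 := n.-1%:R^-1 * _; set A2 := complex.Re _; set A3 := complex.Re _.
set A4 := _ / _; rewrite /e'.
move=> /andP[? ?] /andP[? ?] /andP[? ?] ?; apply/andP; split; lra.
Unshelve. all: by end_near. Qed.
End DeterministicLimit.

(** * A strong law for weighted means *)

Section IntegralAgainstIndependent.
Context d d' (Omega : measurableType d) (T : measurableType d') (R : realType).
Variables (P : probability Omega R) (X : {mfun Omega >-> T}) (F : Omega -> R) (c : R).
Hypothesis mF : measurable_fun setT F.
Hypothesis F0 : forall w, 0 <= F w.
(** Independence of F and X in the form that an induction over events can supply; c is the mean of
    F. *)
Hypothesis FX : forall A, measurable A ->
  (\int[P]_(w in X @^-1` A) (F w)%:E = c%:E * P (X @^-1` A))%E.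

Let mFX (h : T -> R) : measurable_fun setT h -> measurable_fun setT (fun w => F w * h (X w)).
Proof.
by move=> mh; apply: measurable_funM => //; exact: measurableT_comp.
Qed.

Import HBNNSimple.

Let integral_indep_nnsfun (h : {nnsfun T >-> R}) :
  (\int[P]_w (F w * h (X w))%:E = c%:E * \int[P]_w (h (X w))%:E)%E.
Proof.
have hE w : h (X w) = \sum_(y \in range h) y * \1_(h @^-1` [set y]) (X w).
  by rewrite fimfunE.
have mA y : measurable (h @^-1` [set y]) by exact: measurable_sfunP.
have mi y : measurable_fun setT (fun w => \1_(h @^-1` [set y]) (X w) : R).
  by apply: measurableT_comp => //; exact: measurable_indic.
have pos y w : (0 <= (y * \1_(h @^-1` [set y]) (X w))%:E :> \bar R)%E.
  by rewrite EFinM nnfun_muleindic_ge0.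
have iE y : (\int[P]_w (F w * (y * \1_(h @^-1` [set y]) (X w)))%:E =
    c%:E * \int[P]_w (y * \1_(h @^-1` [set y]) (X w))%:E)%E.
  (* Outside the range of h, y may be negative, but then the indicator is 0 and both sides
     vanish. *)
  have [hy|hy] := pselect (exists x, h x = y); last first.
    have z w : \1_(h @^-1` [set y]) (X w) = 0 :> R.
      by rewrite indicE memNset// => hXy; apply: hy; exists (X w).
    by under eq_integral do rewrite z !mulr0; under [in RHS]eq_integral do rewrite z mulr0;
      rewrite integral0 mule0.
  have y0 : 0 <= y by case: hy => x <-.
  under eq_integral do rewrite mulrCA EFinM; under [in RHS]eq_integral do rewrite EFinM.
  rewrite !ge0_integralZl//; last 3 first.
  - exact/measurable_EFinP.
  - by apply/measurable_EFinP; exact: measurable_funM.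
  - by move=> w _; rewrite lee_fin mulr_ge0.
  rewrite muleCA; congr (_ * _)%E.
  have -> : (\int[P]_w (\1_(h @^-1` [set y]) (X w))%:E = P (X @^-1` (h @^-1` [set y])))%E.
    rewrite -[X in P X]setIT -integral_indic//.
    by rewrite -[X in measurable X]setTI; exact: measurable_funP.
  rewrite -FX// [RHS]integral_mkcond; apply: eq_integral => w _.
  rewrite patchE indicE; have [hXy|hXy] := boolP (X w \in _).
    by rewrite mulr1 mem_set//; exact: set_mem hXy.
  rewrite mulr0 memNset// => hXy'.
  by move/negP: hXy; apply; rewrite inE.
transitivity (\sum_(y \in range h) \int[P]_w (F w * (y * \1_(h @^-1` [set y]) (X w)))%:E)%E.
  rewrite -ge0_integral_fsum//; last 2 first.
  - move=> y; apply/measurable_EFinP; apply: measurable_funM => //.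
    exact: measurable_funM.
  - by move=> y w _; rewrite EFinM mule_ge0// lee_fin.
  apply: eq_integral => w _; rewrite hE fsumEFin//; congr (_%:E).
  by rewrite !fsbig_finite//= mulr_sumr.
transitivity (\sum_(y \in range h) c%:E * \int[P]_w (y * \1_(h @^-1` [set y]) (X w))%:E)%E.
  by apply: eq_fsbigr => y _.
rewrite -ge0_mule_fsumr; last by move=> y; apply: integral_ge0.
congr (_ * _)%E; rewrite -ge0_integral_fsum//; last first.
  by move=> y; apply/measurable_EFinP; exact: measurable_funM.
by apply: eq_integral => w _; rewrite hE fsumEFin.
Qed.

Lemma integral_indep (h : T -> R) : measurable_fun setT h -> (forall x, 0 <= h x) ->
  (\int[P]_w (F w * h (X w))%:E = c%:E * \int[P]_w (h (X w))%:E)%E.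
Proof.
move=> mh h0.
have mEh : measurable_fun setT (EFin \o h) by exact/measurable_EFinP.
pose f_ := nnsfun_approx measurableT mEh.
have cvf x : (f_ n x)%:E @[n --> \oo] --> (h x)%:E.
  by apply: (cvg_nnsfun_approx measurableT mEh) => //= y _; rewrite lee_fin.
have ndf x m n : (m <= n)%N -> f_ m x <= f_ n x.
  by move=> mn; exact/lefP/nd_nnsfun_approx.
have mfX n : measurable_fun setT (fun w => f_ n (X w)) by exact: measurableT_comp.
transitivity (lim (\int[P]_w (F w * f_ n (X w))%:E @[n --> \oo])%E).
  rewrite -monotone_convergence//=; last 3 first.
  - by move=> n; apply/measurable_EFinP; exact: mFX.
  - by move=> n w _; rewrite lee_fin mulr_ge0.
  - by move=> w _ m n mn; rewrite lee_fin ler_wpM2l// ndf.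
  apply: eq_integral => w _; apply/esym/cvg_lim => //.
  by under eq_fun do rewrite EFinM; rewrite EFinM; apply: cvgeZl => //; exact: cvf.
rewrite [X in _ = (_ * X)%E](_ : _ = lim
    (\int[P]_w (f_ n (X w))%:E @[n --> \oo])%E); last first.
  rewrite -monotone_convergence//=.
  - by apply: eq_integral => w _; apply/esym/cvg_lim.
  - by move=> n; exact/measurable_EFinP.
  - by move=> n w _; rewrite lee_fin.
  - by move=> w _ m n mn; rewrite lee_fin ndf.
rewrite -limeMl//.
  by apply: congr_lim; apply/funext => n /=; exact: integral_indep_nnsfun.
apply/ereal_nondecreasing_is_cvgn => m n mn; apply: ge0_le_integral => //=.
- by move=> w _; rewrite lee_fin.
- exact/measurable_EFinP.
- exact/measurable_EFinP.
- by move=> w _; rewrite lee_fin ndf.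
Qed.

End IntegralAgainstIndependent.

(** * Expectations of products of independent variables *)

Section IndependentProduct.
Context d d' (Omega : measurableType d) (T : measurableType d') (R : realType).
Variables (P : probability Omega R) (Z : nat -> {RV P >-> T}).
Hypothesis indepZ : mutually_independent Z.
Variables (f : nat -> T -> R) (e : nat -> R).
Hypothesis mf : forall j, measurable_fun setT (f j).
Hypothesis f0 : forall j x, 0 <= f j x.
Hypothesis fe : forall j, (\int[P]_w (f j (Z j w))%:E = (e j)%:E)%E.

Let e0 j : 0 <= e j.
Proof. by rewrite -lee_fin -fe; apply: integral_ge0 => w _; rewrite lee_fin. Qed.

Let mD (J : {fset nat}) (A : nat -> set T) : (forall j, measurable (A j)) ->
  measurable (\bigcap_(j in [set` J]) Z j @^-1` A j).
Proof.
move=> mA; apply: fin_bigcap_measurable => // j _.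
by rewrite -[X in measurable X]setTI; exact: measurable_funP.
Qed.

Let mprod m : measurable_fun setT (fun w => \prod_(j < m) f j (Z j w)).
Proof.
by apply: measurable_prod => j _; exact: measurableT_comp.
Qed.

(** Mutual independence speaks of events only. For the induction, the product over j < m is
    integrated over an event in the variables of index at least m; peeling off [f m] moves Z_m into
    such an event. *)
Lemma integral_indep_prod_setI m (J : {fset nat}) (A : nat -> set T) :
  (forall j, measurable (A j)) -> (forall j, j \in J -> (m <= j)%N) ->
  (\int[P]_(w in \bigcap_(j in [set` J]) Z j @^-1` A j)
     (\prod_(j < m) f j (Z j w))%:E =
   (\prod_(j < m) e j)%:E * P (\bigcap_(j in [set` J]) Z j @^-1` A j))%E.
Proof.
elim: m J A => [|m IH] J A mA Jm.
  under eq_integral do rewrite big_ord0.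
  by rewrite big_ord0 mul1e integral_cst ?mul1e//; exact: mD.
set D := \bigcap_(j in _) _.
have mDD : measurable D by exact: mD.
pose F w := (\prod_(j < m) f j (Z j w)) * \1_D w.
have mF : measurable_fun setT F by apply: measurable_funM => //; exact: measurable_indic.
have F0 w : 0 <= F w by rewrite mulr_ge0// prodr_ge0.
have PDfin : P D \is a fin_num by exact: fin_num_measure.
pose c := (\prod_(j < m) e j) * fine (P D).
have c0 : 0 <= c by rewrite mulr_ge0 ?prodr_ge0// fine_ge0.
have mJ : m \notin J by apply/negP => /Jm; rewrite ltnn.
have FX B : measurable B ->
    (\int[P]_(w in Z m @^-1` B) (F w)%:E = c%:E * P (Z m @^-1` B))%E.
  (* With the set at index m replaced by [B] and m added to J, the intersection with [D] is an event
     covered by the induction hypothesis. *)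
  move=> mB; pose A' j := if j == m then B else A j.
  have mA' j : measurable (A' j) by rewrite /A'; case: ifP.
  have capE : \bigcap_(j in [set` (m |` J)%fset]) Z j @^-1` A' j = Z m @^-1` B `&` D.
    rewrite set_fsetU1 bigcap_setU1/= {1}/A' eqxx; congr (_ `&` _).
    apply: eq_bigcapr => j /= jJ; rewrite /A'; case: eqP => // jm.
    by move: mJ; rewrite -jm jJ.
  have PE : P (Z m @^-1` B `&` D) = (P (Z m @^-1` B) * P D)%E.
    rewrite -capE indepZ// big_fsetU1//= {1}/A' eqxx; congr (_ * _)%E.
    rewrite indepZ//; apply: eq_big_seq => j jJ; rewrite /A'; case: eqP => // jm.
    by move: mJ; rewrite -jm jJ.
  have := IH (m |` J)%fset A' mA'; rewrite capE PE => IHm.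
  transitivity (\int[P]_(w in Z m @^-1` B `&` D) (\prod_(j < m) f j (Z j w))%:E)%E.
    rewrite integral_mkcondr; apply: eq_integral => w _.
    rewrite /F patchE indicE; case: ifP => _; first by rewrite mulr1.
    by rewrite mulr0.
  rewrite IHm.
    by rewrite /c EFinM fineK// -muleA [(P D * _)%E]muleC.
  by move=> j; rewrite !inE => /orP[/eqP->//|/Jm /ltnW].
have iE := @integral_indep _ _ _ _ _ P (Z m) F c mF F0 FX (f m) (mf m) (f0 m).
rewrite fe in iE; rewrite integral_mkcond.
transitivity (\int[P]_w (F w * f m (Z m w))%:E)%E.
  apply: eq_integral => w _; rewrite patchE /F indicE big_ord_recr/=.
  by case: ifP => _; rewrite ?mulr1// mulr0 mul0r.
rewrite iE /c big_ord_recr/= !EFinM fineK// -!muleA; congr (_ * _)%E.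
by rewrite muleC.
Qed.

Lemma integral_indep_prod n :
  (\int[P]_w (\prod_(j < n) f j (Z j w))%:E = (\prod_(j < n) e j)%:E)%E.
Proof.
have := @integral_indep_prod_setI n fset0 (fun=> setT) (fun=> measurableT).
rewrite (_ : \bigcap_(j in _) _ = [set: Omega]); last first.
  by rewrite -subTset => w _ j.
by rewrite probability_setT mule1; apply => j; rewrite inE.
Qed.
End IndependentProduct.

Section BoundedIntegral.
Context d (T : measurableType d) (R : realType) (mu : probability T R).

Lemma bounded_integrable (h : T -> R) (B : R) : measurable_fun setT h ->
  (forall x, `|h x| <= B) -> mu.-integrable setT (EFin \o h).
Proof.
move=> mh hB; apply: measurable_bounded_integrable => //.
  by rewrite -ge0_fin_numE// fin_num_measure.
exists B; split; first by rewrite num_real.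
by move=> M BM x _; exact: le_trans (hB x) (ltW BM).
Qed.

Lemma EFin_bounded_integral (h : T -> R) (B : R) : measurable_fun setT h ->
  (forall x, `|h x| <= B) ->
  (\int[mu]_x (h x)%:E)%E = (\int[mu]_x h x)%:E.
Proof.
move=> mh hB; rewrite /Rintegral fineK//.
by apply: integrable_fin_num => //; exact: bounded_integrable hB.
Qed.

End BoundedIntegral.

(** exp x is at most 1/(1 - x), and (1 - x)(1 + x + 2 x^2) = 1 + x^2 (1 - 2 x). *)
Lemma expR_le_quadratic (R : realType) (x : R) : `|x| <= 2^-1 ->
  expR x <= 1 + x + 2 * x ^+ 2.
Proof.
rewrite ler_norml => /andP[x1 x2].
have h := expR_ge1Dx (- x).
have p : 0 < 1 - x by lra.
apply: (@le_trans _ _ (1 - x)^-1).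
  by rewrite -[x in expR x]opprK expRN lef_pV2 ?posrE ?expR_gt0.
rewrite -[leLHS]mul1r ler_pdivrMr//; nra.
Qed.

Section Hoeffding.
Context d d' (Omega : measurableType d) (T : measurableType d') (R : realType).
Variables (P : probability Omega R) (mu : probability T R).
Variables (Z : nat -> {RV P >-> T}).
Hypothesis Z_iid : iid Z mu.
Variable g : T -> R.
Hypothesis mg : measurable_fun setT g.
Hypothesis g1 : forall x, `|g x| <= 1.
Let m := \int[mu]_x g x.

Let m1 : `|m| <= 1.
Proof.
rewrite -lee_fin /m -[X in (X <= _)%E]/(`|(\int[mu]_x g x)%:E|)%E.
rewrite -(EFin_bounded_integral mu mg g1).
rewrite (le_trans (le_abse_integral _ _ _))//; first exact/measurable_EFinP.
apply: (@le_trans _ _ (\int[mu]_x (cst 1%:E x))%E).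
  apply: ge0_le_integral => //=.
    by apply/measurable_EFinP; exact: measurableT_comp.
  by move=> x _; rewrite lee_fin.
by rewrite integral_cst// mul1e; exact: probability_le1.
Qed.

(** |g - m| <= 2 makes the exponent at most 1/2 in modulus; in the quadratic bound the linear term
    integrates to 0 and 2 (s (g - m))^2 <= 8 s^2. *)
Lemma exp_moment_le (s : R) : `|s| <= 4^-1 ->
  (\int[mu]_x (expR (s * (g x - m)))%:E <= (expR (8 * s ^+ 2))%:E)%E.
Proof.
move=> s4.
have gm x : `|g x - m| <= 2.
  by apply: (le_trans (ler_normB _ _)); exact: (lerD (g1 x) m1).
have mgm : measurable_fun setT (fun x => s * (g x - m)).
  by apply: measurable_funM => //; exact: measurable_funB.
apply: (@le_trans _ _ (\int[mu]_x ((1 + 8 * s ^+ 2 - s * m) + s * g x)%:E)%E).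
  apply: ge0_le_integral => //=.
  - by apply/measurable_EFinP; exact: measurableT_comp.
  - by apply/measurable_EFinP/measurable_funD => //; exact: measurable_funM.
  move=> x _; rewrite lee_fin (le_trans (expR_le_quadratic _))//.
    by rewrite normrM (le_trans (ler_pM _ _ s4 (gm x)))//; lra.
  rewrite exprMn.
  have : (g x - m) ^+ 2 <= 4.
    by rewrite -real_normK ?num_real// (_ : 4 = 2 ^+ 2) ?lerXn2r ?nnegrE//; ring.
  by have := sqr_ge0 s; nra.
under eq_integral do rewrite EFinD EFinM.
have intg : mu.-integrable setT (EFin \o g) by exact: bounded_integrable g1.
rewrite integralD//=; last 2 first.
- exact: finite_measure_integrable_cst.
- exact: integrableZl.
rewrite integralZl// integral_cst// [X in (_ * X + _)%E](_ : _ = 1%E); last exact: probability_setT.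
rewrite mule1.
rewrite (EFin_bounded_integral mu mg g1) -/m -EFinM -EFinD lee_fin subrK.
exact: expR_ge1Dx.
Qed.

Lemma integral_RV j (h : T -> R) : measurable_fun setT h -> (forall x, 0 <= h x) ->
  (\int[P]_w (h (Z j w))%:E = \int[mu]_x (h x)%:E)%E.
Proof.
move=> mh h0; rewrite -(@eq_measure_integral _ _ _ _ _ (distribution P (Z j))).
  by rewrite ge0_integral_distribution//; exact/measurable_EFinP.
by move=> A mA _; case: Z_iid => _; apply.
Qed.

(** Chernoff's method. q depends on A and e but on neither n nor the individual weights, so these
    may change with n as in a triangular array. *)
Lemma Hoeffding_tail (A e : R) : 0 < A -> 0 < e -> exists q : R, [/\ 0 < q, q < 1 &
  forall (a : nat -> R) n, (forall j, `|a j| <= A) ->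
    (P [set w | (e * n%:R <= \sum_(j < n) a j * (g (Z j w) - m))%R] <= (q ^+ n)%:E)%E].
Proof.
move=> A0 e0.
(* t A <= 1/4 is the range of [exp_moment_le]; the other bound makes 8 t^2 A^2 at most t e / 2, half
   of the gain t e in Markov's inequality. *)
pose t := Num.min (4 * A)^-1 (e / (16 * A ^+ 2)).
have A20 : 0 < 16 * A ^+ 2 by rewrite mulr_gt0// exprn_gt0.
have t0 : 0 < t by rewrite lt_min invr_gt0 mulr_gt0//= divr_gt0.
have t1 : t * A <= 4^-1.
  have : t <= (4 * A)^-1 by rewrite ge_min lexx.
  move=> h; rewrite (le_trans (ler_wpM2r (ltW A0) h))//.
  by rewrite invfM divfK// gt_eqF.
have t2 : 8 * t ^+ 2 * A ^+ 2 <= t * e / 2.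
  have : t <= e / (16 * A ^+ 2) by rewrite ge_min lexx orbT.
  by rewrite ler_pdivlMr// => h; have := ler_wpM2l (ltW t0) h; nra.
exists (expR (- (t * e / 2))); split; first exact: expR_gt0.
  by rewrite expR_lt1 oppr_lt0 divr_gt0// mulr_gt0.
move=> a n aA.
pose f j x := expR (t * a j * (g x - m)).
have mf j : measurable_fun setT (f j).
  apply: measurableT_comp => //; apply: measurable_funM => //; exact: measurable_funB.
have f0 j x : 0 <= f j x by exact: expR_ge0.
have sA j : `|t * a j| <= t * A by rewrite normrM gtr0_norm// ler_pM2l.
have fle j : (\int[P]_w (f j (Z j w))%:E <= (expR (8 * (t * a j) ^+ 2))%:E)%E.
  by rewrite integral_RV//; apply: exp_moment_le; rewrite (le_trans (sA j)).
pose e' j := fine (\int[P]_w (f j (Z j w))%:E).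
have fe j : (\int[P]_w (f j (Z j w))%:E = (e' j)%:E)%E.
  rewrite fineK// ge0_fin_numE ?(le_lt_trans (fle j)) ?ltry//.
  by apply: integral_ge0 => w _; rewrite lee_fin.
have pE := @integral_indep_prod _ _ _ _ _ P Z (proj1 Z_iid) f e' mf f0 fe n.
pose S w := \sum_(j < n) a j * (g (Z j w) - m).
have SE w : \prod_(j < n) f j (Z j w) = expR (t * S w).
  by rewrite -expR_sum mulr_sumr; congr expR; apply: eq_bigr => j _; rewrite mulrA.
have mS : measurable_fun setT S.
  apply: measurable_sum => j; apply: measurable_funM => //.
  by apply: measurable_funB => //; exact: measurableT_comp.
set D := [set w | _].
have mD : measurable D.
  rewrite (_ : D = setT `&` S @^-1` `[e * n%:R, +oo[%classic); first exact: mS.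
  by rewrite setTI; apply/seteqP; split => w /=; rewrite in_itv/= andbT.
have : ((expR (t * (e * n%:R)))%:E * P D <= (\prod_(j < n) e' j)%:E)%E.
  rewrite -pE -integral_cst//.
  apply: (@le_trans _ _ (\int[P]_(w in D) (\prod_(j < n) f j (Z j w))%:E)%E).
    apply: ge0_le_integral => //=.
    - apply/measurable_EFinP/measurable_funTS; apply: measurable_prod => j _.
      exact: measurableT_comp.
    - move=> w Dw; rewrite lee_fin SE ler_expR ler_pM2l//.
  apply: ge0_subset_integral => //.
    apply/measurable_EFinP; apply: measurable_prod => j _.
    exact: measurableT_comp.
  by move=> w _; rewrite lee_fin prodr_ge0.
have e'le : \prod_(j < n) e' j <= expR (t * e / 2) ^+ n.
  rewrite -[n in X in _ <= X]card_ord -prodr_const; apply: ler_prod => j _.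
  rewrite -lee_fin -fe fine_ge0 ?integral_ge0//=; last by move=> w _; rewrite lee_fin.
  rewrite (le_trans (fle j))// lee_fin ler_expR (le_trans _ t2)//.
  rewrite (_ : 8 * t ^+ 2 * A ^+ 2 = 8 * (t * A) ^+ 2); last by ring.
  rewrite ler_pM2l// -[leLHS]real_normK ?num_real//.
  by rewrite lerXn2r ?nnegrE// ?mulr_ge0// ltW.
have PDf : P D \is a fin_num by exact: fin_num_measure.
rewrite -(fineK PDf) -EFinM !lee_fin => /le_trans /(_ e'le).
rewrite mulrC -ler_pdivlMr ?expR_gt0// => /le_trans; apply.
by rewrite -expRM_natl -expRN -expRD -expRM_natl ler_expR; lra.
Qed.
End Hoeffding.

(** * Almost sure convergence of weighted means *)

Section StrongLaw.
Context d (Omega : measurableType d) (R : realType) (P : probability Omega R).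

Lemma ae_eventually_notin (D : nat -> set Omega) (q : R) : 0 < q -> q < 1 ->
  (forall n, measurable (D n)) -> (forall n, (P (D n) <= (q ^+ n)%:E)%E) ->
  {ae P, forall w, \forall n \near \oo, ~ D n w}.
Proof.
move=> q0 q1 mD PD.
have fin : (\sum_(n <oo) P (D n) < +oo)%E.
  apply: (@le_lt_trans _ _ ((1 - q)^-1)%:E); last exact: ltry.
  apply: lime_le; first exact: is_cvg_nneseries.
  near=> n; rewrite (@le_trans _ _ (\sum_(0 <= i < n) (q ^+ i)%:E)%E)//.
    by apply: lee_sum.
  rewrite sumEFin lee_fin -[leRHS]mul1r.
  have := @geometric_le_lim _ n 1 q ler01 q0; rewrite ger0_norm ?(ltW q0)// => /(_ q1).
  by apply: le_trans; rewrite /series/=; under [leRHS]eq_bigr do rewrite mul1r.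
have /negligibleP : P (lim_sup_set D) = 0%E by exact: lim_sup_set_cvg0.
have mL : measurable (lim_sup_set D).
  by apply: bigcap_measurable => // n _; apply: bigcup_measurable.
move=> /(_ mL); apply: negligibleS => w /= nw n _.
apply: contrapT => h; apply: nw; exists n => // k /= nk Dk; apply: h.
by exists k.
Unshelve. all: by end_near. Qed.

Context d' (T : measurableType d') (mu : probability T R) (Z : nat -> {RV P >-> T}).
Hypothesis Z_iid : iid Z mu.

(** Only upper tails are estimated, so the weights [a] and [- a] are both used; the thresholds
    1/(k+1) keep the exceptional sets countable in number. *)
Lemma iid_weighted_mean (g : T -> R) (a : nat -> nat -> R) (A : R) :
  measurable_fun setT g -> (forall x, `|g x| <= 1) ->
  (forall n j, `|a n j| <= A) ->
  {ae P, forall w,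
    (fun n => n%:R^-1 * \sum_(j < n) a n j * (g (Z j w) - \int[mu]_x g x)) @ \oo --> (0 : R)}.
Proof.
move=> mg g1; wlog A0 : A / 0 < A => [H aA|aA].
  apply: (H (`|A| + 1)) => [|n j]; first by rewrite ltr_wpDl.
  by rewrite (le_trans (aA n j))// (le_trans (ler_norm _))// lerDl.
set m := \int[mu]_x g x.
pose S (b : nat -> nat -> R) n w := \sum_(j < n) b n j * (g (Z j w) - m).
have mS b n : measurable_fun setT (S b n).
  apply: measurable_sum => j; apply: measurable_funM => //.
  by apply: measurable_funB => //; exact: measurableT_comp.
have key b : (forall n j, `|b n j| <= A) ->
    {ae P, forall w, forall k, \forall n \near \oo, S b n w < k.+1%:R^-1 * n%:R}.
  move=> bA; apply: ae_foralln => k.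
  have k0 : 0 < k.+1%:R^-1 :> R by rewrite invr_gt0.
  have [q [q0 q1 H]] := Hoeffding_tail Z_iid mg g1 A0 k0.
  have := @ae_eventually_notin (fun n => [set w | k.+1%:R^-1 * n%:R <= S b n w]) q q0 q1.
  have mD n : measurable [set w | k.+1%:R^-1 * n%:R <= S b n w].
    rewrite (_ : mkset _ = setT `&` S b n @^-1` `[k.+1%:R^-1 * n%:R, +oo[%classic).
      exact: mS.
    by rewrite setTI; apply/seteqP; split => w /=; rewrite in_itv/= andbT.
  move=> /(_ mD (fun n => H (b n) n (bA n))); apply: filterS => w; apply: filterS => n /negP.
  by rewrite -ltNge.
have Na n j : `|- a n j| <= A by rewrite normrN.
apply: filterS2 (key _ aA) (key (fun n j => - a n j) Na) => w h1 h2.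
apply/cvgr0Pnorm_lt => e e0.
have [k ke] : exists k : nat, k.+1%:R^-1 < e.
  exists (Num.truncn e^-1); rewrite -[ltRHS]invrK ltf_pV2 ?posrE ?invr_gt0//.
  exact: truncnS_gt.
near=> n.
have n0 : 0 < n%:R :> R by rewrite ltr0n; near: n; exists 1%N.
rewrite normrM ger0_norm ?invr_ge0 ?(ltW n0)// ltr_pdivrMl//.
apply: (@lt_le_trans _ _ (k.+1%:R^-1 * n%:R)); last first.
  by rewrite mulrC ler_pM2l// ltW.
have s1 : S a n w < k.+1%:R^-1 * n%:R by near: n; exact: h1.
have s2 : S (fun n j => - a n j) n w < k.+1%:R^-1 * n%:R by near: n; exact: h2.
rewrite ltr_norml -ltrNl; apply/andP; split => //.
by move: s2; rewrite /S; under eq_bigr do rewrite mulNr; rewrite sumrN.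
Unshelve. all: by end_near. Qed.
End StrongLaw.

(** * Moments of measures on the circle *)

Section CircleMoments.
Variable R : realType.
Local Open Scope complex_scope.

Lemma measurable_openC (A : set R[i]) : open A -> measurable A.
Proof. by move=> oA; exact: sub_sigma_algebra. Qed.

Lemma continuous_measurableC (f : R[i] -> R) : continuous f -> measurable_fun setT f.
Proof.
move=> /continuousP cf; apply: (measurability _ (RGenOInfty.measurableE R)) => //.
move=> _ [_ [x ->] <-]; rewrite setTI; apply: measurable_openC.
by apply: cf; rewrite set_itvE; exact: open_gt.
Qed.

Definition disc : set R[i] := [set z | normc z <= 1].

Lemma measurable_disc : measurable disc.
Proof.
rewrite (_ : disc = setT `&` @Normc.normc R @^-1` `]-oo, 1]%classic).
  exact: (continuous_measurableC (@continuous_normc R)).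
by rewrite setTI; apply/seteqP; split => z /=; rewrite in_itv.
Qed.

Lemma unit_circleE : @unit_circle R = [set z | normc z = 1].
Proof.
apply/seteqP; split => z /=; rewrite /unit_circle/= normrE_normc; first by case.
by move=> ->.
Qed.

Lemma measurable_unit_circle : measurable (@unit_circle R).
Proof.
rewrite unit_circleE (_ : mkset _ = setT `&` @Normc.normc R @^-1` [set 1]).
  by apply: (continuous_measurableC (@continuous_normc R)).
by rewrite setTI.
Qed.

(* The powers are cut off outside the closed unit disk to make them bounded. *)
Definition rePow k (z : R[i]) : R := complex.Re (z ^+ k) * \1_disc z.
Definition imPow k (z : R[i]) : R := complex.Im (z ^+ k) * \1_disc z.

Lemma continuous_exprC k : continuous (fun z : R[i] => z ^+ k).
Proof.
rewrite (_ : (fun z => _) = (fun z : R[i] => 'X^k.[z])).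
  exact: continuous_hornerC.
by apply/funext => z; rewrite hornerXn.
Qed.

Lemma measurable_rePow k : measurable_fun setT (rePow k).
Proof.
apply: measurable_funM; last by apply: measurable_indic; exact: measurable_disc.
apply: continuous_measurableC => z.
exact: (continuous_comp (@continuous_exprC k z) (@continuous_Re R _)).
Qed.

Lemma measurable_imPow k : measurable_fun setT (imPow k).
Proof.
apply: measurable_funM; last by apply: measurable_indic; exact: measurable_disc.
apply: continuous_measurableC => z.
exact: (continuous_comp (@continuous_exprC k z) (@continuous_Im R _)).
Qed.

Lemma rePow_le1 k z : `|rePow k z| <= 1.
Proof.
rewrite /rePow indicE; case: (boolP (z \in disc)) => [|_]; last by rewrite mulr0 normr0.
rewrite inE /disc/= mulr1 => z1.
by rewrite (le_trans (normc_ge_absRe _))// normcX exprn_ile1 ?normc_ge0.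
Qed.

Lemma imPow_le1 k z : `|imPow k z| <= 1.
Proof.
rewrite /imPow indicE; case: (boolP (z \in disc)) => [|_]; last by rewrite mulr0 normr0.
rewrite inE /disc/= mulr1 => z1.
by rewrite (le_trans (normc_ge_absIm _))// normcX exprn_ile1 ?normc_ge0.
Qed.

Lemma indic_disc_circle (z : R[i]) : normc z = 1 -> \1_disc z = 1 :> R.
Proof. by move=> z1; rewrite indicE mem_set// /disc/= z1. Qed.

Lemma rePow_circle k z : normc z = 1 -> rePow k z = complex.Re (z ^+ k).
Proof. by move=> z1; rewrite /rePow indic_disc_circle// mulr1. Qed.

Lemma imPow_circle k z : normc z = 1 -> imPow k z = complex.Im (z ^+ k).
Proof. by move=> z1; rewrite /imPow indic_disc_circle// mulr1. Qed.

(** For mu carried by the circle this is the integral of z^k, the cut-off being 1 there. *)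
Definition moment (mu : probability R[i] R) k : R[i] :=
  (\int[mu]_z rePow k z) +i* (\int[mu]_z imPow k z).

Lemma Re_mulE (x y : R[i]) : complex.Re (x * y) =
  complex.Re x * complex.Re y - complex.Im x * complex.Im y.
Proof. by case: x y => ? ? []. Qed.

Lemma measurable_trig (c : nat -> R[i]) k :
  measurable_fun setT (fun z => complex.Re (c k) * rePow k z - complex.Im (c k) * imPow k z).
Proof.
apply: measurable_funB; apply: measurable_funM => //.
  exact: measurable_rePow.
exact: measurable_imPow.
Qed.

Lemma trig_bounded (c : nat -> R[i]) k z :
  `|complex.Re (c k) * rePow k z - complex.Im (c k) * imPow k z| <=
  `|complex.Re (c k)| + `|complex.Im (c k)|.
Proof.
rewrite (le_trans (ler_normB _ _))// lerD// normrM ler_piMr//.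
  exact: rePow_le1.
exact: imPow_le1.
Qed.

Lemma trig_sum_bounded (c : nat -> R[i]) n z :
  `|\sum_(k < n) (complex.Re (c k) * rePow k z - complex.Im (c k) * imPow k z)| <=
  \sum_(k < n) (`|complex.Re (c k)| + `|complex.Im (c k)|).
Proof.
rewrite (le_trans (ler_norm_sum _ _ _))//; apply: ler_sum => k _.
exact: trig_bounded.
Qed.

Lemma Rintegral_trig (mu : probability R[i] R) (c : nat -> R[i]) n :
  complex.Re (\sum_(k < n) c k * moment mu k) =
  \int[mu]_z (\sum_(k < n) (complex.Re (c k) * rePow k z - complex.Im (c k) * imPow k z)).
Proof.
rewrite Re_sum; elim: n => [|n IH].
  rewrite big_ord0 (_ : (fun z => _) = cst 0).
    by rewrite Rintegral_cst// mul0r.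
  by apply/funext => z; rewrite big_ord0.
rewrite big_ord_recr/= IH; under [in RHS]eq_Rintegral do rewrite big_ord_recr/=.
rewrite RintegralD//; last 2 first.
- apply: (bounded_integrable mu _ (@trig_sum_bounded c n)).
  by apply: measurable_sum => k; exact: measurable_trig.
- exact: (bounded_integrable mu (@measurable_trig c n) (@trig_bounded c n)).
have intr : mu.-integrable setT (EFin \o rePow n).
  exact: bounded_integrable (measurable_rePow n) (rePow_le1 n).
have inti : mu.-integrable setT (EFin \o imPow n).
  exact: bounded_integrable (measurable_imPow n) (imPow_le1 n).
have intZ (a : R) (h : R[i] -> R) : measurable_fun setT h -> (forall z, `|h z| <= 1) ->
    mu.-integrable setT (EFin \o (fun z => a * h z)).
  move=> mh h1; apply: (@bounded_integrable _ _ _ mu _ `|a|).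
    exact: measurable_funM.
  by move=> z; rewrite normrM ler_piMr.
congr (_ + _); rewrite Re_mulE /= RintegralB//; last 2 first.
- exact: intZ (measurable_rePow n) (rePow_le1 n).
- exact: intZ (measurable_imPow n) (imPow_le1 n).
by rewrite !RintegralZl.
Qed.

(** Supplies the hypothesis on [L] in [zeros_mean_cvg]. The approximation is assumed on the circle
    only, so the integrands are compared almost everywhere. *)
Lemma Rintegral_trig_approx (mu : probability R[i] R) (f : R[i] -> R) (B : R)
    (p : {poly R[i]}) (e : R) : mu (@unit_circle R) = 1%E ->
  measurable_fun setT f -> (forall z, `|f z| <= B) ->
  (forall z, normc z = 1 -> `|f z - complex.Re p.[z]| <= e) ->
  `|\int[mu]_z f z - complex.Re (\sum_(k < size p) p`_k * moment mu k)| <= e.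
Proof.
move=> mu1 mf fB fp.
have e0 : 0 <= e by apply: le_trans (fp 1 _); rewrite ?Normc.normc1.
rewrite Rintegral_trig.
pose h z := \sum_(k < size p) (complex.Re p`_k * rePow k z - complex.Im p`_k * imPow k z).
have mh : measurable_fun setT h.
  by apply: measurable_sum => k; exact: (measurable_trig (fun k => p`_k)).
have hB z : `|h z| <= \sum_(k < size p) (`|complex.Re p`_k| + `|complex.Im p`_k|).
  exact: trig_sum_bounded.
have hE z : normc z = 1 -> h z = complex.Re p.[z].
  move=> z1; rewrite horner_coef Re_sum; apply: eq_bigr => k _.
  by rewrite Re_mulE rePow_circle// imPow_circle.
have intf : mu.-integrable setT (EFin \o f) by exact: bounded_integrable fB.
have inth : mu.-integrable setT (EFin \o h) by exact: bounded_integrable hB.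
rewrite -/h -RintegralB//.
have dB z : `|f z - h z| <= B + \sum_(k < size p) (`|complex.Re p`_k| + `|complex.Im p`_k|).
  by rewrite (le_trans (ler_normB _ _))// lerD.
have md : measurable_fun setT (fun z => f z - h z) by exact: measurable_funB.
have intd := bounded_integrable mu md dB.
rewrite (le_trans (le_normr_Rintegral _ _))// -lee_fin.
have mdn : measurable_fun setT (fun z => `|f z - h z|) by exact: measurableT_comp.
have dnB z : `|(`|f z - h z|)| <= B + \sum_(k < size p) (`|complex.Re p`_k| + `|complex.Im p`_k|).
  by rewrite normr_id.
rewrite -(EFin_bounded_integral mu mdn dnB).
apply: (@le_trans _ _ (\int[mu]_z (cst e%:E z))%E); last first.
  by rewrite integral_cst// -[leRHS]mule1 lee_wpmul2l ?lee_fin// probability_le1.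
apply: ae_ge0_le_integral => //.
- by apply/measurable_EFinP/measurableT_comp => //; exact: measurable_funB.
have : mu.-negligible (~` @unit_circle R).
  apply/negligibleP; first by apply: measurableC; exact: measurable_unit_circle.
  transitivity (1 - mu (@unit_circle R))%E; last by rewrite mu1 subee.
  exact: probability_setC measurable_unit_circle.
move=> neg; apply: (negligibleS _ neg) => z /= /not_implyP[_ nz] zc; apply: nz.
by rewrite unit_circleE/= in zc; rewrite lee_fin hE// fp.
Qed.
End CircleMoments.

Section RandomZeros.
Context d (Omega : measurableType d) (R : realType).
Variables (P : probability Omega R) (mu : probability R[i] R).
Variable Z : nat -> {RV P >-> R[i]}.
Hypothesis mu_circle : mu (@unit_circle R) = 1%E.
Hypothesis Z_iid : iid Z mu.
Local Open Scope complex_scope.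

Lemma cvgC_ReIm (T : Type) (F : set_system T) {FF : Filter F} (f : T -> R[i]) (l : R[i]) :
  (fun t => complex.Re (f t)) @ F --> complex.Re l ->
  (fun t => complex.Im (f t)) @ F --> complex.Im l -> f @ F --> l.
Proof.
move=> /cvgrPdist_lt hr /cvgrPdist_lt hi; apply/cvgC_normcP => e e0.
have e20 : 0 < e / 2 by rewrite divr_gt0.
apply: filterS2 (hr _ e20) (hi _ e20) => t h1 h2.
rewrite (le_lt_trans (normc_le_ReIm _))// [ltRHS]splitr.
have -> : complex.Re (l - f t) = complex.Re l - complex.Re (f t).
  by case: (l) (f t) => ? ? [].
have -> : complex.Im (l - f t) = complex.Im l - complex.Im (f t).
  by case: (l) (f t) => ? ? [].
by rewrite ltrD.
Qed.

Lemma ae_circle : {ae P, forall w, forall j, normc (Z j w) = 1}.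
Proof.
apply: ae_foralln => j.
have mC : measurable (Z j @^-1` (@unit_circle R)).
  by rewrite -[X in measurable X]setTI; apply: measurable_funP => //; exact: measurable_unit_circle.
have PC : P (Z j @^-1` (@unit_circle R)) = 1%E.
  have := (proj2 Z_iid) j _ (@measurable_unit_circle R).
  by rewrite mu_circle.
have : P.-negligible (~` (Z j @^-1` (@unit_circle R))).
  apply/negligibleP; first exact: measurableC.
  transitivity (1 - P (Z j @^-1` (@unit_circle R)))%E; last by rewrite PC subee.
  exact: probability_setC.
by move=> neg; apply: (negligibleS _ neg) => w /= h /=; rewrite unit_circleE.
Qed.

(** Real and imaginary parts are treated separately by [iid_weighted_mean]; centring at the moment
    makes the limit 0 for every bounded array of weights. *)
Lemma iid_moment (a : nat -> nat -> R) (A : R) : (forall n j, `|a n j| <= A) ->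
  {ae P, forall w, forall k,
    (fun n => n%:R^-1 * \sum_(j < n) (a n j)%:C * (Z j w ^+ k - moment mu k)) @ \oo -->
      (0 : R[i])}.
Proof.
move=> aA.
have hr : {ae P, forall w, forall k, (fun n => n%:R^-1 * \sum_(j < n)
    a n j * (rePow k (Z j w) - \int[mu]_x rePow k x)) @ \oo --> (0 : R)}.
  apply: ae_foralln => k.
  exact: (iid_weighted_mean Z_iid (@measurable_rePow R k) (@rePow_le1 R k) aA).
have hi : {ae P, forall w, forall k, (fun n => n%:R^-1 * \sum_(j < n)
    a n j * (imPow k (Z j w) - \int[mu]_x imPow k x)) @ \oo --> (0 : R)}.
  apply: ae_foralln => k.
  exact: (iid_weighted_mean Z_iid (@measurable_imPow R k) (@imPow_le1 R k) aA).
apply: filterS3 ae_circle hr hi => w Z1 wr wi k.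
have nE n : (n%:R^-1 : R[i]) = (n%:R^-1)%:C by rewrite fmorphV rmorph_nat.
apply: cvgC_ReIm => /=.
  rewrite [X in X @ _](_ : _ = (fun n => n%:R^-1 * \sum_(j < n)
    a n j * (rePow k (Z j w) - \int[mu]_x rePow k x))); first exact: wr.
  apply/funext => n.
  rewrite nE Re_realM Re_sum; congr (_ * _); apply: eq_bigr => j _.
  rewrite Re_realM rePow_circle//; congr (_ * _).
  by case: (Z j w ^+ k).
rewrite [X in X @ _](_ : _ = (fun n => n%:R^-1 * \sum_(j < n)
  a n j * (imPow k (Z j w) - \int[mu]_x imPow k x))); first exact: wi.
apply/funext => n.
have Im_realM (c : R) (x : R[i]) : complex.Im (c%:C * x) = c * complex.Im x.
  by case: x => ? ? /=; rewrite mul0r addr0.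
rewrite nE Im_realM Im_sum; congr (_ * _); apply: eq_bigr => j _.
rewrite Im_realM imPow_circle//; congr (_ * _).
by case: (Z j w ^+ k).
Qed.

Lemma iid_moment_mean : {ae P, forall w, forall k,
  (fun n => n%:R^-1 * \sum_(j < n) Z j w ^+ k) @ \oo --> moment mu k}.
Proof.
have a1 (n j : nat) : `|1 : R| <= 1 by rewrite normr1.
have := iid_moment a1; apply: filterS => w h k.
have := h k => {h} /cvgC_normcP h; apply/cvgC_normcP => e e0.
near=> n.
have n0 : (n%:R : R[i]) != 0 by rewrite pnatr_eq0 -lt0n; near: n; exists 1%N.
have : normc (0 - n%:R^-1 * \sum_(j < n) 1%:C * (Z j w ^+ k - moment mu k)) < e.
  by near: n; exact: h.
under eq_bigr do rewrite mul1r.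
rewrite sumrB sumr_const card_ord -[moment mu k *+ n]mulr_natl mulrBr mulKf//.
by rewrite sub0r opprB.
Unshelve. all: by end_near. Qed.

Lemma integral_mu_ (lam : forall n, 'I_n -> Omega -> R[i]) w n (f : R[i] -> R) :
  measurable_fun setT f ->
  (\int[mu_ (fun j => Z j) lam w n]_z (f z)%:E =
   (n.-1%:R^-1 * \sum_(j < n.-1) f (W_ (fun j => Z j) lam n w j))%:E)%E.
Proof.
have ge0 (g : R[i] -> R) : measurable_fun setT g -> (forall z, 0 <= g z) ->
    (\int[mu_ (fun j => Z j) lam w n]_z (g z)%:E =
     (n.-1%:R^-1 * \sum_(j < n.-1) g (W_ (fun j => Z j) lam n w j))%:E)%E.
  move=> mg g0; have mEg : measurable_fun setT (EFin \o g) by exact/measurable_EFinP.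
  transitivity ((n.-1%:R^-1)%:E * \int[msum
      (fun j => \d_(W_ (fun j => Z j) lam n w j)) n.-1]_z (g z)%:E)%E.
    by rewrite ge0_integral_mscale//= => z _; rewrite lee_fin.
  rewrite ge0_integral_measure_sum//; last by move=> z _; rewrite lee_fin.
  rewrite EFinM -sumEFin; congr (_ * _)%E; apply: eq_bigr => j _.
  by rewrite integral_dirac// diracT mul1e.
move=> mf; rewrite integralE.
have E1 z : ((fun z => (f z)%:E)^\+ z = (Num.max (f z) 0)%:E)%E.
  by rewrite funeposE EFin_max.
have E2 z : ((fun z => (f z)%:E)^\- z = (Num.max (- f z) 0)%:E)%E.
  by rewrite funenegE EFin_max.
under eq_integral do rewrite E1.
under [X in (_ - X)%E]eq_integral do rewrite E2.
have m1 : measurable_fun setT (fun z => Num.max (f z) 0) by exact: measurable_maxr.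
have m2 : measurable_fun setT (fun z => Num.max (- f z) 0).
  by apply: measurable_maxr => //; exact: measurableT_comp.
rewrite !ge0//; try by move=> z; rewrite le_max lexx orbT.
rewrite -EFinB -mulrBr -sumrB; congr (_ * _)%:E; apply: eq_bigr => j _.
set y := f _; have [y0|y0] := leP 0 y.
  by rewrite max_r ?oppr_le0// subr0.
by rewrite max_l ?oppr_ge0 ?(ltW y0)// sub0r opprK.
Qed.
End RandomZeros.

(** * From pathwise limits to almost sure weak convergence *)

Section WeakConvergence.
Context d (Omega : measurableType d) (R : realType).
Variables (P : probability Omega R) (mu : probability R[i] R).
Variable Z : nat -> {RV P >-> R[i]}.
Hypothesis mu_circle : mu (@unit_circle R) = 1%E.
Hypothesis Z_iid : iid Z mu.
Local Open Scope complex_scope.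

Lemma sum_norm_leE n (l : 'I_n -> R[i]) (K : R) : (0 < n)%N ->
  (n%:R^-1 * \sum_(j < n) `|l j| <= K%:C) = (\sum_(j < n) normc (l j) <= K * n%:R).
Proof.
move=> n0; have -> : n%:R^-1 * \sum_(j < n) `|l j| = (n%:R^-1 * \sum_(j < n) normc (l j))%:C.
  by rewrite rmorphM fmorphV rmorph_nat rmorph_sum; congr (_ * _).
by rewrite lecR ler_pdivrMl ?ltr0n// mulrC.
Qed.

Lemma norm_sum_geE n (l : 'I_n -> R[i]) (delta : R) : (0 < n)%N ->
  (delta%:C <= n%:R^-1 * `|\sum_(j < n) l j|) = (delta * n%:R <= normc (\sum_(j < n) l j)).
Proof.
move=> n0; have -> : n%:R^-1 * `|\sum_(j < n) l j| = (n%:R^-1 * normc (\sum_(j < n) l j))%:C.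
  by rewrite rmorphM fmorphV rmorph_nat normrE_normc.
by rewrite lecR ler_pdivlMl ?ltr0n// mulrC.
Qed.

(** The conditions are countably many, so they hold together on one event of full measure, fixed
    before the test function is chosen; the rest is pathwise. *)
Lemma weak_cvg_of_hypotheses (lam : forall n, 'I_n -> Omega -> R[i]) :
  hypotheses P (fun j => Z j) lam -> as_weak_cvg P (fun j => Z j) lam mu.
Proof.
move=> [lam0 [M M0 WM] [K [delta [b [K0 delta0 exb [cb lK ld]]]]]].
have cb' : {ae P, forall w, forall m,
    (n%:R^-1 * \sum_(j < n) (lam n j w)^*%R * Z j w ^+ m.+1) @[n --> \oo] --> b m}.
  by apply: ae_foralln => m; exact: cb.
have Z1 := ae_circle mu_circle Z_iid.
have zm := iid_moment_mean mu_circle Z_iid.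
apply: filterS (filterI Z1 (filterI zm (filterI cb' (filterI lam0
  (filterI WM (filterI lK ld)))))) => w [z1 [zmw [cbw [l0 [WMw [lKw ldw]]]]]].
move=> f cf [B fB].
have mf := continuous_measurableC cf.
under eq_fun do rewrite integral_mu_//.
rewrite (EFin_bounded_integral mu mf fB).
apply: cvg_EFin; first by near=> n.
pose lw n (j : 'I_n) := lam n j w.
have sz n : (2 <= n)%N -> size (zeros (gen_deriv (fun j : 'I_n => Z j w) (lw n))) = n.-1.
  by move=> n2; have [] := gen_deriv_zeros (fun j : 'I_n => Z j w) (l0 _ n2).
have -> : fine \o (fun n => (n.-1%:R^-1 * \sum_(j < n.-1) f (W_ (fun j => Z j) lam n w j))%:E) =
   (fun n => n.-1%:R^-1 * \sum_(j < n.-1) f (W_ (fun j => Z j) lam n w j)) by [].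
have lK' n : (2 <= n)%N -> \sum_(j < n) normc (lw n j) <= K * n%:R.
  by move=> n2; rewrite -sum_norm_leE ?(ltnW n2)//; exact: lKw.
have ld' n : (2 <= n)%N -> delta * n%:R <= normc (\sum_(j < n) lw n j).
  by move=> n2; rewrite -norm_sum_geE ?(ltnW n2)//; exact: ldw.
have WM' n : (2 <= n)%N -> {in zeros (gen_deriv (fun j : 'I_n => Z j w) (lw n)),
    forall W, normc W <= M}.
  move=> n2 V /(nthP 0)[j jn <-]; rewrite sz// in jn.
  by have := WMw n n2 j jn; rewrite normrE_normc lecR.
have HL (p : {poly R[i]}) (e : R) : (forall x, normc x = 1 -> `|f x - complex.Re p.[x]| <= e) ->
    `|\int[mu]_x f x - complex.Re (\sum_(k < size p) p`_k * moment mu k)| <= e.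
  exact: Rintegral_trig_approx mu_circle mf fB.
have := zeros_mean_cvg z1 exb K0 delta0 cbw lK' ld' zmw cf fB WM' HL.
apply: cvg_trans; apply: near_eq_cvg; exists 2%N => // n /= n2.
by rewrite (big_nth 0) big_mkord sz.
Unshelve. all: by end_near. Qed.

(** At a root W with |W| > 1, W / (W - z) = 1 + z / (W - z) gives sum_j l_j = - sum_j l_j z_j / (W -
    z_j), whose modulus is at most K n / (|W| - 1). *)
Lemma zeros_le n (z l : 'I_n -> R[i]) (K delta : R) (W : R[i]) : (0 < n)%N ->
  (forall j, normc (z j) = 1) -> 0 < delta ->
  \sum_(j < n) normc (l j) <= K * n%:R -> delta * n%:R <= normc (\sum_(j < n) l j) ->
  root (gen_deriv z l) W -> normc W <= 1 + K / delta.
Proof.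
move=> n0 z1 delta0 lK ld rW; rewrite leNgt; apply/negP => Wgt.
have n0' : 0 < n%:R :> R by rewrite ltr0n.
have K0 : 0 <= K.
  by rewrite -(pmulr_lge0 _ n0') (le_trans _ lK)// sumr_ge0// => j _; exact: normc_ge0.
have W1 : 1 < normc W by rewrite (le_lt_trans _ Wgt)// lerDl divr_ge0// ltW.
have Wz j : W != z j by apply/eqP => e; move: W1; rewrite e z1 ltxx.
have PW : (root_poly z).[W] != 0.
  rewrite /root_poly horner_prod; apply/prodf_neq0 => j _.
  by rewrite hornerXsubC subr_eq0.
have : \sum_(j < n) l j / (W - z j) = 0.
  move: rW; rewrite /root horner_gen_deriv// mulf_eq0 (negPf PW)/= => /eqP; exact.
move=> /(congr1 (fun x => W * x)); rewrite mulr0 mulr_sumr.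
rewrite (eq_bigr (fun j => l j + l j * z j / (W - z j))); last first.
  move=> j _; have Wzj : W - z j != 0 by rewrite subr_eq0.
  by field.
rewrite big_split/= => /eqP; rewrite addr_eq0 => /eqP lE.
have : delta * n%:R <= K * n%:R / (normc W - 1).
  rewrite (le_trans ld)// lE normcN (le_trans (normc_sum_le _ _ _))//.
  have W10 : 0 < normc W - 1 by rewrite subr_gt0.
  rewrite (@le_trans _ _ (\sum_(j < n) normc (l j) / (normc W - 1)))//.
    apply: ler_sum => j _; rewrite !normcM normcV z1 mulr1 ler_wpM2l ?normc_ge0//.
    have := normcB_ge W (z j); rewrite z1 => h.
    by rewrite lef_pV2 ?posrE// (lt_le_trans W10).
  by rewrite -mulr_suml ler_pM2r ?invr_gt0.
rewrite mulrAC ler_pM2r// ler_pdivlMr ?subr_gt0//.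
move: Wgt; rewrite -ltrBrDl ltr_pdivrMr// mulrC => h /le_lt_trans /(_ h).
by rewrite ltxx.
Qed.

(* The bound on the zeros required by [hypotheses] follows from (ii) and (iii). *)
Lemma hypotheses_of_moments (lam : forall n, 'I_n -> Omega -> R[i]) (K delta : R)
    (b : nat -> R[i]) : 0 < K -> 0 < delta -> (exists m, b m != 0) ->
  {ae P, forall w, forall m, (fun n => conj_moment (fun j : 'I_n => Z j w)
     (fun j => lam n j w) m) @ \oo --> b m} ->
  {ae P, forall w, forall n, (2 <= n)%N -> \sum_(j < n) normc (lam n j w) <= K * n%:R} ->
  {ae P, forall w, forall n, (2 <= n)%N -> delta * n%:R <= normc (\sum_(j < n) lam n j w)} ->
  hypotheses P (fun j => Z j) lam.
Proof.
move=> K0 delta0 exb cb lK ld.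
have l0 : {ae P, forall w, forall n, (2 <= n)%N -> \sum_(j < n) lam n j w != 0}.
  apply: filterS ld => w ld n n2; rewrite -normc_gt0 (lt_le_trans _ (ld n n2))//.
  by rewrite mulr_gt0// ltr0n ltnW.
split => //.
  exists (1 + K / delta); first by rewrite addr_gt0// divr_gt0.
  apply: filterS (filterI (ae_circle mu_circle Z_iid) (filterI l0 (filterI lK ld))).
  move=> w [z1 [l0w [lKw ldw]]] n n2 j jn.
  have [sz E] := gen_deriv_zeros (fun j : 'I_n => Z j w) (l0w _ n2).
  rewrite normrE_normc lecR.
  apply: (zeros_le (ltnW n2) (fun j => z1 j) delta0 (lKw n n2) (ldw n n2)).
  rewrite E rootZ ?root_prod_XsubC; first by apply: mem_nth; rewrite sz.
  rewrite lead_coef_eq0 -size_poly_gt0 size_gen_deriv//; first exact: ltnW.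
  exact: l0w.
exists K, delta, b; split => //; split.
- move=> m; apply: filterS cb => w; exact.
- apply: filterS lK => w h n n2; rewrite sum_norm_leE ?(ltnW n2)//; exact: h.
- apply: filterS ld => w h n n2; rewrite norm_sum_geE ?(ltnW n2)//; exact: h.
Qed.

End WeakConvergence.

(** * Characterization of the uniform distribution *)

Section Uniqueness.
Variable R : realType.
Local Open Scope complex_scope.

Section DistanceToClosed.
Variable U : set R[i].

Let D z := [set normc (z - w) | w in ~` U].

Definition dist_compl (z : R[i]) : R := inf (D z).

Let lbD z : has_lbound (D z).
Proof. by exists 0 => _ [w _ <-]; exact: normc_ge0. Qed.

Lemma dist_compl_ge0 z : 0 <= dist_compl z.
Proof.
rewrite /dist_compl -/(D z).
have [->|/set0P ne] := eqVneq (D z) set0; first by rewrite inf0.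
by apply: lb_le_inf => // _ [w _ <-]; exact: normc_ge0.
Qed.

Hypothesis neU : ~` U !=set0.

Let neD z : D z !=set0.
Proof. by case: neU => w Uw; exists (normc (z - w)), w. Qed.

Lemma dist_compl_lip z y : dist_compl z <= normc (z - y) + dist_compl y.
Proof.
rewrite -lerBlDl; apply: lb_le_inf => // _ [w Uw <-].
rewrite lerBlDl (@le_trans _ _ (normc (z - w)))//.
  by apply: ge_inf => //; exists w.
by rewrite (_ : z - w = (z - y) + (y - w)) ?le_normcD//; ring.
Qed.

Lemma continuous_dist_compl : continuous dist_compl.
Proof.
move=> z; apply/(@cvgrPdist_lt _ _ _ _ (nbhs_filter z)) => e e0.
have /(cvgC_normcP (nbhs_filter z))/(_ _ e0) := @cvg_id _ (nbhs z).
apply: filterS => t; apply: le_lt_trans; rewrite ler_norml.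
have h1 := dist_compl_lip z t; have h2 := dist_compl_lip t z.
rewrite -(normcN (t - z)) opprB in h2; apply/andP; split; lra.
Qed.

Lemma dist_compl_gt0 z : open U -> U z -> 0 < dist_compl z.
Proof.
rewrite openE => /(_ z) oU /oU /nbhs_normcP[e e0 eU].
apply: (lt_le_trans e0); apply: lb_le_inf => // _ [w Uw <-].
by rewrite leNgt; apply/negP => /eU.
Qed.

Lemma dist_compl_out z : ~ U z -> dist_compl z = 0.
Proof.
move=> Uz; apply/eqP; rewrite eq_le dist_compl_ge0 andbT.
by apply: ge_inf => //; exists z => //; rewrite subrr Normc.normc0.
Qed.
End DistanceToClosed.

(** Open sets form a generating pi-system, and the indicator of an open set is the increasing limit
    of min(1, n dist), with dist the distance to its complement. *)
Lemma measure_eq_of_integrals (mu nu : probability R[i] R) :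
  (forall f : R[i] -> R, continuous f -> (forall z, `|f z| <= 1) ->
     \int[mu]_z f z = \int[nu]_z f z) ->
  forall A, measurable A -> mu A = nu A.
Proof.
move=> H A mA.
have open_case U : open U -> mu U = nu U.
  move=> oU.
  (* For U everything the distance is an infimum over the empty set, with value 0, and the
     approximation below would give 0 instead of 1. *)
  have [UT|/set0P neU] := eqVneq (~` U) set0.
    have -> : U = setT by rewrite -(setCK U) UT setC0.
    by transitivity (1%E : \bar R); [exact: probability_setT|apply/esym; exact: probability_setT].
  pose f n z : R := Num.min 1 (n%:R * dist_compl U z).
  have f0 n z : 0 <= f n z.
    by rewrite le_min ler01/= mulr_ge0// dist_compl_ge0.
  have f1 n z : `|f n z| <= 1 by rewrite ger0_norm// ge_min lexx.
  have cf n : continuous (f n).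
    move=> z; apply: (@continuous_min _ _ (cst 1) (fun z => n%:R * dist_compl U z)).
      exact: cst_continuous.
    apply: (@cvgM R _ _ (nbhs_filter z)); first exact: cst_continuous.
    exact: continuous_dist_compl.
  have mf n : measurable_fun setT (f n) by exact: continuous_measurableC.
  have mU : measurable U by exact: measurable_openC.
  have lim (m : probability R[i] R) : (fun n => \int[m]_z (f n z)%:E)%E @ \oo --> m U.
    have -> : m U = (\int[m]_z (\1_U z)%:E)%E by rewrite integral_indic// setIT.
    rewrite [X in _ --> X](_ : _ = (\int[m]_z (lim ((f n z)%:E @[n --> \oo])))%E); last first.
      apply: eq_integral => z _; apply/esym/cvg_lim => //.
      apply: cvg_EFin; first by near=> n.
      rewrite indicE; have [zU|zU] := boolP (z \in U).
        rewrite inE in zU; have d0 := dist_compl_gt0 neU oU zU.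
        apply: cvg_near_cst; near=> n; apply/eqP; rewrite /= /f min_l//.
        rewrite -ler_pdivrMr//.
        near: n; exists (Num.truncn (1 / dist_compl U z)).+1 => // n /= hn.
        by apply/ltW/(lt_le_trans (truncnS_gt _)); rewrite ler_nat.
      apply: cvg_near_cst; near=> n; apply/eqP; rewrite /= /f dist_compl_out.
        by rewrite mulr0 min_r.
      by move=> Uz; move/negP: zU; apply; rewrite inE.
    apply: cvg_monotone_convergence => //.
    - by move=> n; apply/measurable_EFinP.
    - by move=> n z _; rewrite lee_fin.
    - move=> z _ i j ij; rewrite lee_fin /f le_min2//.
      by rewrite ler_wpM2r ?dist_compl_ge0// ler_nat.
  have := lim nu; have -> : (fun n => \int[nu]_z (f n z)%:E)%E = (fun n => \int[mu]_z (f n z)%:E)%E.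
    apply/funext => n.
    by rewrite !(EFin_bounded_integral _ (mf n) (f1 n)) H.
  move=> h; exact: (cvg_unique _ (lim mu) h).
apply: (measure_unique (@open R[i]) (fun _ => setT) _ _ _ _ mu nu) => //.
- exact: openI.
- by move=> _; exact: openT.
- by rewrite bigcup_const//; exists 0%N.
by rewrite -ge0_fin_numE// fin_num_measure.
Unshelve. all: by end_near. Qed.
End Uniqueness.

(** * Moments of the uniform distribution *)

Section UniformLaw.
Variable R : realType.
Local Open Scope complex_scope.

Definition expiR : measurableTypeR R -> R[i] := @expi R.

Lemma measurable_expiR : measurable_fun setT expiR.
Proof.
have mG : @measurable _ R[i] = <<s @open R[i] >> by [].
apply: (measurability _ mG) => //.
move=> _ [U oU <-]; rewrite setTI; apply: open_measurable.
by move/continuousP: (@continuous_expi R); apply.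
Qed.

HB.instance Definition _ := isMeasurableFun.Build _ _ _ _ expiR measurable_expiR.

Definition uniform_law : probability R[i] R :=
  distribution (uniform_prob (@pi2_gt0 R)) expiR.

Lemma uniform_law_circle : uniform_law (@unit_circle R) = 1%E.
Proof.
rewrite -[LHS]/(uniform_prob (@pi2_gt0 R) (@expi R @^-1` (@unit_circle R))).
rewrite (_ : _ @^-1` _ = setT); first exact: probability_setT.
by rewrite -subTset unit_circleE => t _ /=; rewrite -[LHS]/(normc (expi t)) normc_expi.
Qed.

Lemma uniform_on_circleP (mu : probability R[i] R) :
  uniform_on_circle mu <-> forall A, measurable A -> mu A = uniform_law A.
Proof. by []. Qed.

Lemma expiX (t : R) k : expi t ^+ k = expi (k%:R * t).
Proof.
elim: k => [|k IH]; first by rewrite mul0r /expi cos0 sin0.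
rewrite exprS IH -natr1 mulrDl mul1r [_ + t]addrC /expi cosD sinD.
by apply/eqP; rewrite eq_complex /= eqxx/= addrC.
Qed.

(** The fundamental theorem of calculus is applied to 1 + h, nonnegative because |h| <= 1; the
    contribution 1 of the constant is then subtracted. *)
Lemma integral_uniform_zero (h H : R -> R) :
  (forall t : R, is_derive t (1 : R) H (h t)) -> (forall t, `|h t| <= 1) -> continuous h ->
  H (2 * pi) = H 0 -> \int[uniform_prob (@pi2_gt0 R)]_t h t = 0.
Proof.
move=> dH h1 ch H0.
have mh : measurable_fun setT h by exact: continuous_measurable_fun.
have h0 t : 0 <= 1 + h t by move: (h1 t); rewrite ler_norml => /andP[]; lra.
have pi20 : 0 < 2 * pi :> R by exact: pi2_gt0.
have E : (\int[uniform_prob (@pi2_gt0 R)]_t (1 + h t)%:E = 1%E)%E.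
  rewrite integral_uniform//; last first.
    by apply/measurable_EFinP; exact: measurable_funD.
  have dF (t : R) : is_derive t (1 : R) (fun t : R => t + H t) (1 + h t).
    exact: is_deriveD.
  have cF (t : R) : (fun t : R => t + H t) @ t --> t + H t.
    have [dFt _] := dF t.
    by have /derivable1_diffP/differentiable_continuous := dFt.
  rewrite (@continuous_FTC2 _ (fun t => 1 + h t) (fun t => t + H t))//.
  - by rewrite H0 add0r -EFinB -EFinM subr0 addrK mulVf// gt_eqF.
  - apply: continuous_subspaceT => t; apply: cvgD; [exact: cvg_cst|exact: ch].
  - split.
    + by move=> t _; have [] := dF t.
    + by apply: cvg_at_right_filter; exact: cF.
    + by apply: cvg_at_left_filter; exact: cF.
  - by move=> t _; rewrite derive1E; exact: derive_val.
have mone : measurable_fun setT (fun t => 1 + h t) by exact: measurable_funD.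
have h2 t : `|1 + h t| <= 2.
  by rewrite (le_trans (ler_normD _ _))// normr1; have := h1 t; lra.
have := etrans (esym (EFin_bounded_integral (uniform_prob (@pi2_gt0 R)) mone h2)) E.
move=> [] e; have : 1 + \int[uniform_prob (@pi2_gt0 R)]_t h t = 1.
  rewrite -[RHS]e RintegralD//.
  - congr (_ + _); rewrite Rintegral_cst// mul1r [X in fine X](_ : _ = 1%E)//.
    exact: probability_setT.
  - exact: finite_measure_integrable_cst.
  - exact: (bounded_integrable (uniform_prob (@pi2_gt0 R)) mh h1).
by rewrite -[RHS]addr0 => /addrI.
Qed.

Lemma moment_uniform_law k : moment uniform_law k.+1 = 0.
Proof.
have k0 : k.+1%:R != 0 :> R by rewrite pnatr_eq0.
have push (g : R[i] -> R) : measurable_fun setT g -> (forall z, `|g z| <= 1) ->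
    \int[uniform_law]_z g z = \int[uniform_prob (@pi2_gt0 R)]_t g (expi t).
  move=> mg g1; congr fine; rewrite integral_distribution//.
    exact/measurable_EFinP.
  apply: (@bounded_integrable _ _ _ _ (fun t => g (expiR t)) 1) => //.
  exact: measurableT_comp.
have c1 (t : R) : `|cos t| <= 1 by rewrite ler_norml cos_geN1 cos_le1.
have s1 (t : R) : `|sin t| <= 1 by rewrite ler_norml sin_geN1 sin_le1.
have ccM : continuous (fun t : R => k.+1%:R * t).
  by move=> t; apply: cvgM; [exact: cvg_cst|exact: cvg_id].
have dk (t : R) : is_derive t (1 : R) (fun t : R => k.+1%:R * t) k.+1%:R.
  by have := is_deriveZ (k.+1%:R : R) (is_derive_id t (1 : R)); rewrite /GRing.scale/= mulr1.
have : expi (k.+1%:R * (2 * pi)) = 1 :> R[i].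
  by rewrite -expiX (_ : expi _ = 1) ?expr1n// /expi mulr_natl cos2pi sin2pi.
case=> cosk sink.
congr (_ +i* _).
  rewrite push; [|exact: measurable_rePow|exact: rePow_le1].
  rewrite (_ : (fun t => _) = (fun t : R => cos (k.+1%:R * t))); last first.
    by apply/funext => t; rewrite rePow_circle ?normc_expi// expiX.
  apply: (@integral_uniform_zero _ (fun t : R => k.+1%:R^-1 * sin (k.+1%:R * t))) => //.
  - move=> t.
    have := is_deriveZ k.+1%:R^-1 (is_derive1_comp (is_derive_sin (k.+1%:R * t)) (dk t)).
    by rewrite /GRing.scale/= mulrCA mulVf// mulr1.
  - move=> t; apply: continuous_comp; [exact: ccM|exact: continuous_cos].
  - by rewrite mulr0 sin0 sink.
rewrite push; [|exact: measurable_imPow|exact: imPow_le1].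
rewrite (_ : (fun t => _) = (fun t : R => sin (k.+1%:R * t))); last first.
  by apply/funext => t; rewrite imPow_circle ?normc_expi// expiX.
apply: (@integral_uniform_zero _ (fun t : R => - k.+1%:R^-1 * cos (k.+1%:R * t))) => //.
- move=> t.
  have := is_deriveZ (- k.+1%:R^-1) (is_derive1_comp (is_derive_cos (k.+1%:R * t)) (dk t)).
  by rewrite /GRing.scale/= mulNr mulNr mulrN opprK mulrCA mulVf// mulr1.
- move=> t; apply: continuous_comp; [exact: ccM|exact: continuous_sin].
- by rewrite mulr0 cos0 cosk.
Qed.

Lemma moment0 (mu : probability R[i] R) : mu (@unit_circle R) = 1%E -> moment mu 0 = 1.
Proof.
move=> mu1; apply/eqP; rewrite eq_complex /=; apply/andP; split; last first.
  rewrite (_ : imPow 0 = cst 0) ?Rintegral_cst// ?mul0r//.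
  by apply/funext => z; rewrite /imPow expr0 /= mul0r.
rewrite (_ : rePow 0 = \1_(@disc R)); last first.
  by apply/funext => z; rewrite /rePow expr0 /= mul1r.
have muD : mu (@disc R) = 1%E.
  apply/eqP; rewrite eq_le probability_le1//=; last exact: measurable_disc.
  rewrite -mu1; apply: le_measure; rewrite ?inE//.
  - exact: measurable_unit_circle.
  - exact: measurable_disc.
  - by rewrite unit_circleE => z /= z1; rewrite /disc/= z1.
rewrite /Rintegral integral_indic//; last exact: measurable_disc.
by rewrite setIT; apply/eqP; exact: (congr1 fine muD).
Qed.

(** Moments of nonnegative order suffice because continuous real functions are approximated on the
    circle by real parts of polynomials. *)
Lemma uniform_of_moments (mu : probability R[i] R) : mu (@unit_circle R) = 1%E ->
  (forall k, moment mu k.+1 = 0) -> uniform_on_circle mu.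
Proof.
move=> mu1 mk; apply/uniform_on_circleP; apply: measure_eq_of_integrals => f cf f1.
have mm k : moment mu k = moment uniform_law k.
  by case: k => [|k]; rewrite ?moment0 ?mk ?moment_uniform_law//; exact: uniform_law_circle.
have mf := continuous_measurableC cf.
apply/eqP; rewrite -subr_eq0 -normr_le0; apply/ler_addgt0Pr => e e0; rewrite add0r.
have e20 : 0 < e / 2 by rewrite divr_gt0.
have [p pE] := trig_approx cf f1 e20.
have h1 := Rintegral_trig_approx mu1 mf f1 pE.
have h2 := Rintegral_trig_approx uniform_law_circle mf f1 pE.
have eqp : \sum_(k < size p) p`_k * moment mu k = \sum_(k < size p) p`_k * moment uniform_law k.
  by apply: eq_bigr => k _; rewrite mm.
rewrite -eqp in h2.
move: h1 h2; set a := complex.Re _; rewrite !ler_norml => /andP[? ?] /andP[? ?].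
by apply/andP; split; lra.
Qed.

Lemma moment_uniform (mu : probability R[i] R) k : uniform_on_circle mu -> moment mu k.+1 = 0.
Proof.
move=> /uniform_on_circleP muU; rewrite -(moment_uniform_law k).
by congr (_ +i* _); congr fine; apply: eq_measure_integral => A mA _; exact: muU.
Qed.
End UniformLaw.

(** * The polar derivative and Sz.-Nagy's derivative *)

Section SpecialCases.
Context d (Omega : measurableType d) (R : realType).
Variables (P : probability Omega R) (mu : probability R[i] R).
Variable Z : nat -> {RV P >-> R[i]}.
Hypothesis mu_circle : mu (@unit_circle R) = 1%E.
Hypothesis Z_iid : iid Z mu.
Local Open Scope complex_scope.

(** The expectation integrates Z itself and the moment a cut-off power; they agree because Z lies on
    the circle almost surely. *)
Lemma CexpectationE : Cexpectation P (Z 0%N) = moment mu 1.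
Proof.
have push (g h : R[i] -> R) : continuous g -> measurable_fun setT h ->
    (forall z, `|h z| <= 1) -> (forall z, normc z = 1 -> g z = h z) ->
    fine 'E_P[fun w => g (Z 0%N w)] = \int[mu]_z h z.
  move=> cg mh h1 gh; rewrite unlock; congr fine.
  transitivity (\int[P]_w (h (Z 0%N w))%:E)%E.
    apply: ae_eq_integral => //.
    - apply/measurable_EFinP; apply: measurableT_comp => //.
      exact: continuous_measurableC.
    - by apply/measurable_EFinP; exact: measurableT_comp.
    by apply: filterS (ae_circle mu_circle Z_iid) => w z1 _; rewrite gh.
  rewrite -(@eq_measure_integral _ _ _ _ _ (distribution P (Z 0%N))).
    rewrite integral_distribution//; first exact/measurable_EFinP.
    apply: (@bounded_integrable _ _ _ _ (fun w => h (Z 0%N w)) 1) => //.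
    exact: measurableT_comp.
  by move=> A mA _; case: Z_iid => _; apply.
congr (_ +i* _); apply: push.
- exact: continuous_Re.
- exact: measurable_rePow.
- exact: rePow_le1.
- by move=> z z1; rewrite rePow_circle.
- exact: continuous_Im.
- exact: measurable_imPow.
- exact: imPow_le1.
- by move=> z z1; rewrite imPow_circle.
Qed.

Lemma cvgC_B (T : Type) (F : set_system T) {FF : Filter F} (f g : T -> R[i]) (a b : R[i]) :
  f @ F --> a -> g @ F --> b -> (fun t => f t - g t) @ F --> a - b.
Proof.
move=> /cvgC_normcP fa /cvgC_normcP gb; apply/cvgC_normcP => e e0.
have e20 : 0 < e / 2 by rewrite divr_gt0.
apply: filterS2 (fa _ e20) (gb _ e20) => t h1 h2.
rewrite (_ : _ - _ = (a - f t) - (b - g t)); last by ring.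
by rewrite (le_lt_trans (normcB_le _ _))// [ltRHS]splitr ltrD.
Qed.

(** On the circle the conjugate of xi - Z times Z^(m+1) is conj(xi) Z^(m+1) - Z^m, which gives b_m;
    the last hypothesis is b_0 != 0. The triangle inequality gives K = |xi| + 1 and delta = |xi| -
    1. *)
Lemma hypotheses_polar (lam : forall n, 'I_n -> Omega -> R[i]) (xi : R[i]) :
  polar_derivative_case P (fun j => Z j) lam xi -> 1 < normc xi ->
  xi^*%R * moment mu 1 != 1 -> hypotheses P (fun j => Z j) lam.
Proof.
move=> polar xi1 b0.
pose b m := xi^*%R * moment mu m.+1 - moment mu m.
have d0 : 0 < normc xi - 1 by rewrite subr_gt0.
have Z1 := ae_circle mu_circle Z_iid.
apply: (hypotheses_of_moments mu_circle Z_iid (K := normc xi + 1) (b := b) _ d0).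
- by rewrite ltr_wpDl ?normc_ge0.
- by exists 0%N; rewrite /b moment0// subr_eq0.
- apply: filterS (filterI Z1 (filterI polar (iid_moment_mean mu_circle Z_iid))).
  move=> w [z1 [lamE zm]] m.
  have : (fun n => xi^*%R * (n%:R^-1 * \sum_(j < n) Z j w ^+ m.+1) -
      n%:R^-1 * \sum_(j < n) Z j w ^+ m) @ \oo --> b m.
    apply: cvgC_B; last exact: zm.
    by apply: cvgC_M; [exact: cvg_cst|exact: zm].
  apply: cvg_trans; apply: near_eq_cvg; exists 2%N => // n /= n2.
  rewrite /conj_moment mulrCA -mulrBr; congr (_ * _).
  rewrite mulr_sumr -sumrB; apply: eq_bigr => j _.
  rewrite lamE// rmorphB mulrBl; congr (_ - _).
  rewrite [X in X * _](_ : _ = (Z j w)^-1); last exact: conjC_unit.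
  by rewrite exprS mulKf// -normc_gt0 z1.
- apply: filterS (filterI Z1 polar) => w [z1 lamE] n n2.
  rewrite (@le_trans _ _ (\sum_(j < n) (normc xi + 1)))//.
    by apply: ler_sum => j _; rewrite lamE// (le_trans (normcB_le _ _))// z1.
  by rewrite sumr_const card_ord mulr_natr.
- apply: filterS (filterI Z1 polar) => w [z1 lamE] n n2.
  rewrite (eq_bigr (fun j : 'I_n => xi - Z j w)) => [|j _]; last exact: lamE.
  rewrite sumrB sumr_const card_ord -[xi *+ n]mulr_natl.
  apply: le_trans (normcB_ge _ _); rewrite normcM normc_nat mulrBl mul1r mulrC lerD2l lerN2.
  rewrite (le_trans (normc_sum_le _ _ _))//.
  rewrite (eq_bigr (fun=> 1)) => [|j _]; last exact: z1.
  by rewrite sumr_const card_ord.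
Qed.

(** Degenerate coefficients form a deterministic array of weights, to which [iid_moment] applies.
    Positivity and the sum n give K = delta = 1. *)
Lemma hypotheses_SzNagy (lam : forall n, 'I_n -> Omega -> R[i]) :
  SzNagy_case P lam -> ~ uniform_on_circle mu -> hypotheses P (fun j => Z j) lam.
Proof.
move=> [lampos lamc [M' M'0 lamM]] nunif.
have [k mk] : exists k, moment mu k.+1 != 0.
  apply: contra_notP nunif => nk; apply: uniform_of_moments => // k.
  by apply/eqP/negPn/negP => mk; apply: nk; exists k.
(* [xget] picks the almost sure value; the default 0 can occur only for n < 2. *)
pose c n (j : 'I_n) : R[i] := xget 0 [set c | {ae P, forall w, lam n j w = c}].
have cE n j : (2 <= n)%N -> {ae P, forall w, lam n j w = c n j}.
  move=> n2; have [c0 c0E] := lamc n n2 j.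
  by rewrite /c; case: xgetP => [x _|] //= h; case: (h c0).
have cEw : {ae P, forall w, forall n, (2 <= n)%N -> forall j : 'I_n, lam n j w = c n j}.
  (* The ordinal index becomes a natural number i with a proof of i < n, so that almost sure
     statements can be joined over nat. *)
  have : {ae P, forall w, forall n, forall i, (2 <= n)%N -> forall h : (i < n)%N,
      lam n (Ordinal h) w = c n (Ordinal h)}.
    apply: ae_foralln => n; apply: ae_foralln => i.
    have [n2|] := leqP 2 n; last by move=> ?; apply: aeW.
    have [h|nh] := pselect (i < n)%N; last by apply: aeW.
    apply: filterS (cE n (Ordinal h) n2) => w e _ h'.
    by rewrite (bool_irrelevance h' h).
  apply: filterS => w h n n2 [i ilt]; exact: h.
pose a n i : R := if (2 <= n)%N then
  (if insub i is Some j then complex.Re (c n j) else 0) else 0.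
have aE n (j : 'I_n) : (2 <= n)%N -> a n j = complex.Re (c n j).
  by move=> n2; rewrite /a n2 valK.
have PF : ProperFilter (almost_everywhere P).
  apply: ae_properfilter_algebraOfSetsType.
  by rewrite [X in (_ < X)%E](_ : _ = 1%E) ?lte01//; exact: probability_setT.
(* One sample point at which all conditions hold transfers positivity, the bound and the sum to the
   constants. *)
have [w0 [cw0 [posw0 Mw0]]] := filter_ex (filterI cEw (filterI lampos lamM)).
have cpos n (j : 'I_n) : (2 <= n)%N -> [/\ 0 < complex.Re (c n j),
    complex.Re (c n j) <= M' & c n j = (complex.Re (c n j))%:C].
  move=> n2; have := (posw0 n n2).1 j; have := Mw0 n n2 j; rewrite cw0//.
  case: (c n j) => u v; rewrite lecE ltcE /= => /andP[_ ->] /andP[/eqP -> ->].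
  by split.
have sumc n : (2 <= n)%N -> \sum_(j < n) complex.Re (c n j) = n%:R.
  move=> n2; have := (posw0 n n2).2; rewrite (eq_bigr (fun j => c n j)) => [|j _]; last exact: cw0.
  by move=> /(congr1 (@complex.Re R)); rewrite Re_sum => ->; rewrite -(rmorph_nat (real_complex R)).
have aM n j : `|a n j| <= M'.
  rewrite /a; case: ifP => n2; last by rewrite normr0 ltW.
  case: insub => [i|]; last by rewrite normr0 ltW.
  by have [p1 p2 _] := cpos n i n2; rewrite gtr0_norm.
have Z1 := ae_circle mu_circle Z_iid.
apply: (hypotheses_of_moments mu_circle Z_iid (K := 1) (delta := 1)
  (b := fun m => moment mu m.+1)) => //.
- by exists k.
- apply: filterS (filterI cEw (iid_moment mu_circle Z_iid aM)) => w [lamE zm] m.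
  have : (fun n => n%:R^-1 * \sum_(j < n) (a n j)%:C * (Z j w ^+ m.+1 - moment mu m.+1) -
      (- moment mu m.+1)) @ \oo --> (0 : R[i]) - (- moment mu m.+1).
    by apply: cvgC_B; [exact: zm|exact: cvg_cst].
  rewrite sub0r opprK; apply: cvg_trans; apply: near_eq_cvg; exists 2%N => // n /= n2.
  rewrite /conj_moment.
  have n0 : (n%:R : R[i]) != 0 by rewrite pnatr_eq0 -lt0n ltnW.
  under eq_bigr do rewrite mulrBr.
  rewrite sumrB -mulr_suml (_ : \sum_(j < n) (a n j)%:C = n%:R); last first.
    rewrite -(rmorph_nat (real_complex R)) -(sumc _ n2) rmorph_sum.
    by apply: eq_bigr => j _; rewrite aE.
  rewrite mulrBr mulKf// subrK; congr (_ * _); apply: eq_bigr => j _.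
  congr (_ * _); rewrite lamE//; have [_ _ ->] := cpos n j n2.
  by rewrite aE//; apply/esym; exact: conjC_real.
- apply: filterS cEw => w lamE n n2; rewrite mul1r -(sumc _ n2).
  apply: ler_sum => j _; rewrite lamE//; have [p1 _ ->] := cpos n j n2.
  by rewrite normc_real/= gtr0_norm.
- apply: filterS lampos => w h n n2; rewrite mul1r (h n n2).2.
  by rewrite normc_nat.
Qed.

End SpecialCases.

Theorem corollary6 (R : realType) (d : measure_display)
    (Omega : measurableType d) (P : probability Omega R)
    (mu : probability R[i] R) (Z : nat -> {RV P >-> R[i]})
    (mu_circle : mu (@unit_circle R) = 1%E) (Z_iid : iid Z mu) :
  [/\ forall lam : forall n, 'I_n -> Omega -> R[i],
        hypotheses P Z lam -> as_weak_cvg P Z lam mu,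
      forall (lam : forall n, 'I_n -> Omega -> R[i]) (xi : R[i]),
        polar_derivative_case P Z lam xi ->
        (uniform_on_circle mu -> 1 < Normc.normc xi) ->
        (~ uniform_on_circle mu ->
           (maxe 1 ((Normc.normc (Cexpectation P (Z 0%N)))%:E^-1) < (Normc.normc xi)%:E)%E) ->
        hypotheses P Z lam /\ as_weak_cvg P Z lam mu
    & forall lam : forall n, 'I_n -> Omega -> R[i],
        ~ uniform_on_circle mu -> SzNagy_case P lam ->
        hypotheses P Z lam /\ as_weak_cvg P Z lam mu].
Proof.
have part1 lam : hypotheses P (fun j => Z j) lam -> as_weak_cvg P (fun j => Z j) lam mu.
  exact: weak_cvg_of_hypotheses.
split; first exact: part1.
- move=> lam xi polar hu hn.
  suff H : hypotheses P (fun j => Z j) lam by split => //; exact: part1.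
  have [unif|nunif] := pselect (uniform_on_circle mu).
    apply: (hypotheses_polar mu_circle Z_iid polar (hu unif)).
    by rewrite moment_uniform// mulr0 eq_sym oner_eq0.
  have := hn nunif; rewrite gt_max lte_fin => /andP[xi1 xim].
  apply: (hypotheses_polar mu_circle Z_iid polar xi1).
  (* If the first moment is 0 then b_0 = -1; otherwise b_0 = 0 would force |xi| = 1/|E Z|, which the
     bound on xi excludes. *)
  move: xim; rewrite (CexpectationE mu_circle Z_iid); have [->|m0] := eqVneq (moment mu 1) 0.
    by rewrite mulr0 eq_sym oner_eq0.
  have nm0 : 0 < Normc.normc (moment mu 1) by rewrite normc_gt0.
  rewrite inver gt_eqF// lte_fin => xim; apply/eqP => /(congr1 (@Normc.normc R)).
  rewrite Normc.normcM normc_conj Normc.normc1 => e.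
  by move: xim; rewrite -(ltr_pM2r nm0) mulVf ?gt_eqF// e ltxx.
move=> lam nunif nagy.
have H : hypotheses P (fun j => Z j) lam by exact: hypotheses_SzNagy nagy nunif.
by split => //; exact: part1.
Qed.
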